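(* Let $t_0$ be a labeled cotree with $k$ leaves, $n_v$ internal nodes, $n_=$ edges joining internal nodes with equal decorations and $n_{\neq}$ edges joining internal nodes with different decorations. Let $\mathcal V_{t_0}$ be the class of tuples $(t,a;\ell_1,\dots,\ell_k)$ where $t$ is a labeled canonical cotree, $a$ is a root-preserving automorphism of $t$, and $\ell_1,\dots,\ell_k$ are distinct leaves of $t$ such that (i) they induce the cotree $t_0$, and (ii) all deepest common ancestors of (at least two of) the marked leaves, and all their children having a marked leaf among their descendants, are fixed by $a$; let $V_{t_0}$ be its exponential generating function (size = number of leaves of $t$). Then $$V_{t_0}=U^\star\,(2U+1-z)^{n_v}\,(U^\bullet)^k\,(U^{\mathrm{odd}})^{n_=}\,(U^{\mathrm{even}})^{n_{\neq}},$$ where $U^\bullet(z)=zU'(z)$.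
   Context: A cotree is a rooted non-plane tree whose internal nodes have at least two children and each carry a decoration $0$ or $1$; labeled if its $n$ leaves are labeled $1,\dots,n$. It is canonical if every child of a node decorated $0$ (resp. $1$) is a leaf or decorated $1$ (resp. $0$). Induced cotree of $(t,(\ell_1,\dots,\ell_k))$: the labeled cotree with leaves $\ell_i$ (labeled $i$) and internal nodes the nodes of $t$ that are deepest common ancestors of at least two $\ell_i$, with ancestor relation and decorations inherited. An automorphism of a rooted tree is a bijection of its nodes preserving adjacency and fixing the root (not necessarily preserving labels). $\mathcal U$ is the class of pairs $(t,a)$ with $t$ a non-plane rooted tree with leaves labeled $1,\dots,n$, internal nodes having at least two children, and $a$ an automorphism of $t$; $U(z)$ is its exponential generating function by number of leaves. $U^\star(z)=\sum_{n\ge1}\frac{c_n}{(n-1)!}z^{n-1}$, $U^{\mathrm{even}}(z)=\sum_{n\ge1}\frac{c^e_n}{(n-1)!}z^{n-1}$, $U^{\mathrm{odd}}(z)=\sum_{n\ge1}\frac{c^o_n}{(n-1)!}z^{n-1}$, where $c_n$ counts $(t,a)\in\mathcal U$ with leaves labeled $1,\dots,n$ such that leaf $n$ is fixed by $a$, and $c^e_n$ (resp. $c^o_n$) those where moreover leaf $n$ is at even (resp. odd) distance from the root.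
   Formalization: The cotree t_0 is assumed to have k ≥ 2 leaves; for k = 1 (a single leaf) the formula fails, since V = 2zU' − z = z + 4z² + … while U*·U^• = z + 3z² + …. *)

(* Defs.v *)
From HB Require Import structures.
From mathcomp Require Import all_boot all_order all_fingroup all_algebra.
From mathcomp Require Import zify.

Set Implicit Arguments.
Unset Strict Implicit.
Unset Printing Implicit Defensive.

Import GRing.Theory.

(* The node set is an arbitrary finite type [N]; the (non-plane) rooted tree structure
   is a parent map, with the convention that the root is its own parent.  The
   leaf labels [1, ..., n] are shifted to ['I_n]. *)

Record ltree (n : nat) (N : finType) := LTree {
  troot : N;
  par : {ffun N -> N};
  lab : {ffun 'I_n -> N}
}.

Section LTreeFinite.
Variables (n : nat) (N : finType).

Definition ltree_val (t : ltree n N) := (troot t, par t, lab t).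
Definition ltree_of (u : N * {ffun N -> N} * {ffun 'I_n -> N}) : ltree n N :=
  LTree u.1.1 u.1.2 u.2.

Lemma ltree_valK : cancel ltree_val ltree_of.
Proof. by case. Qed.

HB.instance Definition _ := Finite.copy (ltree n N) (can_type ltree_valK).
End LTreeFinite.

Section LTree.
Variables (n : nat) (N : finType).
Implicit Types (t : ltree n N) (x y : N).

Definition child t x y : bool := (y != troot t) && (par t y == x).
Definition children t x : {set N} := [set y | child t x y].
Definition leaf t x : bool := children t x == set0.
Definition adj t x y : bool := child t x y || child t y x.

(* [x] is an ancestor of [y], reflexively. *)
Definition anc t x y : bool := fconnect (par t) y x.

(* The least [i] such that [iter i (par t) x = troot t]. *)
Definition depth t x : nat := findex (par t) x (troot t).

Definition is_ltree t : bool :=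
  [&& par t (troot t) == troot t,
      [forall x, anc t (troot t) x],
      [forall x, leaf t x || (2 <= #|children t x|)],
      injectiveb (lab t)
    & [forall x, leaf t x == (x \in codom (lab t))]].

Definition is_aut t (a : {perm N}) : bool :=
  [forall x, forall y, adj t (a x) (a y) == adj t x y]
  && (a (troot t) == troot t).

Definition is_dca t (S : {set N}) x : bool :=
  [forall l in S, anc t x l]
  && [forall y, [forall l in S, anc t y l] ==> anc t y x].

End LTree.

Definition ltree_iso (n : nat) (N N' : finType) (s : N -> N')
    (t : ltree n N) (t' : ltree n N') : bool :=
  [&& s (troot t) == troot t',
      [forall x, s (par t x) == par t' (s x)]
    & [forall i, s (lab t i) == lab t' i]].

(* [None] on the leaves, [Some false] and [Some true] for the decorations 0
   and 1 of the internal nodes. *)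
Record cotree (n : nat) (N : finType) := Cotree {
  ctree :> ltree n N;
  dec : {ffun N -> option bool}
}.

Section CotreeFinite.
Variables (n : nat) (N : finType).

Definition cotree_val (t : cotree n N) := (ctree t, dec t).
Definition cotree_of (u : ltree n N * {ffun N -> option bool}) : cotree n N :=
  Cotree u.1 u.2.

Lemma cotree_valK : cancel cotree_val cotree_of.
Proof. by case. Qed.

HB.instance Definition _ := Finite.copy (cotree n N) (can_type cotree_valK).
End CotreeFinite.

Section Cotree.
Variables (n : nat) (N : finType).
Implicit Types (t : cotree n N).

Definition is_cotree t : bool :=
  is_ltree t && [forall x, (dec t x == None) == leaf t x].

Definition canonical t : bool :=
  [forall x, forall y, child t x y ==> (leaf t y || (dec t y != dec t x))].

Definition n_int t : nat := #|[set x | ~~ leaf t x]|.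

Definition int_edges t : {set N * N} :=
  [set e | [&& child t e.1 e.2, ~~ leaf t e.1 & ~~ leaf t e.2]].
Definition n_eq t : nat := #|[set e in int_edges t | dec t e.1 == dec t e.2]|.
Definition n_neq t : nat := #|[set e in int_edges t | dec t e.1 != dec t e.2]|.

Variable k : nat.
Implicit Types (l : {ffun 'I_k -> N}).

Definition dcas t l : {set N} :=
  [set x | [exists A : {set 'I_k}, (2 <= #|A|) && is_dca t (l @: A) x]].

(* [f] identifies [t0] with the cotree induced by the marked leaves [l]. *)
Definition induces (N0 : finType) (t0 : cotree k N0) t l : bool :=
  [exists f : {ffun N0 -> N},
    [&& injectiveb f,
        [forall i, f (lab t0 i) == l i],
        f @: [set x | ~~ leaf t0 x] == dcas t l,
        [forall x, forall y, anc t0 x y == anc t (f x) (f y)]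
      & [forall x, dec t0 x == dec t (f x)]]].

(* A child which is itself a marked leaf counts as having a marked leaf among
   its descendants. *)
Definition fixes_dcas t (a : {perm N}) l : bool :=
  [forall x in dcas t l,
    (a x == x)
    && [forall y in children t x, [exists i, anc t y (l i)] ==> (a y == y)]].

End Cotree.

(* Only the leaves carry labels, so the objects with [n] leaves are the
   isomorphism classes of structures on the node sets ['I_m]; by [ltree_card]
   it is enough to consider [m < 2 n]. *)

Lemma sum_children (n : nat) (N : finType) (t : ltree n N) :
  \sum_x #|children t x| = #|N|.-1.
Proof.
have -> : \sum_x #|children t x| = \sum_x \sum_(y | child t x y) 1.
  by apply: eq_bigr => x _; rewrite sum1dep_card.
rewrite (exchange_big_dep (fun y => y != troot t)) /=; last first.
  by move=> x y _ /andP[].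
rewrite -(cardC1 (troot t)) -sum1_card; apply: eq_big => // y yr.
rewrite (big_pred1 (par t y)) // => x /=.
by rewrite /child yr /= eq_sym.
Qed.

Lemma ltree_card (n : nat) (N : finType) (t : ltree n N) :
  is_ltree t -> #|N| < n.*2.
Proof.
case/and5P=> _ _ /forallP t2 /injectiveP labI /forallP labP.
have lE : #|[set x | leaf t x]| = n.
  rewrite -[RHS]card_ord -(card_codom labI) cardsE; apply: eq_card => x.
  by rewrite -(eqP (labP x)).
have N0 : 0 < #|N| by apply/card_gt0P; exists (troot t).
have iE : #|[set x | leaf t x]| + #|[set x | ~~ leaf t x]| = #|N|.
  rewrite -(cardsC [set x | leaf t x]); congr (_ + _).
  by apply: eq_card => x; rewrite !inE.
have : #|[set x | ~~ leaf t x]|.*2 <= \sum_x #|children t x|.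
  rewrite (bigID (fun x => leaf t x)) /= -[leqLHS]add0n leq_add //.
  rewrite -muln2 -[#|[set _ | _]|]sum1dep_card big_distrl /= leq_sum // => x xl.
  by have := t2 x; rewrite (negbTE xl).
rewrite sum_children; move: iE; rewrite lE; lia.
Qed.

Section UClass.
Variables (n : nat) (N : finType).

Definition ustruct : finType := (ltree n N * {perm N})%type.

Definition Uclass : {set ustruct} := [set u | is_ltree u.1 && is_aut u.1 u.2].

Definition Uiso : rel ustruct := fun u v =>
  [exists s : {perm N},
    ltree_iso s u.1 v.1 && [forall x, s (u.2 x) == v.2 (s x)]].

End UClass.

Definition Ucount (n : nat) (P : forall N : finType, pred (ustruct n N)) : nat :=
  \sum_(m < n.*2)
    #|equivalence_partition (@Uiso n 'I_m) [set u in Uclass n 'I_m | P _ u]|.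

(* The leaf with the largest label. *)
Definition last_leaf (n : nat) (N : finType) (t : ltree n.+1 N) : N :=
  lab t ord_max.

Definition last_fixed (n : nat) (N : finType) : pred (ustruct n.+1 N) :=
  fun u => u.2 (last_leaf u.1) == last_leaf u.1.
Definition last_fixed_odd (n : nat) (N : finType) : pred (ustruct n.+1 N) :=
  fun u => last_fixed u && odd (depth u.1 (last_leaf u.1)).
Definition last_fixed_even (n : nat) (N : finType) : pred (ustruct n.+1 N) :=
  fun u => last_fixed u && ~~ odd (depth u.1 (last_leaf u.1)).

Section VClass.
Variables (k : nat) (N0 : finType) (t0 : cotree k N0) (n : nat) (N : finType).

Definition vstruct : finType :=
  (cotree n N * {perm N} * {ffun 'I_k -> N})%type.

Definition Vclass : {set vstruct} :=
  [set v : vstruct | let: (t, a, l) := v in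
    [&& is_cotree t, canonical t, is_aut t a,
        injectiveb l, [forall i, leaf t (l i)],
        induces t0 t l & fixes_dcas t a l]].

Definition Viso : rel vstruct := fun v w =>
  let: (t, a, l) := v in let: (t', a', l') := w in
  [exists s : {perm N},
    [&& ltree_iso s t t', [forall x, dec t x == dec t' (s x)],
        [forall x, s (a x) == a' (s x)] & [forall i, s (l i) == l' i]]].

End VClass.

Definition Vcount (k : nat) (N0 : finType) (t0 : cotree k N0) (n : nat) : nat :=
  \sum_(m < n.*2) #|equivalence_partition (@Viso k n 'I_m) (Vclass t0 n 'I_m)|.

Lemma Uiso_equiv (n : nat) (N : finType) : equivalence_rel (@Uiso n N).
Proof.
apply/equivalence_relP; split=> [u|u v /existsP[s]].
  apply/existsP; exists 1%g; rewrite /ltree_iso !perm1 eqxx /=.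
  by apply/andP; split; [apply/andP; split|]; apply/forallP=> x; rewrite !perm1.
case/andP=> /and3P[/eqP sr /forallP sp /forallP sl] /forallP sa w.
apply/existsP/existsP=> -[r /andP[/and3P[/eqP rr /forallP rp /forallP rl] /forallP ra]].
- exists (s^-1 * r)%g; rewrite /ltree_iso !permM -sr permK rr eqxx /=.
  apply/andP; split; [apply/andP; split|]; apply/forallP=> x; rewrite !permM.
  + by rewrite -(eqP (rp _)) -{1}(permKV s x) -(eqP (sp _)) permK.
  + by rewrite -(eqP (sl x)) permK (eqP (rl x)).
  + by rewrite -(eqP (ra _)) -{1}(permKV s x) -(eqP (sa _)) permK.
- exists (s * r)%g; rewrite /ltree_iso !permM sr rr eqxx /=.
  apply/andP; split; [apply/andP; split|]; apply/forallP=> x; rewrite !permM.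
  + by rewrite (eqP (sp x)) (eqP (rp _)).
  + by rewrite (eqP (sl x)) (eqP (rl x)).
  + by rewrite (eqP (sa x)) (eqP (ra _)).
Qed.

Lemma Viso_equiv (k n : nat) (N : finType) : equivalence_rel (@Viso k n N).
Proof.
apply/equivalence_relP; split=> [[[t a] l]|[[t a] l] [[t' a'] l'] /existsP[s]].
  apply/existsP; exists 1%g; rewrite /ltree_iso !perm1 eqxx /=.
  by apply/and4P; split; [apply/andP; split|..]; apply/forallP=> x; rewrite !perm1.
case/and4P=> /and3P[/eqP sr /forallP sp /forallP sl] /forallP sd /forallP sa /forallP sm.
case=> [[t2 a2] l2]; apply/existsP/existsP=> -[r].
all: case/and4P=> /and3P[/eqP rr /forallP rp /forallP rl] /forallP rd /forallP ra /forallP rm.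
- exists (s^-1 * r)%g; rewrite /ltree_iso !permM -sr permK rr eqxx /=.
  apply/and4P; split; [apply/andP; split|..]; apply/forallP=> x; rewrite !permM.
  + by rewrite -(eqP (rp _)) -{1}(permKV s x) -(eqP (sp _)) permK.
  + by rewrite -(eqP (sl x)) permK (eqP (rl x)).
  + by rewrite -(eqP (rd _)) (eqP (sd _)) permKV.
  + by rewrite -(eqP (ra _)) -{1}(permKV s x) -(eqP (sa _)) permK.
  + by rewrite -(eqP (sm x)) permK (eqP (rm x)).
- exists (s * r)%g; rewrite /ltree_iso !permM sr rr eqxx /=.
  apply/and4P; split; [apply/andP; split|..]; apply/forallP=> x; rewrite !permM.
  + by rewrite (eqP (sp x)) (eqP (rp _)).
  + by rewrite (eqP (sl x)) (eqP (rl x)).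
  + by rewrite (eqP (sd x)) (eqP (rd _)).
  + by rewrite (eqP (sa x)) (eqP (ra _)).
  + by rewrite (eqP (sm x)) (eqP (rm x)).
Qed.

(* Formal power series, given by their coefficient sequences. *)
Definition fps : Type := nat -> rat.

Declare Scope fps_scope.
Delimit Scope fps_scope with fps.
Bind Scope fps_scope with fps.
Local Open Scope ring_scope.

Definition fps_const (c : rat) : fps := fun n => if n == 0%N then c else 0.
Definition fps_X : fps := fun n => (n == 1%N)%:R.
Definition fps_add (f g : fps) : fps := fun n => f n + g n.
Definition fps_sub (f g : fps) : fps := fun n => f n - g n.
Definition fps_mul (f g : fps) : fps := fun n => \sum_(i < n.+1) f i * g (n - i)%N.
Definition fps_exp (f : fps) (k : nat) : fps := iter k (fps_mul f) (fps_const 1).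
Definition fps_deriv (f : fps) : fps := fun n => n.+1%:R * f n.+1.

Notation "1" := (fps_const 1%R) : fps_scope.
Notation "2" := (fps_const 2%R) : fps_scope.
Notation "f + g" := (fps_add f g) : fps_scope.
Notation "f - g" := (fps_sub f g) : fps_scope.
Notation "f * g" := (fps_mul f g) : fps_scope.
Notation "f ^+ k" := (fps_exp f k) : fps_scope.
Notation "'z" := fps_X : fps_scope.

Definition egf (c : nat -> nat) : fps := fun n => (c n)%:R / n`!%:R.

Definition U : fps := egf (fun n => Ucount (fun N => @predT (ustruct n N))).

(* The coefficient of [z^n] involves the trees with [n + 1] leaves: the leaf with
   the largest label is not counted in the size. *)
Definition Ustar : fps := egf (fun n => Ucount (@last_fixed n)).
Definition Uodd : fps := egf (fun n => Ucount (@last_fixed_odd n)).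
Definition Ueven : fps := egf (fun n => Ucount (@last_fixed_even n)).

Definition Ubullet : fps := ('z * fps_deriv U)%fps.

Definition V (k : nat) (N0 : finType) (t0 : cotree k N0) : fps := egf (Vcount t0).

(* Main.v *)
Require Import Defs.
From mathcomp Require Import all_boot all_order all_fingroup all_algebra.
From mathcomp Require Import zify ring.

(* Since the leaf labels make the structures rigid, each isomorphism class on [m]
   nodes accounts for [m!] structures on ['I_m]; and a structure with [n] leaves has
   [n!] labelings.  So every series of the theorem is the sum over [m] of [1/m!]
   times the sum of [z^(leaves)] over the unlabelled structures on ['I_m], and a
   product of such series counts the colourings of ['I_m] with a structure of the
   prescribed kind on each colour class.

   Write [f y] for the node of [t] corresponding to the node [y] of [t0].  Cutting all
   edges of [t] below the nodes [f v], [v] internal, leaves: for each internal [y] a stem,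
   i.e. a tree having [f y] as a leaf fixed by the automorphism; for each leaf [y]
   a tree pointed at [f y]; and for each internal [v] the forest of the trees without
   marked leaf hanging from [f v].  Condition (ii) says exactly that the automorphism
   preserves all these pieces.  The stems of the non-root nodes [y] have even or odd height
   according to whether the decorations of [y] and of its parent differ or agree, since
   decorations alternate along the branches of [t].  Finally, a forest with at
   least two trees is a tree with its root removed, so that the forests have the
   series [1 + U + (U - z)]. *)

Set Implicit Arguments.
Unset Strict Implicit.
Unset Printing Implicit Defensive.

Import GRing.Theory Num.Theory.

(** Cutting and gluing are awkward on isomorphism classes, so everything is done on concrete node
    sets: a tree or forest with its automorphism and marks is a single function on the nodes, and
    restricting it to a colour class is restricting that function. The nodes are the atoms of an
    exponential formula in which the number of leaves is a polynomial weight. Since unary nodes are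
    excluded, nodes are bounded by about twice the leaves; every coefficient is then a finite sum,
    and the node variable can be set to 1 at the end.

    That cutting is a bijection rests on two rigidity facts. The embedding [f] is determined by the
    marked leaves, because without unary nodes a node is determined by the leaves below it. The
    decorations of [t] are determined by that of the root of [t0] and by parities of heights. With
    [2 <= k] the root of [t0] is internal, so the top piece is a stem of either parity, whose parity
    decides the root decoration of [t]: hence [Ustar], without a factor 2. *)

Section Enumeration.

(** The hypotheses make [v |-> (r v, la v)] a bijection onto pairs of a good skeleton and an
    admissible decoration of it. It splits off the leaf labels of trees, stems and cotrees, and the
    mark of pointed trees. *)
Lemma card_fibration (T G L : finType) (S : {set T}) (good : pred G)
    (LB : G -> {set L}) (r : T -> G) (la : T -> L) :
    (forall v, v \in S -> good (r v) && (la v \in LB (r v))) ->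
    {in S &, forall v w, r v = r w -> la v = la w -> v = w} ->
    (forall g l, good g -> l \in LB g ->
       exists2 v, v \in S & r v = g /\ la v = l) ->
  #|S| = \sum_(g | good g) #|LB g|.
Proof.
move=> hS inj surj; rewrite -sum1_card (partition_big r good) /=; last first.
  by move=> v /hS/andP[].
apply: eq_bigr => g gg; rewrite sum1dep_card.
rewrite -(card_in_imset (f := la)) => [|v w]; last first.
  by rewrite !inE => /andP[vS /eqP <-] /andP[wS /eqP rE]; apply: inj.
apply: eq_card => l; apply/imsetP/idP => [[v + ->]|lg].
  by rewrite inE => /andP[/hS/andP[_ lP] /eqP <-].
by have [v vS [rE lE]] := surj g l gg lg; exists v; rewrite // inE vS rE eqxx.
Qed.

Lemma card_block_partition (T : finType) (R : rel T) (S : {set T}) (m : nat) :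
    equivalence_rel R ->
    (forall u, u \in S -> #|[set v in S | R u v]| = m) ->
  (#|equivalence_partition R S| * m = #|S|)%N.
Proof.
move=> eqR hm; symmetry; apply: card_uniform_partition; last first.
  by apply: equivalence_partitionP => x y z _ _ _; apply: eqR.
by move=> B /imsetP[u uS ->]; apply: hm.
Qed.

Definition labelings (n : nat) (N : finType) (L : {set N}) : {set {ffun 'I_n -> N}} :=
  [set f : {ffun 'I_n -> N} | injectiveb f && [forall x, (x \in L) == (x \in codom f)]].

Lemma card_labelings (n : nat) (N : finType) (L : {set N}) :
  #|L| = n -> #|labelings n L| = n`!.
Proof.
move=> Ln.
have -> : labelings n L =
    [set f : {ffun 'I_n -> N} in ffun_on (mem L) | injectiveb f].
  apply/setP=> f; rewrite !inE andbC; apply: andb_id2r => /injectiveP fI.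
  apply/forallP/ffun_onP => [fP i|fP x]; first by rewrite (eqP (fP _)) codom_f.
  have cL : codom f \subset L by apply/subsetP=> y /codomP[i ->]; apply: fP.
  have := (subset_leqif_card cL).2.
  rewrite card_codom // card_ord Ln eqxx => /esym /subsetP Lc.
  apply/eqP; apply/idP/idP => [/Lc //|/codomP[i ->]]; exact: fP.
by rewrite card_inj_ffuns_on card_ord Ln ffactnn.
Qed.

(** Swapping [x] and [y] in the values exchanges the labelings with last value [x] and those with
    last value [y], so the [n.+1] possible last values share the [n.+1!] labelings equally. *)
Lemma card_labelings_last (n : nat) (N : finType) (L : {set N}) (x : N) :
  #|L| = n.+1 -> x \in L ->
  #|[set f in labelings n.+1 L | f ord_max == x]| = n`!.
Proof.
move=> Ln xL; pose C y := [set f in labelings n.+1 L | f ord_max == y].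
have CE y : y \in L -> #|C y| = #|C x|.
  move=> yL; pose h (f : {ffun 'I_n.+1 -> N}) := [ffun i => tperm x y (f i)].
  have hK : involutive h by move=> f; apply/ffunP=> i; rewrite !ffunE tpermK.
  have tL z : (tperm x y z \in L) = (z \in L).
    by case: tpermP => [->|->|//]; rewrite xL yL.
  have hC f z : (f \in C z) -> h f \in C (tperm x y z).
    rewrite !inE => /andP[/andP[/injectiveP fI /forallP fL] /eqP fz].
    rewrite ffunE fz eqxx andbT; apply/andP; split.
      by apply/injectiveP=> i j; rewrite !ffunE => /perm_inj/fI.
    apply/forallP=> w; rewrite -tL (eqP (fL _)); apply/eqP.
    apply/codomP/codomP=> -[i wE]; exists i.
      by rewrite ffunE -wE tpermK.
    by rewrite wE ffunE tpermK.
  rewrite -(card_imset (pred_of_set (C y)) (inv_inj hK)); apply: eq_card => f; apply/imsetP/idP.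
    by case=> g /hC; rewrite tpermR => ? ->.
  by move/hC; rewrite tpermL; exists (h f); rewrite ?hK.
have : \sum_(y in L) #|C y| = n.+1`!.
  rewrite -(card_labelings Ln) -sum1_card.
  rewrite (partition_big (fun f : {ffun 'I_n.+1 -> N} => f ord_max) (mem L)) /=.
    by apply: eq_bigr => y _; rewrite -sum1_card; apply: eq_bigl => f; rewrite !inE.
  by move=> f; rewrite inE => /andP[_ /forallP/(_ (f ord_max))/eqP ->]; exact: codom_f.
rewrite (eq_bigr _ CE) sum_nat_const Ln factS => /eqP.
by rewrite eqn_pmul2l // => /eqP.
Qed.

End Enumeration.

Local Open Scope ring_scope.

Lemma deriv_prod (R : comNzRingType) (I : finType) (P : I -> {poly R}) :
  (\prod_i P i)^`() = \sum_i \prod_j (if j == i then (P j)^`() else P j).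
Proof.
rewrite -big_enum /= [RHS](eq_bigr (fun i =>
    \prod_(j <- enum I) (if j == i then (P j)^`() else P j)));
  last by move=> i _; rewrite big_enum.
rewrite -[RHS]big_enum /=.
elim: (enum I) (enum_uniq I) => [_|x r IHr /= /andP[xr ru]].
  by rewrite !big_nil derivC.
rewrite !big_cons derivM IHr // eqxx; congr (_ + _).
  congr (_ * _); rewrite big_seq [RHS]big_seq; apply: eq_bigr => j jr.
  by case: eqP jr xr => // -> ->.
rewrite mulr_sumr big_seq [RHS]big_seq; apply: eq_bigr => i ir.
rewrite big_cons; case: eqP ir xr => [-> ->|//].
by [].
Qed.

(* Both sides satisfy the same recursion: colouring one more point shifts one of
   the sequences, which is the product rule for the exponential generating
   functions. *)
Lemma sum_colorings (R : comNzRingType) (I : finType) (m : nat)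
    (f : I -> nat -> R) (P : I -> {poly R}) :
    (forall i j, (j <= m)%N -> f i j = (P i)`_j *+ j`!) ->
  \sum_(c : {ffun 'I_m -> I}) \prod_i f i #|[set x | c x == i]|
    = (\prod_i P i)`_m *+ m`!.
Proof.
elim: m f P => [|m IHm] f P fP.
  rewrite (big_pred1 [ffun x : 'I_0 => False_rect I (notF (ltn_ord x))]) => [|c]; last first.
    by apply/esym/eqP/ffunP=> -[].
  rewrite coef0_prod; apply: eq_bigr => i _; rewrite -[RHS]mulr1n -(fP i 0%N) //.
  by congr f; apply: eq_card0 => -[].
rewrite factS mulrnA -coef_deriv deriv_prod coef_sum -sumrMnl.
pose f' i0 i j := if i == i0 then f i j.+1 else f i j.
rewrite [RHS](eq_bigr (fun i0 =>
   \sum_(c : {ffun 'I_m -> I}) \prod_i f' i0 i #|[set x | c x == i]|)); last first.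
  move=> i0 _; rewrite -(IHm (f' i0)) // => i j jm; rewrite /f'; case: eqP => _.
    by rewrite fP // coef_deriv factS mulrnA.
  by rewrite fP // ltnW.
pose ext (u : I * {ffun 'I_m -> I}) : {ffun 'I_m.+1 -> I} :=
  [ffun x => if unlift ord0 x is Some y then u.2 y else u.1].
pose res (c : {ffun 'I_m.+1 -> I}) := (c ord0, [ffun y => c (lift ord0 y)]).
rewrite pair_bigA /= (reindex ext) /=; last first.
  exists res => [[i c] _|c _]; rewrite /res /ext.
    by congr (_, _); [rewrite ffunE unlift_none|apply/ffunP=> y; rewrite !ffunE liftK].
  by apply/ffunP=> x; rewrite !ffunE; case: unliftP => [y|] -> /=; rewrite ?ffunE.
apply: eq_bigr => -[i0 c] _ /=; apply: eq_bigr => i _; rewrite /f'.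
have -> : #|[set x | ext (i0, c) x == i]| = ((i == i0) + #|[set x | c x == i]|)%N.
  rewrite -!sum1dep_card big_mkcond /= big_ord_recl ffunE unlift_none /=.
  rewrite [in RHS]big_mkcond /=; congr (_ + _)%N; first by rewrite eq_sym; case: (i == i0).
  by apply: eq_bigr => j _; rewrite ffunE liftK.
by case: eqP.
Qed.

Local Close Scope ring_scope.

(** * Functional forests *)

Section Forest.
Variables (N : finType) (p : N -> N).

(** Roots are fixed points, so cycles of length one are allowed: every orbit has to end at one. *)
Definition acyclic := forall x, exists n, p (iter n p x) = iter n p x.

Definition top x : N := odflt x [pick y | (p y == y) && fconnect p x y].

(** [fingraph.order] counts the nodes on the path from [x] to its root, both ends included, hence
    the predecessor. *)
Definition height x : nat := (fingraph.order p x).-1.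

Lemma fconnectP x y : reflect (exists n, iter n p x = y) (fconnect p x y).
Proof.
apply: (iffP idP) => [/iter_findex <-|[n <-]]; last exact: fconnect_iter.
by exists (findex p x y).
Qed.

Lemma iter_fix n x : p x = x -> iter n p x = x.
Proof. by move=> px; elim: n => //= n ->. Qed.

Lemma fconnect_fix x y : p x = x -> fconnect p x y -> y = x.
Proof. by move=> px /fconnectP[n <-]; rewrite iter_fix. Qed.

Lemma acyclicP :
  (forall x, exists2 y, p y = y & fconnect p x y) -> acyclic.
Proof. by move=> h x; have [y py /fconnectP[n nE]] := h x; exists n; rewrite nE. Qed.

Lemma fconnect_total z x y :
  fconnect p z x -> fconnect p z y -> fconnect p x y || fconnect p y x.
Proof.
move=> /fconnectP[n <-] /fconnectP[m <-]; case: (leqP n m) => [nm|/ltnW nm].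
  by rewrite -(subnK nm) iterD fconnect_iter.
by rewrite -(subnK nm) iterD fconnect_iter orbT.
Qed.

Hypothesis pA : acyclic.

Lemma acyclic_ind (P : N -> Prop) :
    (forall x, p x = x -> P x) -> (forall x, p x <> x -> P (p x) -> P x) ->
  forall x, P x.
Proof.
move=> P0 PS x; have [n] := pA x; elim: n x => [|n IHn] x; first exact: P0.
have [/P0 //|nx] := eqVneq (p x) x; rewrite !iterSr => /IHn.
by apply: PS; apply/eqP.
Qed.

(** Going to [y] and back is a cycle through [x]. Running round it often enough passes the fixed
    point reached from [x], which must then be [x] itself. *)
Lemma fconnect_anti x y : fconnect p x y -> fconnect p y x -> x = y.
Proof.
move=> /fconnectP[n nE] /fconnectP[m mE].
case: n nE => [//|n nE].
have xE : iter (m + n.+1) p x = x by rewrite iterD nE.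
have xE' q : iter (q * (m + n.+1)) p x = x.
  by elim: q => //= q IHq; rewrite mulSn iterD IHq.
have [q qE] := pA x.
have : iter (q * (m + n.+1)) p x = iter q p x.
  have le : q <= q * (m + n.+1) by rewrite leq_pmulr // addnS.
  by rewrite -(subnK le) iterD iter_fix.
rewrite xE' => xq; rewrite -xq in qE.
by rewrite -nE iter_fix.
Qed.

Lemma topP x : p (top x) = top x /\ fconnect p x (top x).
Proof.
rewrite /top; case: pickP => [y /andP[/eqP]//|] /=.
have [n nE] := pA x => /(_ (iter n p x)).
by rewrite nE eqxx fconnect_iter.
Qed.

Lemma top_fix x : p (top x) = top x. Proof. by case: (topP x). Qed.

Lemma fconnect_top x : fconnect p x (top x). Proof. by case: (topP x). Qed.

Lemma top_unique x y : p y = y -> fconnect p x y -> top x = y.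
Proof.
move=> py xy; have [pt xt] := topP x.
by case/orP: (fconnect_total xy xt) => /fconnect_fix -> //.
Qed.

Lemma top_fconnect x y : fconnect p x y -> top x = top y.
Proof.
by move=> xy; apply: top_unique (top_fix _) (connect_trans xy (fconnect_top _)).
Qed.

Lemma top_step x : top (p x) = top x.
Proof. by apply/esym/top_fconnect/fconnect1. Qed.

Lemma fconnect_step x : p x <> x -> ~~ fconnect p (p x) x.
Proof.
move=> nx; apply/negP=> h; apply: nx; apply/esym.
by apply: fconnect_anti h; apply: fconnect1.
Qed.

Lemma height_fix x : p x = x -> height x = 0.
Proof.
move=> px; rewrite /height /fingraph.order (@eq_card _ _ (pred1 x)) ?card1 // => y.
rewrite !inE; apply/idP/eqP => [/(fconnect_fix px)//|->]; exact: connect0.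
Qed.

Lemma height_step x : p x <> x -> height x = (height (p x)).+1.
Proof.
move=> px; rewrite /height /fingraph.order.
rewrite (@eq_card _ (fconnect p x) [predU1 x & fconnect p (p x)]) => [|y]; last first.
  by rewrite !inE [LHS]fconnect_eqVf eq_sym.
rewrite cardU1 inE fconnect_step //=.
by case E: #|_| => [|//]; have := card0_eq E (p x); rewrite inE connect0.
Qed.

Lemma findex_height x r : p r = r -> fconnect p x r -> findex p x r = height x.
Proof.
move=> pr; elim/acyclic_ind: x => [x px /(fconnect_fix px) ->|x px IH xr].
  by rewrite findex0 height_fix.
have nxr : r != x by apply/eqP=> xE; apply: px; rewrite -xE.
rewrite height_step // -IH; last first.
  by move: xr; rewrite fconnect_eqVf eq_sym (negbTE nxr).
by have := fconnect_findex xr nxr.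
Qed.

(** A descendant of maximal height has no child. *)
Lemma leaf_below x :
  exists2 z, fconnect p z x & forall w, p w = z -> w = z.
Proof.
pose P z := fconnect p z x; have Px : P x by apply: connect0.
case: (arg_maxnP height Px) => z zx zM; exists z => // w wz.
apply/eqP/negPn/negP => /eqP nw.
have Pw : P w by apply: connect_trans zx; rewrite -wz fconnect1.
have : height w <= height z by exact: zM Pw.
by rewrite (height_step (x := w)) wz ?ltnn // => zw; apply: nw.
Qed.

Lemma fconnect_child x y : fconnect p y x -> y <> x ->
  exists w, [/\ p w = x, w <> x & fconnect p y w].
Proof.
elim/(acyclic_ind): y => [y py /(fconnect_fix py) -> //|y py IH].
have [pyx|/eqP pyx] := eqVneq (p y) x => yx nyx.
  by exists y; split=> //; apply: connect0.
move: yx; rewrite fconnect_eqVf; case: eqP => //= _ /IH[] // w [pw nw yw].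
by exists w; split=> //; apply: connect_trans yw; apply: fconnect1.
Qed.

End Forest.

Section ForestTransport.
Variables (N N' : finType) (h : N' -> N) (p : N -> N) (p' : N' -> N').
Variable A : {set N'}.
Hypothesis hI : injective h.
Hypothesis pA : {in A, forall x, p' x \in A}.
Hypothesis hp : {in A, forall x, p (h x) = h (p' x)}.

Lemma iter_transport n x : x \in A ->
  iter n p' x \in A /\ iter n p (h x) = h (iter n p' x).
Proof.
move=> xA; elim: n => //= n [nA ->]; split; first exact: pA.
by rewrite hp.
Qed.

Lemma fconnect_transport x y : x \in A ->
  fconnect p (h x) (h y) = fconnect p' x y.
Proof.
move=> xA; apply/fconnectP/fconnectP=> -[n nE]; exists n.
  by apply: hI; rewrite -nE; case: (iter_transport n xA).
by case: (iter_transport n xA) => _ ->; rewrite nE.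
Qed.

Lemma height_transport x : x \in A -> height p (h x) = height p' x.
Proof.
move=> xA; rewrite /height /fingraph.order; congr _.-1.
rewrite -(card_image hI); apply: eq_card => y; rewrite !inE.
apply/idP/imageP => [/fconnectP[n <-]|[z zx ->]].
  exists (iter n p' x); first by rewrite inE fconnect_iter.
  by case: (iter_transport n xA).
by rewrite fconnect_transport.
Qed.

End ForestTransport.

(** * Automorphism structures on subsets *)

(* The value at [x] gives the parent of [x] (roots being their own parents), the
   image of [x] under the automorphism, and whether [x] is marked. *)
Definition fstruct (N : finType) := {ffun N -> N * N * bool}.

(* [Stem o]: a tree with a marked fixed leaf, at odd height iff [b] when
   [o = Some b]; [Pointed]: a tree with a marked leaf, not necessarily fixed. *)
Inductive kind := Tree | Forest | Pointed | Stem of option bool | Void.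

Section Structures.
Variables (N : finType) (A : {set N}) (s : fstruct N).

Definition sp x := (s x).1.1.
Definition sa x := (s x).1.2.
Definition sm x := (s x).2.

Definition kids x : {set N} := [set y in A | (sp y == x) && (y != x)].
Definition rootset : {set N} := [set x in A | sp x == x].
Definition markset : {set N} := [set x in A | sm x].
Definition leafset : {set N} := [set x in A | kids x == set0].

(** An automorphism is encoded by commutation with the parent map, which already sends roots to
    roots, so one condition serves trees and forests. Bijectivity on [A] comes from injectivity once
    [supported] makes [A] stable. *)
Definition forest_aut : bool :=
  [forall x in A, [&& sa (sp x) == sp (sa x), #|kids x| != 1
     & [exists y in A, (sp y == y) && fconnect sp x y]]]
  && [forall x in A, forall y in A, (sa x == sa y) ==> (x == y)].

Definition of_kind (K : kind) : bool :=
  forest_aut &&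
  match K with
  | Tree => (#|rootset| == 1) && (#|markset| == 0)
  | Forest => #|markset| == 0
  | Pointed => [&& #|rootset| == 1, #|markset| == 1 & markset \subset leafset]
  | Stem o => [&& #|rootset| == 1, #|markset| == 1, markset \subset leafset
      & [forall x in markset, (sa x == x) &&
           (if o is Some b then odd (height sp x) == b else true)]]
  | Void => A == set0
  end.

Definition is_stem (K : kind) := if K is Stem _ then true else false.

(** The mark of a stem is left out: in [Ustar], [Uodd] and [Ueven] it is the leaf with the largest
    label, and after gluing it is an internal node. The mark of a pointed tree remains a leaf and is
    counted. *)
Definition weight (K : kind) : nat :=
  #|[set x in leafset | ~~ (is_stem K && sm x)]|.

(** Values outside [A] are frozen, so that each structure on [A] is represented by exactly one
    function on [N]. *)
Definition supported : bool :=
  [forall x, if x \in A then (sp x \in A) && (sa x \in A) else s x == (x, x, false)].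

End Structures.

Section StructTransport.
Variables (N N' : finType) (h : N' -> N) (A : {set N'}).
Variables (s : fstruct N) (s' : fstruct N').
Hypothesis hI : injective h.
Hypothesis pA : {in A, forall x, sp s' x \in A}.
Hypothesis aA : {in A, forall x, sa s' x \in A}.
Hypothesis hs : {in A, forall x, s (h x) = (h (sp s' x), h (sa s' x), sm s' x)}.

Let hp : {in A, forall x, sp s (h x) = h (sp s' x)}.
Proof. by move=> x xA; rewrite /sp hs. Qed.
Let ha : {in A, forall x, sa s (h x) = h (sa s' x)}.
Proof. by move=> x xA; rewrite /sa hs. Qed.
Let hm : {in A, forall x, sm s (h x) = sm s' x}.
Proof. by move=> x xA; rewrite /sm hs. Qed.

Let forall_im (P : pred N) (Q : pred N') : {in A, forall x, P (h x) = Q x} ->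
  [forall x in h @: A, P x] = [forall x in A, Q x].
Proof.
move=> PQ; apply/forall_inP/forall_inP => H x.
  by move=> xA; rewrite -PQ // H ?imset_f.
by case/imsetP=> y yA ->; rewrite PQ // H.
Qed.

Let exists_im (P : pred N) (Q : pred N') : {in A, forall x, P (h x) = Q x} ->
  [exists x in h @: A, P x] = [exists x in A, Q x].
Proof.
move=> PQ; apply/exists_inP/exists_inP => -[x].
  by case/imsetP=> y yA ->; rewrite PQ // => Qy; exists y.
by move=> xA Qx; exists (h x); rewrite ?PQ ?imset_f.
Qed.

Let filter_im (P : pred N) (Q : pred N') : {in A, forall x, P (h x) = Q x} ->
  [set x in h @: A | P x] = h @: [set x in A | Q x].
Proof.
move=> PQ; apply/setP=> x; rewrite inE; apply/andP/imsetP.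
  by case=> /imsetP[y yA ->]; rewrite PQ // => Qy; exists y; rewrite // inE yA.
by case=> y; rewrite inE => /andP[yA Qy] ->; rewrite imset_f // PQ.
Qed.

Let kidsE x : x \in A -> kids (h @: A) s (h x) = h @: kids A s' x.
Proof.
move=> xA; apply: filter_im => y yA; rewrite hp // !(inj_eq hI).
by [].
Qed.

Let rootsE : rootset (h @: A) s = h @: rootset A s'.
Proof. by apply: filter_im => x xA; rewrite hp // (inj_eq hI). Qed.

Let marksE : markset (h @: A) s = h @: markset A s'.
Proof. by apply: filter_im => x xA; rewrite hm. Qed.

Let leavesE : leafset (h @: A) s = h @: leafset A s'.
Proof. by apply: filter_im => x xA; rewrite kidsE // imset_eq0. Qed.

Lemma forest_aut_transport : forest_aut (h @: A) s = forest_aut A s'.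
Proof.
rewrite /forest_aut; congr (_ && _); apply: forall_im => x xA.
  rewrite kidsE // card_imset // hp // !ha ?pA // hp ?aA // (inj_eq hI).
  do 2 congr (_ && _); apply: exists_im => y yA; rewrite hp // (inj_eq hI).
  by rewrite (fconnect_transport hI pA hp).
by apply: forall_im => y yA; rewrite !ha // !(inj_eq hI).
Qed.

(** Used along an injection, to see that only the size of a set counts, and with [h] the identity,
    to see that the kind depends only on the values on [A]. *)
Lemma of_kind_transport K : of_kind (h @: A) s K = of_kind A s' K.
Proof.
rewrite /of_kind forest_aut_transport rootsE marksE leavesE !card_imset //.
rewrite imset_eq0; congr (_ && _); case: K => //.
  by congr [&& _, _ & _]; apply/subsetP/subsetP => H x;
    [move=> xA; have := H _ (imset_f h xA); rewrite mem_imset|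
     case/imsetP=> y yA ->; rewrite mem_imset // H].
move=> o; congr [&& _, _, _ & _].
  by apply/subsetP/subsetP => H x;
    [move=> xA; have := H _ (imset_f h xA); rewrite mem_imset|
     case/imsetP=> y yA ->; rewrite mem_imset // H].
apply/forall_inP/forall_inP => H x.
  move=> xM; have := H _ (imset_f h xM); move: xM; rewrite inE => /andP[xA _].
  by rewrite ha // (inj_eq hI) (height_transport hI pA hp).
case/imsetP=> y yM ->; have := H _ yM; move: yM; rewrite inE => /andP[xA _].
by rewrite ha // (inj_eq hI) (height_transport hI pA hp).
Qed.

Lemma weight_transport K : weight (h @: A) s K = weight A s' K.
Proof.
rewrite /weight leavesE -(card_imset _ hI); apply: eq_card => x; rewrite inE.
apply/andP/imsetP.
  case=> /imsetP[y yA ->] H; exists y => //; rewrite inE yA /=.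
  by move: yA H; rewrite inE => /andP[yA _]; rewrite hm.
case=> y; rewrite inE => /andP[yA H] ->; rewrite imset_f //; split=> //.
by move: yA H; rewrite inE => /andP[yA _]; rewrite hm.
Qed.

End StructTransport.

Local Open Scope ring_scope.

Definition mass (N : finType) (K : kind) (A : {set N}) : {poly rat} :=
  \sum_(s : fstruct N | supported A s && of_kind A s K) 'X^(weight A s K).

(** The coefficient of the m-th power of the node variable in a bivariate generating function,
    exponential in the nodes and ordinary in the leaves. *)
Definition emass (K : kind) (m : nat) : {poly rat} :=
  (m`!%:R^-1 : rat) *: mass K [set: 'I_m].

Lemma mass_transport (N N' : finType) (h : N' -> N) (K : kind) :
  injective h -> mass K (h @: [set: N']) = mass K [set: N'].
Proof.
move=> hI; pose A := h @: [set: N'].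
pose iv y x0 : N' := odflt x0 [pick x | h x == y].
have ivh x x0 : iv (h x) x0 = x.
  rewrite /iv; case: pickP => [z /eqP/hI //|/(_ x)]; by rewrite eqxx.
have hiv y x0 : y \in A -> h (iv y x0) = y by case/imsetP=> x _ ->; rewrite ivh.
pose push (s : fstruct N') : fstruct N := [ffun y =>
  if [pick x | h x == y] is Some x then (h (sp s x), h (sa s x), sm s x)
  else (y, y, false)].
pose pull (s : fstruct N) : fstruct N' := [ffun x =>
  (iv (sp s (h x)) x, iv (sa s (h x)) x, sm s (h x))].
have pushE s x : push s (h x) = (h (sp s x), h (sa s x), sm s x).
  rewrite ffunE; case: pickP => [z /eqP/hI -> //|/(_ x)]; by rewrite eqxx.
have pushN s y : y \notin A -> push s y = (y, y, false).
  rewrite ffunE; case: pickP => // x /eqP <- /imsetP[]; by exists x.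
have pushP s : supported A (push s).
  apply/forallP=> y; case: ifP => [/imsetP[x _ ->]|/negbT yA].
    by rewrite /sp /sa pushE /= !imset_f.
  by rewrite pushN.
have pullK s : supported A s -> push (pull s) = s.
  move=> /forallP sA; apply/ffunP=> y; have := sA y; case: ifP => yA; last first.
    by move/eqP->; rewrite pushN // yA.
  case/imsetP: yA => x _ -> /andP[pA aA]; rewrite pushE /sp /sa /sm ffunE /=.
  by rewrite !hiv // /sp /sa /sm; case: (s (h x)) => [[]].
have pushK s : pull (push s) = s.
  apply/ffunP=> x; rewrite ffunE {1}/sp {1}/sa {1}/sm !pushE /= !ivh.
  by rewrite /sp /sa /sm; case: (s x) => [[]].
have tr s := @of_kind_transport N N' h setT (push s) s hI
  (fun x _ => in_setT _) (fun x _ => in_setT _) (fun x _ => pushE s x) K.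
have tw s := @weight_transport N N' h setT (push s) s hI
  (fun x _ => pushE s x) K.
rewrite /mass (reindex_onto push pull) /= => [|s /andP[/pullK //]].
apply: eq_big => s; last by rewrite tw.
rewrite pushP tr pushK eqxx andbT /=; suff -> : supported setT s by [].
by apply/forallP=> x; rewrite !inE.
Qed.

(** Only the cardinality of [A] matters, by transport along an enumeration of [A]. This puts
    products over colour classes into the form of [sum_colorings]. *)
Lemma massE (N : finType) (K : kind) (A : {set N}) :
  mass K A = (#|A|`!%:R : rat) *: emass K #|A|.
Proof.
rewrite /emass scalerA divff ?scale1r ?pnatr_eq0 -?lt0n ?fact_gt0 //.
rewrite -(mass_transport K (@enum_val_inj _ (pred_of_set A))); congr mass.
apply/setP=> x; apply/idP/imsetP => [xA|[i _ ->]]; last exact: enum_valP.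
by exists (enum_rank_in xA x); rewrite ?enum_rankK_in.
Qed.

(** Independent structures on the colour classes amount to one structure on [N] whose two maps
    preserve colours; weights add, so monomials multiply. *)
Lemma mass_prod (N I : finType) (K : I -> kind) (c : {ffun N -> I}) :
  let A i := [set x | c x == i] in
  \prod_i mass (K i) (A i) =
  \sum_(s : fstruct N | [forall x, (c (sp s x) == c x) && (c (sa s x) == c x)]
                     && [forall i, of_kind (A i) s (K i)])
     'X^(\sum_i weight (A i) s (K i)).
Proof.
move=> A; rewrite /mass bigA_distr_big_dep /=.
have AE i x : (x \in A i) = (c x == i) by rewrite inE.
pose cut (s : fstruct N) : {ffun I -> fstruct N} :=
  [ffun i => [ffun x => if c x == i then s x else (x, x, false)]].
pose glue (u : {ffun I -> fstruct N}) : fstruct N := [ffun x => u (c x) x].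
have cutE s i x : c x = i -> cut s i x = s x by move=> ci; rewrite !ffunE ci eqxx.
have cutN s i x : c x != i -> cut s i x = (x, x, false).
  by move=> ci; rewrite !ffunE (negbTE ci).
have cutK s : glue (cut s) = s by apply/ffunP=> x; rewrite ffunE cutE.
have supE s : [forall i, supported (A i) (cut s i)] =
    [forall x, (c (sp s x) == c x) && (c (sa s x) == c x)].
  apply/forallP/forallP => H x.
    by have /forallP/(_ x) := H (c x); rewrite !AE eqxx /sp /sa cutE.
  apply/forallP=> y; rewrite !AE; case: eqP => [<-|/eqP /cutN -> //].
  by have := H y; rewrite /sp /sa cutE.
rewrite (reindex_onto cut glue) => [|u /familyP uP]; last first.
  apply/ffunP=> i; apply/ffunP=> x; rewrite !ffunE; case: eqP => [->//|ci].
  have /andP[/forallP/(_ x)] := uP i.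
  by rewrite AE; case: eqP ci => // _ _ /eqP.
rewrite (eq_bigl (fun s => [forall x, (c (sp s x) == c x) && (c (sa s x) == c x)]
    && [forall i, of_kind (A i) (cut s i) (K i)])) /= => [|s]; last first.
  rewrite cutK eqxx andbT -supE; apply/familyP/andP => [H|[/forallP H1 /forallP H2] i].
    by split; apply/forallP=> i; have /andP[] := H i.
  by apply/andP; split; [apply: H1|apply: H2].
have trK s i : [forall x, (c (sp s x) == c x) && (c (sa s x) == c x)] ->
    of_kind (A i) (cut s i) (K i) = of_kind (A i) s (K i) /\
    weight (A i) (cut s i) (K i) = weight (A i) s (K i).
  move=> /forallP sc; rewrite -{1 3}(imset_id (A i)).
  have hs : {in A i, forall x, cut s i (id x) = (id (sp s x), id (sa s x), sm s x)}.
    by move=> x; rewrite AE => /eqP ci; rewrite cutE // /sp /sa /sm; case: (s x) => [[]].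
  split; [apply: of_kind_transport => // x|exact: weight_transport];
  by rewrite !AE => /eqP <-; have /andP[] := sc x.
apply: eq_big => s; last first.
  case/andP=> sc _; rewrite -prodrXr; apply: eq_bigr => i _.
  by rewrite (trK s i sc).2.
apply: andb_id2l => sc; apply: eq_forallb => i; exact: (trK s i sc).1.
Qed.

Local Close Scope ring_scope.

(** * Generating functions *)

Section Bounds.
Variables (N : finType) (A : {set N}) (s : fstruct N).

Lemma sum_kids : supported A s -> \sum_(x in A) #|kids A s x| = #|A| - #|rootset A s|.
Proof.
move=> /forallP sA.
have -> : \sum_(x in A) #|kids A s x| =
    \sum_(x in A) \sum_(y in A | (sp s y == x) && (y != x)) 1.
  by apply: eq_bigr => x _; rewrite -sum1dep_card; apply: eq_bigl => y.
rewrite (exchange_big_dep (fun y => (y \in A) && (sp s y != y))) /=; last first.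
  by move=> x y xA /and3P[-> /eqP -> /=]; rewrite eq_sym.
have -> : #|A| - #|rootset A s| = #|[set x in A | sp s x != x]|.
  have <- : A :&: rootset A s = rootset A s by apply/setIidPr/subsetP=> x; rewrite inE => /andP[].
  rewrite -cardsD; apply: eq_card => x; rewrite !inE.
  by case: (x \in A) => //=; rewrite andbT.
rewrite -sum1dep_card; apply: eq_bigr => y /andP[yA py].
rewrite (big_pred1 (sp s y)) // => x /=; rewrite yA /= eq_sym.
have := sA y; rewrite yA => /andP[pA _].
by case: eqP => [->|_]; rewrite ?andbF // pA eq_sym py.
Qed.

(** Inner nodes have at least two kids, so twice their number is at most the number
    [#|A| - #|rootset A s|] of edges. *)
Lemma forest_card_bound : supported A s -> forest_aut A s ->
  #|A| + #|rootset A s| <= #|leafset A s|.*2.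
Proof.
move=> sA /andP[/forall_inP fA _].
have rA : #|rootset A s| <= #|A|.
  by apply/subset_leq_card/subsetP=> x; rewrite inE => /andP[].
have lA : leafset A s \subset A by apply/subsetP=> x; rewrite inE => /andP[].
have : #|A :\: leafset A s|.*2 <= \sum_(x in A) #|kids A s x|.
  rewrite (bigID (mem (leafset A s))) /= -[leqLHS]add0n leq_add //.
  rewrite -muln2 -sum1_card big_distrl /=.
  rewrite (eq_bigl (fun x => (x \in A) && (x \notin leafset A s))); last first.
    by move=> x; rewrite inE andbC.
  apply: leq_sum => x /andP[xA]; rewrite inE xA /= -card_gt0.
  have /and3P[_ + _] := fA x xA.
  by case: #|_| => [|[|]].
rewrite sum_kids // cardsD (setIidPr lA); have := subset_leq_card lA.
move: rA; lia.
Qed.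

(** The constant 2 pays for the one leaf that the weight of a stem omits. *)
Lemma weight_bound K : supported A s -> of_kind A s K ->
  #|A| <= (weight A s K).*2 + 2.
Proof.
move=> sA /andP[fA kA]; have := forest_card_bound sA fA.
suff : #|leafset A s| <= weight A s K + 1 by lia.
rewrite /weight; case: K kA => [_|_|_|o|_] /=; last 1 first; rewrite ?andbT.
all: try by rewrite (leq_trans _ (leq_addr _ _)) // subset_leq_card //;
  apply/subsetP=> x; rewrite !inE andbT.
case/and4P=> _ /eqP m1 _ _; rewrite -m1 addnC.
rewrite -(cardsID (markset A s) (leafset A s)) leq_add //.
  by rewrite subset_leq_card // subsetIr.
apply/subset_leq_card/subsetP=> x; rewrite !inE.
by case: (x \in A) => //= /andP[-> ->].
Qed.

End Bounds.

Local Open Scope ring_scope.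

Lemma mass_coef (N : finType) (K : kind) (A : {set N}) n :
  (mass K A)`_n = #|[set s | [&& supported A s, of_kind A s K & weight A s K == n]]|%:R.
Proof.
rewrite coef_sum -sum1dep_card natr_sum /=.
rewrite [RHS](eq_bigl (fun s => (supported A s && of_kind A s K) && (weight A s K == n)));
  last by move=> s; rewrite andbA.
rewrite [RHS]big_mkcondr; apply: eq_bigr => s _.
by rewrite coefXn eq_sym; case: eqP.
Qed.

Lemma emass_bound K m n : (n.*2 + 2 < m)%N -> (emass K m)`_n = 0.
Proof.
move=> nm; rewrite coefZ mass_coef; apply/eqP; rewrite mulf_eq0; apply/orP; right.
rewrite pnatr_eq0 cards_eq0; apply/eqP/setP=> s; rewrite !inE.
apply/negP=> /and3P[sA sK /eqP wn]; have := weight_bound sA sK.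
by rewrite cardsT card_ord wn leqNgt nm.
Qed.

(** By [emass_bound] no structure of weight [n] has more than [2n + 2] nodes, so this finite sum is
    the whole sum over [m]. *)
Definition series (K : kind) : fps := fun n => \sum_(m < n.*2 + 3) (emass K m)`_n.

Lemma seriesE K n M : (n.*2 + 3 <= M)%N -> series K n = \sum_(m < M) (emass K m)`_n.
Proof.
move=> nM; rewrite /series -(big_mkord xpredT (fun m => (emass K m)`_n)).
rewrite -[RHS](big_mkord xpredT (fun m => (emass K m)`_n)) [RHS](big_cat_nat (n := n.*2 + 3)) //=.
rewrite [X in _ = _ + X]big_nat_cond [X in _ = _ + X]big1 ?addr0 // => m.
by rewrite andbT => /andP[nm _]; rewrite emass_bound // -addnS.
Qed.

Section Truncation.
Variable n : nat.

(** [fps] is a bare function type; up to degree [n] a series is replaced by a polynomial, where ring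
    identities are at hand. *)
Definition agree (f : fps) (q : {poly rat}) := forall e, (e <= n)%N -> f e = q`_e.

Lemma agree_const c : agree (fps_const c) c%:P.
Proof. by move=> e _; rewrite coefC. Qed.

Lemma agree_mul f g q r : agree f q -> agree g r -> agree (fps_mul f g) (q * r).
Proof.
move=> fq gr e en; rewrite coefM; apply: eq_bigr => i _.
rewrite fq ?gr // (leq_trans _ en) ?leq_subr // -ltnS; exact: ltn_ord.
Qed.

Lemma agree_exp f q k : agree f q -> agree (fps_exp f k) (q ^+ k).
Proof.
move=> fq; elim: k => [|k IHk]; first by rewrite expr0 -polyC1; apply: agree_const.
by rewrite exprS; apply: agree_mul.
Qed.

Lemma agree_ext f g q : f =1 g -> agree f q -> agree g q.
Proof. by move=> fg fq e en; rewrite -fg fq. Qed.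

End Truncation.

(** The outer index counts nodes and the inner one leaves: the support lies below a line of slope 2.
    Intercepts add under products. *)
Definition slope (C : nat) (P : {poly {poly rat}}) :=
  forall m n, (n.*2 + C < m)%N -> P`_m`_n = 0.

Lemma slope_mul C D P Q : slope C P -> slope D Q -> slope (C + D) (P * Q).
Proof.
move=> hP hQ m n nm; rewrite coefM coef_sum big1 // => i _; rewrite coefM big1 // => j _.
have im : (i <= m)%N by rewrite -ltnS.
have jn : (j <= n)%N by rewrite -ltnS.
have [h|h] := ltnP (j.*2 + C) i; first by rewrite hP // mul0r.
rewrite hQ ?mulr0 //; lia.
Qed.

Lemma slope_prod (I : finType) (P : I -> {poly {poly rat}}) C :
  (forall i, slope C (P i)) -> slope (#|I| * C) (\prod_i P i).
Proof.
move=> hP; rewrite -big_enum cardE /=; elim: (enum I) => [|i r IHr].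
  rewrite big_nil => m n; rewrite coef1; case: m => // m _; exact: coef0.
by rewrite big_cons /= mulSn; apply: slope_mul.
Qed.

(** The exponential formula in the node variable, followed by setting that variable to 1. A product
    of truncated series also has terms with [M] or more nodes; the slope bound shows that they do
    not contribute at [n]. *)
Lemma series_prod (I : finType) (K : I -> kind) n M :
    (n.*2 + (#|I| * 2 + 3) <= M)%N ->
  \sum_(m < M) (m`!%:R^-1 *
    (\sum_(c : {ffun 'I_m -> I}) \prod_i mass (K i) [set x | c x == i])`_n)
  = (\prod_i \sum_(m < M) emass (K i) m)`_n.
Proof.
move=> nM; pose P i : {poly {poly rat}} := \poly_(m < M) emass (K i) m.
have PE i : \sum_(m < M) emass (K i) m = (P i).[1].
  rewrite horner_poly; apply: eq_bigr => m _; by rewrite expr1n mulr1.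
rewrite (eq_bigr _ (fun i _ => PE i)) -horner_prod.
have sP : slope (#|I| * 2) (\prod_i P i).
  apply: slope_prod => i m e em; rewrite coef_poly; case: ifP => _; last exact: coef0.
  exact: emass_bound.
have -> : (\prod_i P i).[1] = \sum_(m < maxn M (size (\prod_i P i))) (\prod_i P i)`_m.
  rewrite (horner_coef_wide _ (leq_maxr M _)); apply: eq_bigr => m _.
  by rewrite expr1n mulr1.
rewrite coef_sum -[RHS](big_mkord xpredT (fun m => (\prod_i P i)`_m`_n)).
rewrite [RHS](big_cat_nat (n := M)) ?leq_maxl //=.
rewrite [X in _ = _ + X]big_nat_cond [X in _ = _ + X]big1 ?addr0 => [|m]; last first.
  rewrite andbT => /andP[Mm _]; apply: sP; lia.
rewrite big_mkord; apply: eq_bigr => m _.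
under eq_bigr => c _ do under eq_bigr => i _ do rewrite massE.
rewrite (sum_colorings (f := fun i j => j`!%:R *: emass (K i) j) (P := P)); last first.
  move=> i j jm; rewrite coef_poly (leq_ltn_trans jm (ltn_ord m)).
  by rewrite scaler_nat.
rewrite coefMn -[X in _ * X]mulr_natl mulrA mulVf ?mul1r // pnatr_eq0 -lt0n fact_gt0 //.
Qed.

Lemma agree_series K n M : (n.*2 + 3 <= M)%N ->
  agree n (series K) (\sum_(m < M) emass K m).
Proof. by move=> nM e en; rewrite coef_sum (@seriesE _ _ M) //; lia. Qed.

Lemma sum_emass_void M : (0 < M)%N -> \sum_(m < M) emass Void m = 1.
Proof.
case: M => // M _; rewrite big_ord_recl big1 ?addr0 => [|i _]; last first.
  rewrite /emass /mass big_pred0 ?scaler0 // => s; apply/negP=> /and3P[_ _].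
  by rewrite -cards_eq0 cardsT card_ord.
pose s0 : fstruct 'I_0 := [ffun x => (x, x, false)].
rewrite /emass /mass (big_pred1 s0) => [|s]; last first.
  have -> : s = s0 by apply/ffunP=> -[].
  rewrite /= eqxx; apply/and3P; split; last 1 first.
  - by rewrite -cards_eq0 cardsT card_ord.
  - by apply/forallP=> -[].
  - by apply/andP; split; apply/forallP=> -[].
rewrite invr1 scale1r /weight (_ : #|_| = 0%N) ?expr0 //.
by apply: eq_card0 => -[].
Qed.

Local Close Scope ring_scope.

(** * Trees as functional graphs *)

Definition fkids (N : finType) (p : N -> N) x : {set N} :=
  [set y | (p y == x) && (y != x)].

Lemma kids_setT (N : finType) (s : fstruct N) x : kids setT s x = fkids (sp s) x.
Proof. by apply/setP=> y; rewrite !inE. Qed.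

Section TreeFacts.
Variables (n : nat) (N : finType) (t : ltree n N).

(** Restates the axioms through the parent map, the root being its fixed point: the form in which
    they compare with [forest_aut]. *)
Lemma is_ltreeP : reflect
  [/\ acyclic (par t), forall x, (par t x == x) = (x == troot t),
      forall x, #|fkids (par t) x| != 1, injective (lab t)
    & forall x, (fkids (par t) x == set0) = (x \in codom (lab t))]
  (is_ltree t).
Proof.
have cE (fx : forall x, (par t x == x) = (x == troot t)) x :
    children t x = fkids (par t) x.
  apply/setP=> y; rewrite !inE /child andbC; apply: andb_id2l => /eqP <-.
  by rewrite -fx eq_sym.
have leafE (fx : forall x, (par t x == x) = (x == troot t)) x :
  leaf t x = (fkids (par t) x == set0) by rewrite /leaf cE.
have lE k : (k == 0) || (2 <= k) = (k != 1) by case: k => [|[|]].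
apply: (iffP and5P) => [[/eqP r0 /forallP r1 /forallP b /injectiveP li /forallP lc]|].
  have fx x : (par t x == x) = (x == troot t).
    apply/eqP/eqP => [px|->//]; exact/esym/(fconnect_fix px)/r1.
  split=> // x; last 2 first.
  - by have := b x; rewrite leafE // cE // -cards_eq0 lE.
  - by rewrite -leafE // (eqP (lc x)).
  have /fconnectP[k kE] := r1 x; by exists k; rewrite kE.
case=> ac fx b li lc; split; last 1 first.
- by apply/forallP=> x; rewrite leafE // lc.
- by rewrite fx.
- apply/forallP=> x; have [/eqP + xt] := topP ac x.
  by rewrite fx => /eqP xE; rewrite /anc -xE.
- by apply/forallP=> x; rewrite leafE // cE // -cards_eq0 lE.
- exact/injectiveP.
Qed.

Hypothesis tT : is_ltree t.

Lemma ltree_acyclic : acyclic (par t). Proof. by case/is_ltreeP: tT. Qed.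

Lemma par_fix x : (par t x == x) = (x == troot t).
Proof. by case/is_ltreeP: tT. Qed.

Lemma par_root : par t (troot t) = troot t.
Proof. by apply/eqP; rewrite par_fix. Qed.

Lemma anc_root x : anc t (troot t) x.
Proof. by case/and5P: tT => _ /forallP. Qed.

Lemma childrenE x : children t x = fkids (par t) x.
Proof.
apply/setP=> y; rewrite !inE /child andbC; apply: andb_id2l => /eqP <-.
by rewrite -par_fix eq_sym.
Qed.

Lemma leafE x : leaf t x = (fkids (par t) x == set0).
Proof. by rewrite /leaf childrenE. Qed.

Lemma leaf_codom x : leaf t x = (x \in codom (lab t)).
Proof. by case/and5P: tT => _ _ _ _ /forallP/(_ x)/eqP. Qed.

Lemma leaf_lab i : leaf t (lab t i).
Proof. by rewrite leaf_codom codom_f. Qed.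

Lemma leaf_minimal x y : leaf t x -> anc t x y -> y = x.
Proof.
move=> lx xy; apply/eqP/negPn/negP=> /eqP yx.
have [w [pw wx _]] := fconnect_child ltree_acyclic xy yx.
by move: lx; rewrite leafE => /eqP/setP/(_ w); rewrite !inE pw eqxx; case: eqP.
Qed.

Lemma exists_label_below x : exists i, anc t x (lab t i).
Proof.
have [z zx zl] := leaf_below ltree_acyclic x.
have : leaf t z.
  rewrite leafE; apply/eqP/setP=> w; rewrite !inE.
  by apply/andP=> -[/eqP /zl ->]; rewrite eqxx.
by rewrite leaf_codom => /codomP[i zE]; exists i; rewrite /anc -zE.
Qed.

Lemma depth_height x : depth t x = height (par t) x.
Proof. exact: (findex_height ltree_acyclic par_root (anc_root x)). Qed.

(* A permutation preserving adjacency could only reverse the edge above [y]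
   by identifying [y] with its grandparent, which injectivity forbids. *)
Lemma is_autP (a : {perm N}) :
  reflect (forall x, a (par t x) = par t (a x)) (is_aut t a).
Proof.
have adjE x y : adj t x y = (x != y) && ((par t y == x) || (par t x == y)).
  rewrite /adj /child -!par_fix.
  have [->|xy] := eqVneq x y; first by rewrite !andNb.
  congr (_ || _); first by case: (par t y =P x) => [->|]; rewrite ?andbF ?andbT.
  by case: (par t x =P y) => [->|]; rewrite ?andbF ?andbT // eq_sym.
apply: (iffP andP) => [[/forallP aP /eqP ar] x|aP].
  elim/(acyclic_ind ltree_acyclic): x => [x px|x px IH].
    have /eqP -> : x == troot t by rewrite -par_fix px.
    by rewrite par_root ar par_root.
  have /forallP/(_ (par t x)) := aP x; rewrite !adjE eqxx orbT andbT.
  have nx : x != par t x by apply/eqP=> /esym.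
  rewrite (inj_eq perm_inj) nx => /eqP/orP[] /eqP; last by move->.
  rewrite -IH => /perm_inj pp.
  by have /negP[] := fconnect_step ltree_acyclic px; rewrite -{2}pp fconnect1.
split; last by rewrite -par_fix -aP par_root.
apply/forallP=> x; apply/forallP=> y.
by rewrite !adjE -!aP !(inj_eq perm_inj).
Qed.

End TreeFacts.

Section Relabeling.
Variables (n : nat) (N : finType).
Implicit Types (g h : {perm N}) (t : ltree n N).

Definition relabel g t : ltree n N :=
  LTree (g (troot t)) [ffun x => g (par t (g^-1%g x))] [ffun i => g (lab t i)].

Lemma par_relabel g t x : par (relabel g t) (g x) = g (par t x).
Proof. by rewrite ffunE permK. Qed.

Lemma ltree_isoE g t t' : ltree_iso g t t' = (t' == relabel g t).
Proof.
apply/and3P/eqP => [[/eqP tr /forallP tp /forallP tl]|->]; last first.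
  by split=> //=; apply/forallP=> x; rewrite ffunE ?permK.
case: t' tr tp tl => r p l /= <- tp tl; congr LTree; apply/ffunP=> x.
  by rewrite ffunE (eqP (tp _)) permKV.
by rewrite ffunE (eqP (tl _)).
Qed.

Lemma forall_perm g (P : pred N) : [forall x, P x] = [forall x, P (g x)].
Proof.
apply/forallP/forallP=> H x //; by rewrite -(permKV g x).
Qed.

Lemma anc_relabel g t x y : anc (relabel g t) (g x) (g y) = anc t x y.
Proof.
by apply: (fconnect_transport (A := setT) (@perm_inj _ g)) => // z _; rewrite ?inE ?par_relabel.
Qed.

Lemma child_relabel g t x y : child (relabel g t) (g x) (g y) = child t x y.
Proof. by rewrite /child par_relabel !(inj_eq perm_inj). Qed.

Lemma children_relabel g t x : children (relabel g t) (g x) = g @: children t x.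
Proof.
apply/setP=> y; rewrite -(permKV g y) mem_imset ?inE ?child_relabel //.
exact: perm_inj.
Qed.

Lemma leaf_relabel g t x : leaf (relabel g t) (g x) = leaf t x.
Proof. by rewrite /leaf children_relabel imset_eq0. Qed.

Lemma is_ltree_relabel g t : is_ltree (relabel g t) = is_ltree t.
Proof.
rewrite /is_ltree par_relabel (inj_eq perm_inj); congr [&& _, _, _, _ & _].
- by rewrite (forall_perm g); apply: eq_forallb => x; rewrite anc_relabel.
- rewrite (forall_perm g); apply: eq_forallb => x.
  by rewrite leaf_relabel children_relabel card_imset //; apply: perm_inj.
- apply/injectiveP/injectiveP => H i j.
    by move=> ij; apply: H; rewrite !ffunE ij.
  by rewrite !ffunE => /perm_inj/H.
rewrite (forall_perm g); apply: eq_forallb => x; rewrite leaf_relabel.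
congr (_ == _); apply/codomP/codomP=> -[i xi]; exists i; rewrite ?ffunE ?xi //.
by move: xi; rewrite ffunE => /perm_inj.
Qed.

Lemma is_aut_relabel g t (a : {perm N}) : is_aut (relabel g t) (a ^ g)%g = is_aut t a.
Proof.
rewrite /is_aut permJ (inj_eq perm_inj); congr (_ && _).
rewrite (forall_perm g); apply: eq_forallb => x.
rewrite (forall_perm g); apply: eq_forallb => y.
by rewrite /adj !permJ !child_relabel.
Qed.

Lemma depth_relabel g t x : is_ltree t ->
  depth (relabel g t) (g x) = depth t x.
Proof.
move=> tT; rewrite !depth_height ?is_ltree_relabel //.
apply: (height_transport (A := setT) (@perm_inj _ g)) => // z _; by rewrite ?inE ?par_relabel.
Qed.

(* Every node is the ancestor of a labelled leaf, whose image is prescribed. *)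
Lemma relabel_inj g h t : is_ltree t -> relabel g t = relabel h t -> g = h.
Proof.
move=> tT E; apply/permP=> x.
have [i /fconnectP[k <-]] := exists_label_below tT x.
elim: k => [|k IHk] /=.
  by move: (congr1 (fun u => lab u i) E); rewrite !ffunE.
by rewrite -!par_relabel IHk E.
Qed.

End Relabeling.

(** The last hypothesis says that relabeling the nodes is a free action, so every isomorphism class
    is an orbit of [m!] elements. *)
Lemma card_iso_classes (m : nat) (T : finType) (R : rel T) (S : {set T})
    (act : {perm 'I_m} -> T -> T) :
    equivalence_rel R -> (forall u v, R u v = [exists g, v == act g u]) ->
    (forall g u, u \in S -> act g u \in S) ->
    (forall g h u, u \in S -> act g u = act h u -> g = h) ->
  #|equivalence_partition R S| * m`! = #|S|.
Proof.
move=> eqR RE Sact inj; apply: card_block_partition => // u uS.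
rewrite -card_Sn -(card_imset (mem 'S_m) (f := act^~ u)); last first.
  by move=> g h; apply: inj.
apply: eq_card => v; rewrite !inE RE; apply/andP/imsetP.
  by case=> _ /existsP[g /eqP ->]; exists g; rewrite ?inE.
by case=> g _ ->; split; [exact: Sact|apply/existsP; exists g].
Qed.

Section UClasses.
Variables (n m : nat).
Notation N := 'I_m.

Definition Uact (g : {perm N}) (u : ustruct n N) : ustruct n N :=
  (relabel g u.1, (u.2 ^ g)%g).

Lemma UisoE u v : Uiso u v = [exists g, v == Uact g u].
Proof.
apply: eq_existsb => g; rewrite ltree_isoE -pair_eqE /=; congr (_ && _).
apply/forallP/eqP => [H|-> x]; last by rewrite permJ.
by apply/permP=> x; rewrite -(permKV g x) permJ (eqP (H _)).
Qed.

Lemma card_Uclasses (P : pred (ustruct n N)) :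
    (forall g u, u \in Uclass n N -> P u -> P (Uact g u)) ->
  #|equivalence_partition (@Uiso n N) [set u in Uclass n N | P u]| * m`!
    = #|[set u in Uclass n N | P u]|.
Proof.
move=> Pg; apply: (card_iso_classes (act := Uact)).
- exact: Uiso_equiv.
- exact: UisoE.
- move=> g u; rewrite [in X in X -> _]inE => /andP[uU Pu]; rewrite inE Pg // andbT.
  by move: uU; rewrite !inE /= is_ltree_relabel is_aut_relabel.
- by move=> g h [t a]; rewrite !inE => /andP[/andP[tT _] _] /(congr1 fst)/(relabel_inj tT).
Qed.

End UClasses.

(** * The series of trees with automorphisms *)

Definition to_struct (n : nat) (N : finType) (t : ltree n N) (a : {perm N})
  (b : pred N) : fstruct N := [ffun x => (par t x, a x, b x)].

Section StructLtree.
Variables (n : nat) (N : finType).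

Section FromLtree.
Variables (t : ltree n N) (a : {perm N}) (b : pred N).
Hypotheses (tT : is_ltree t) (aT : is_aut t a).
Let s := to_struct t a b.

Lemma sp_to_struct : sp s =1 par t. Proof. by move=> x; rewrite /sp ffunE. Qed.
Lemma sa_to_struct : sa s =1 a. Proof. by move=> x; rewrite /sa ffunE. Qed.
Lemma sm_to_struct : sm s =1 b. Proof. by move=> x; rewrite /sm ffunE. Qed.

Lemma fkids_to_struct x : fkids (sp s) x = fkids (par t) x.
Proof. by apply/setP=> y; rewrite !inE sp_to_struct. Qed.

Lemma rootset_to_struct : rootset setT s = [set troot t].
Proof. by apply/setP=> x; rewrite !inE sp_to_struct par_fix. Qed.

Lemma leafset_to_struct : leafset setT s = [set x | leaf t x].
Proof. by apply/setP=> x; rewrite !inE kids_setT fkids_to_struct leafE. Qed.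

Lemma forest_aut_to_struct : forest_aut setT s.
Proof.
have /is_ltreeP[_ _ br _ _] := tT.
apply/andP; split; apply/forall_inP=> x _; last first.
  by apply/forall_inP=> y _; rewrite !sa_to_struct (inj_eq perm_inj) implybb.
rewrite kids_setT fkids_to_struct br !sa_to_struct !sp_to_struct (elimT (is_autP tT a) aT) eqxx /=.
apply/exists_inP; exists (troot t) => //; rewrite sp_to_struct par_root // eqxx /=.
rewrite (eq_fconnect sp_to_struct); exact: anc_root.
Qed.

End FromLtree.

(** A converse to [to_struct]. The predicate [b] is quantified inside because for stems the mark is
    expressed through the tree just obtained. *)
Lemma of_struct (s : fstruct N) (l : {ffun 'I_n -> N}) :
    forest_aut setT s -> #|rootset setT s| == 1 ->
    l \in labelings n (leafset setT s) ->
  exists t a, [/\ is_ltree t, is_aut t a, forall b, b =1 sm s -> to_struct t a b = s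
    & lab t = l].
Proof.
move=> /andP[/forall_inP fs /forall_inP ais] /cards1P[r rE].
rewrite inE => /andP[/injectiveP lI /forallP lL].
have aI : injective (sa s).
  by move=> x y /eqP xy; have /forall_inP/(_ y (in_setT _))/implyP/(_ xy)/eqP := ais x (in_setT _).
pose t := LTree r [ffun x => sp s x] l; pose a := perm aI.
have pE : par t =1 sp s by move=> x; rewrite ffunE.
have kE x : fkids (par t) x = kids setT s x.
  by rewrite kids_setT; apply/setP=> y; rewrite !inE pE.
have tT : is_ltree t.
  apply/is_ltreeP; split=> //.
  - apply: acyclicP => x; have /and3P[_ _ /exists_inP[y _ /andP[/eqP py xy]]] := fs x (in_setT _).
    by exists y; rewrite ?pE // (eq_fconnect pE).
  - by move=> x; rewrite pE; have /setP/(_ x) := rE; rewrite !inE.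
  - by move=> x; rewrite kE; have /and3P[] := fs x (in_setT _).
  - by move=> x; rewrite kE; have := lL x; rewrite !inE => /eqP.
exists t, a; split=> //.
  apply/(is_autP tT) => x; rewrite !pE !permE.
  by have /and3P[/eqP] := fs x (in_setT _).
by move=> b bE; apply/ffunP=> x; rewrite !ffunE permE bE /sp /sa /sm; case: (s x) => [[]].
Qed.

Lemma labelings_lab (t : ltree n N) : is_ltree t ->
  lab t \in labelings n [set x | leaf t x].
Proof.
move=> tT; have /is_ltreeP[_ _ _ /injectiveP lI _] := tT; rewrite inE lI.
by apply/forallP=> x; rewrite inE leaf_codom.
Qed.

Lemma ltree_eq (t t' : ltree n N) : is_ltree t -> is_ltree t' ->
  par t =1 par t' -> lab t = lab t' -> t = t'.
Proof.
move=> tT tT' pp ll; have : troot t == troot t' by rewrite -par_fix // -pp par_root.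
case: t t' pp ll {tT tT'} => [r p l] [r' p' l'] /= pp -> /eqP ->; congr LTree.
exact/ffunP.
Qed.

End StructLtree.

Definition kindset (N : finType) (K : kind) (A : {set N}) (n : nat) :=
  [set s | [&& supported A s, of_kind A s K & weight A s K == n]].

Lemma supported_setT (N : finType) (s : fstruct N) : supported setT s.
Proof. by apply/forallP=> x; rewrite !inE. Qed.

Lemma to_struct_inj n (N : finType) (u v : ustruct n N) b b' :
  u \in Uclass n N -> v \in Uclass n N -> to_struct u.1 u.2 b = to_struct v.1 v.2 b' ->
  lab u.1 = lab v.1 -> u = v.
Proof.
case: u v => [t a] [t' a']; rewrite !inE => /andP[/= tT _] /andP[/= tT' _] /ffunP E ll.
congr (_, _); first by apply: ltree_eq => // x; move: (E x); rewrite !ffunE => -[].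
by apply/permP=> x; move: (E x); rewrite !ffunE => -[].
Qed.

Lemma card_U_tree n (N : finType) :
  #|[set u in Uclass n N | predT u]| = n`! * #|kindset Tree [set: N] n|.
Proof.
rewrite (card_fibration (good := [in kindset Tree [set: N] n])
  (LB := fun s => labelings n (leafset setT s))
  (r := fun u => to_struct u.1 u.2 pred0) (la := fun u => lab u.1)).
- rewrite mulnC -sum_nat_const; apply: eq_big => [//|s]; rewrite !inE => /and3P[_ _ /eqP w].
  apply: card_labelings; rewrite -w /weight; apply: eq_card => x; by rewrite !inE andbT.
- move=> [t a]; rewrite !inE => /andP[/andP[/= tT aT] _].
  have le : leafset setT (to_struct t a pred0) = [set x | leaf t x].
    exact: leafset_to_struct.
  rewrite supported_setT /of_kind forest_aut_to_struct // rootset_to_struct // cards1 /=.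
  have := labelings_lab tT; rewrite !inE => /andP[lI lL].
  rewrite lI le lL andbT /weight le /= cards_eq0 andbT; apply/andP; split.
    by apply/eqP/setP=> x; rewrite !inE sm_to_struct.
  rewrite (_ : [set _ in _ | _] = [set x in codom (lab t)]); last first.
    by apply/setP=> x; rewrite !inE leaf_codom // andbT.
  by rewrite cardsE card_codom ?card_ord //; apply/injectiveP.
- move=> u v; rewrite [in X in X -> _]inE => /andP[uU _].
  rewrite [in X in X -> _]inE => /andP[vU _]; exact: to_struct_inj uU vU.
move=> s l; rewrite inE => /and3P[_ /andP[fs /andP[rs /eqP ms]] _] lL.
have [t [a [tT aT tE <-]]] := of_struct fs rs lL; exists (t, a); first by rewrite !inE /= tT aT.
split=> //=; apply: tE => x; move/eqP: ms; rewrite cards_eq0 => /eqP/setP/(_ x).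
by rewrite !inE.
Qed.

Definition stem_pred (o : option bool) n (N : finType) : pred (ustruct n.+1 N) :=
  fun u => last_fixed u &&
    (if o is Some b then odd (depth u.1 (last_leaf u.1)) == b else true).

(** The label [ord_max] is turned into the mark, so an unlabelled stem only admits the labelings
    sending [ord_max] to its mark: [n!] of them for [n.+1] leaves. *)
Lemma card_U_stem o n (N : finType) :
  #|[set u in Uclass n.+1 N | stem_pred o u]| = n`! * #|kindset (Stem o) [set: N] n|.
Proof.
rewrite (card_fibration (good := [in kindset (Stem o) [set: N] n])
  (LB := fun s => [set l in labelings n.+1 (leafset setT s) | sm s (l ord_max)])
  (r := fun u => to_struct u.1 u.2 (pred1 (last_leaf u.1))) (la := fun u => lab u.1)).
- rewrite mulnC -sum_nat_const; apply: eq_big => [//|s]; rewrite !inE.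
  case/and3P=> _ /andP[_ /and4P[_ /cards1P[x mE] mL _]] /eqP w.
  have xL : x \in leafset setT s by apply: (subsetP mL); rewrite mE inE.
  have smE y : sm s y = (y == x) by have /setP/(_ y) := mE; rewrite !inE.
  rewrite -(@card_labelings_last n _ (leafset setT s) x) //.
    by apply: eq_card => l; rewrite !inE smE.
  rewrite (cardsD1 x) xL add1n -w /weight; congr _.+1; apply: eq_card => y.
  by rewrite !inE smE andbC.
- move=> [t a]; rewrite !inE => /andP[/andP[/= tT aT] /andP[/eqP /= lf ls]].
  set s := to_struct _ _ _.
  have le : leafset setT s = [set x | leaf t x] by exact: leafset_to_struct.
  have me : markset setT s = [set last_leaf t].
    by apply/setP=> x; rewrite !inE sm_to_struct.
  rewrite supported_setT /of_kind forest_aut_to_struct // rootset_to_struct // me !cards1 /=.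
  have := labelings_lab tT; rewrite !inE => /andP[lI lL].
  rewrite lI le lL sm_to_struct /= eqxx andbT.
  have -> : [set last_leaf t] \subset [set x | leaf t x].
    by apply/subsetP=> x; rewrite !inE => /eqP ->; apply: leaf_lab.
  have -> /= : [forall x in [set last_leaf t], (sa s x == x) &&
      match o with Some b => odd (height (sp s) x) == b | None => true end].
    apply/forall_inP=> x; rewrite inE => /eqP ->; rewrite sa_to_struct lf eqxx /=.
    case: (o) ls => // b; rewrite depth_height // /height /fingraph.order.
    rewrite (@eq_card _ (fconnect (sp s) (last_leaf t)) (fconnect (par t) (last_leaf t))) //.
    by move=> y; rewrite !inE (eq_fconnect (sp_to_struct t a _)).
  rewrite /weight le (_ : [set _ in _ | _] = [set x in codom (lab t)] :\ last_leaf t); last first.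
    by apply/setP=> x; rewrite !inE leaf_codom // sm_to_struct andbC.
  have lc : last_leaf t \in codom (lab t) by exact: codom_f.
  have := cardsD1 (last_leaf t) [set x in codom (lab t)].
  rewrite inE lc cardsE card_codom ?card_ord; last exact/injectiveP.
  by rewrite add1n => -[<-].
- move=> u v; rewrite [in X in X -> _]inE => /andP[uU _].
  rewrite [in X in X -> _]inE => /andP[vU _]; exact: to_struct_inj uU vU.
move=> s l; rewrite [in X in X -> _]inE => /and3P[_ /andP[fs +] _].
case/and4P=> rs /cards1P[x mE] ml /forall_inP ms.
rewrite [in X in X -> _]inE => /andP[lL smx].
have smE y : sm s y = (y == x) by have /setP/(_ y) := mE; rewrite !inE.
have [t [a [tT aT tE lE]]] := of_struct fs rs lL; subst l.
have E : to_struct t a (pred1 (last_leaf t)) = s.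
  by apply: tE => y; rewrite smE /=; move: smx; rewrite smE => /eqP <-.
exists (t, a) => //; rewrite !inE tT aT /=.
have : last_leaf t \in markset setT s by rewrite !inE.
have saE : sa s (last_leaf t) = a (last_leaf t) by rewrite -E sa_to_struct.
have spE : sp s =1 par t by move=> y; rewrite -E sp_to_struct.
move/ms; rewrite saE => /andP[lf]; rewrite /stem_pred /last_fixed /= lf /=.
case: (o) => // b; rewrite depth_height // /height /fingraph.order.
rewrite (@eq_card _ (fconnect (sp s) (last_leaf t)) (fconnect (par t) (last_leaf t))) //.
by move=> y; rewrite !inE (eq_fconnect spE).
Qed.

Lemma skeleton_ext (N : finType) (A : {set N}) (s s' : fstruct N) :
    sp s =1 sp s' -> sa s =1 sa s' ->
  [/\ forest_aut A s = forest_aut A s', rootset A s = rootset A s'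
    & leafset A s = leafset A s'].
Proof.
move=> pE aE; have kE x : kids A s x = kids A s' x.
  by apply/setP=> y; rewrite !inE pE.
split; last 2 first.
- by apply/setP=> x; rewrite !inE pE.
- by apply/setP=> x; rewrite !inE kE.
congr (_ && _); apply: eq_forallb => x; congr (_ ==> _); last first.
  by apply: eq_forallb => y; rewrite !aE.
rewrite !pE !aE kE; do 2 congr (_ && _).
by apply: eq_existsb => y; rewrite pE (eq_fconnect pE).
Qed.

(** The mark is a free choice among the [n] leaves, whatever the automorphism does to it. *)
Lemma card_pointed n (N : finType) :
  #|kindset Pointed [set: N] n| = n * #|kindset Tree [set: N] n|.
Proof.
pose mark (s : fstruct N) (M : {set N}) : fstruct N :=
  [ffun x => (sp s x, sa s x, x \in M)].
have mp s M : sp (mark s M) =1 sp s by move=> x; rewrite /sp ffunE.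
have ma s M : sa (mark s M) =1 sa s by move=> x; rewrite /sa ffunE.
have mm s M : markset setT (mark s M) = M by apply/setP=> x; rewrite !inE /sm ffunE.
rewrite (card_fibration (good := [in kindset Tree [set: N] n])
  (LB := fun s => [set [set x] | x in leafset setT s])
  (r := fun s => mark s set0) (la := fun s => markset setT s)).
- rewrite mulnC -sum_nat_const; apply: eq_big => [//|s]; rewrite !inE => /and3P[_ _ /eqP w].
  rewrite card_imset; last exact: set1_inj.
  by rewrite -w /weight; apply: eq_card => x; rewrite !inE andbT.
- move=> s; rewrite !inE /of_kind => /and3P[_ /andP[fs /and3P[rs /cards1P[x mE] mL]] ws].
  have [-> -> lE] := skeleton_ext setT (mp s set0) (ma s set0).
  rewrite supported_setT fs rs mm cards0 /weight lE ws /= mE imset_f //.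
  by apply: (subsetP mL); rewrite mE inE.
- move=> s s' _ _ /ffunP rE /setP mE; apply/ffunP=> x.
  move: (rE x) (mE x); rewrite !ffunE !inE /= /sp /sa /sm.
  by case: (s x) (s' x) => [[? ?] ?] [[? ?] ?] /= [-> ->] ->.
move=> s M; rewrite inE => /and3P[_ /andP[fs /andP[rs ms]] ws] /imsetP[x xL ->].
exists (mark s [set x]).
  have [E1 E2 lE] := skeleton_ext setT (mp s [set x]) (ma s [set x]).
  rewrite !inE /of_kind supported_setT E1 E2 fs rs mm cards1 lE sub1set xL /=.
  by rewrite /weight lE.
split; last exact: mm.
apply/ffunP=> y; rewrite ffunE mp ma inE; move: ms; rewrite cards_eq0 => /eqP/setP/(_ y).
by rewrite !inE /= /sp /sa /sm; case: (s y) => [[? ?] ?] /= ->.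
Qed.

(** * Adding a root to a forest *)

Section RootRemoval.
Variables (N : finType) (r : N) (s s' : fstruct N).
Hypothesis (sr : s r = (r, r, false)).
Hypothesis (pr : forall x, x != r -> sp s' x != r).
Hypothesis (ar : forall x, x != r -> sa s' x != r).
Hypothesis (spE : forall x, x != r -> sp s x = if sp s' x == x then r else sp s' x).
Hypothesis (saE : forall x, x != r -> sa s x = sa s' x).
Hypothesis (smE : forall x, x != r -> sm s x = sm s' x).
Let A := ~: [set r].

Let inA x : (x \in A) = (x != r). Proof. by rewrite !inE. Qed.
Let spr : sp s r = r. Proof. by rewrite /sp sr. Qed.
Let sar : sa s r = r. Proof. by rewrite /sa sr. Qed.

Lemma rootset_glue : rootset setT s = [set r].
Proof.
apply/setP=> x; rewrite !inE /=; have [->|xr] := eqVneq x r; first by rewrite spr eqxx.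
by rewrite spE //; case: ifP => // _; apply/negbTE; rewrite eq_sym.
Qed.

Lemma markset_glue : markset setT s = markset A s'.
Proof.
apply/setP=> x; rewrite !inE /=; have [->|xr] := eqVneq x r; first by rewrite /sm sr.
by rewrite smE.
Qed.

Lemma kids_glue_root : kids setT s r = rootset A s'.
Proof.
apply/setP=> x; rewrite !inE /= andbC; apply: andb_id2l => xr; rewrite spE //.
by case: (sp s' x =P x) => _; rewrite ?eqxx //; apply/negbTE/pr.
Qed.

Lemma kids_glue x : x != r -> kids setT s x = kids A s' x.
Proof.
move=> xr; apply/setP=> y; rewrite !inE /=.
have [->|yr] := eqVneq y r; first by rewrite spr eq_sym (negbTE xr).
rewrite spE //; case: (sp s' y =P y) => //= py; rewrite eq_sym (negbTE xr) /=.
by rewrite py andbN.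
Qed.

Lemma leafset_glue : rootset A s' != set0 -> leafset setT s = leafset A s'.
Proof.
move=> nr; apply/setP=> x; rewrite !inE /=; have [->|xr] := eqVneq x r.
  by rewrite kids_glue_root (negbTE nr).
by rewrite kids_glue.
Qed.

(** The roots of the forest become the children of [r], so the extra condition is that [r] does not
    have a single child. *)
Lemma forest_aut_glue :
  forest_aut setT s = forest_aut A s' && (#|rootset A s'| != 1).
Proof.
apply/andP/andP => -[].
  move=> /forall_inP f1 /forall_inP f2; split; last first.
    by have /and3P[_ + _] := f1 r (in_setT _); rewrite kids_glue_root.
  apply/andP; split; apply/forall_inP=> x; rewrite inA => xr; last first.
    apply/forall_inP=> y; rewrite inA => yr; rewrite -!saE //.
    by have /forall_inP/(_ y (in_setT _)) := f2 x (in_setT _).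
  have /and3P[/eqP cx + /exists_inP[y _ /andP[py xy]]] := f1 x (in_setT _).
  rewrite kids_glue // => ->; apply/andP; split.
    move: cx; rewrite (spE xr) (saE xr) (spE (ar xr)).
    case: (sp s' x =P x) => [px|px].
      rewrite sar px; case: (sp s' (sa s' x) =P _) => [->//|_ /esym/eqP].
      by rewrite (negbTE (pr (ar xr))).
    rewrite (saE (pr xr)); case: (sp s' (sa s' x) =P _) => [_ /eqP|_ -> //].
    by rewrite (negbTE (ar (pr xr))).
  have {py} yE : y = r.
    by apply/eqP; move/setP/(_ y): rootset_glue; rewrite !inE py.
  case/fconnectP: xy => k; rewrite {}yE; elim: k x xr {cx} => [x xr /= xE|k IHk x xr].
    by rewrite xE eqxx in xr.
  rewrite iterSr spE //; case: (sp s' x =P x) => [px _|px hk].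
    by apply/exists_inP; exists x; rewrite ?inA // px eqxx connect0.
  have /exists_inP[y' yA /andP[py xy]] := IHk _ (pr xr) hk.
  apply/exists_inP; exists y' => //; rewrite py /=.
  by apply: connect_trans xy; apply: fconnect1.
move=> /andP[/forall_inP f1 /forall_inP f2] r1; split; apply/forall_inP=> x _; last first.
  apply/forall_inP=> y _; have [->|xr] := eqVneq x r; have [->|yr] := eqVneq y r.
  - by rewrite !eqxx.
  - by rewrite sar saE // eq_sym (negbTE (ar yr)).
  - by rewrite sar saE // (negbTE (ar xr)).
  - by rewrite !saE //; have /forall_inP/(_ y) := f2 x (etrans (inA x) xr); rewrite inA => ->.
have [->|xr] := eqVneq x r.
  rewrite spr sar spr eqxx kids_glue_root r1 /=.
  by apply/exists_inP; exists r; rewrite // spr eqxx connect0.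
have /and3P[/eqP cx + /exists_inP[y yA /andP[/eqP py xy]]] := f1 x (etrans (inA x) xr).
rewrite kids_glue // => ->; apply/andP; split.
  rewrite (saE xr) (spE xr) (spE (ar xr)) -cx.
  case: (sp s' x =P x) => [->|px]; first by rewrite sar !eqxx.
  (* A non-root is not sent to a root: otherwise [x] and its parent would have the same image. *)
  rewrite saE ?pr //; case: (sa s' (sp s' x) =P sa s' x) => // ax; case: px; apply/eqP.
  by have /forall_inP/(_ x) := f2 _ (etrans (inA (sp s' x)) (pr xr)); rewrite inA ax eqxx; apply.
apply/exists_inP; exists r; rewrite // spr eqxx /=.
case/fconnectP: xy => k; elim: k x xr {cx} => [|k IHk] x xr.
  move=> /= xy; rewrite -{}xy in py; apply/fconnectP; exists 1.
  by rewrite /= spE // py eqxx.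
have [px _|px] := eqVneq (sp s' x) x.
  by apply/fconnectP; exists 1; rewrite /= spE // px eqxx.
rewrite iterSr => /IHk h; apply: connect_trans (h (pr xr)).
by rewrite -[sp s' x](_ : sp s x = _) ?fconnect1 // spE // (negbTE px).
Qed.

End RootRemoval.

Lemma forest_rootset_neq0 (N : finType) (A : {set N}) s :
  A != set0 -> forest_aut A s -> rootset A s != set0.
Proof.
case/set0Pn=> x xA /andP[/forall_inP/(_ x xA)/and3P[_ _ /exists_inP[y yA /andP[py _]]] _].
by apply/set0Pn; exists y; rewrite inE yA.
Qed.

Local Open Scope ring_scope.

(** Removing [r] leaves a forest whose number of trees is not one, counted as forests minus trees.
    Since [r] is not the only node it is not a leaf, so the weight is unchanged. *)
Lemma mass_tree_root (N : finType) (r : N) : (1 < #|N|)%N ->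
  \sum_(s : fstruct N | of_kind setT s Tree && (sp s r == r)) 'X^(weight setT s Tree)
  = mass Forest (~: [set r]) - mass Tree (~: [set r]).
Proof.
move=> N2; set A := ~: [set r].
have inA x : (x \in A) = (x != r) by rewrite !inE.
have A0 : A != set0 by rewrite -card_gt0 cardsC1; case: #|N| N2 => [|[]].
have -> : mass Forest A - mass Tree A = \sum_(s : fstruct N | supported A s &&
     [&& forest_aut A s, #|markset A s| == 0 & #|rootset A s| != 1]%N) 'X^(weight A s Tree).
  rewrite /mass [X in X - _](bigID (fun s => #|rootset A s| == 1%N)) /=.
  rewrite [X in X + _ - _](eq_bigl (fun s => supported A s && of_kind A s Tree)).
    rewrite addrAC subrr add0r; apply: eq_bigl => s; by rewrite /of_kind !andbA.
  move=> s; rewrite /of_kind /=.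
  by case: (supported A s) => //; case: (forest_aut A s) => //=; rewrite andbC.
(* [cut] gives [r] the default value and makes its kids roots; [glue] hangs the roots back on
   [r]. *)
pose cut (s : fstruct N) : fstruct N := [ffun x => if x == r then (r, r, false)
  else (if sp s x == r then x else sp s x, sa s x, sm s x)].
pose glue (s : fstruct N) : fstruct N := [ffun x => if x == r then (r, r, false)
  else (if sp s x == x then r else sp s x, sa s x, sm s x)].
have cutr s : cut s r = (r, r, false) by rewrite ffunE eqxx.
have gluer s : glue s r = (r, r, false) by rewrite ffunE eqxx.
have cutN s x : x != r -> cut s x = (if sp s x == r then x else sp s x, sa s x, sm s x).
  by move=> xr; rewrite ffunE (negbTE xr).
have glueN s x : x != r -> glue s x = (if sp s x == x then r else sp s x, sa s x, sm s x).
  by move=> xr; rewrite ffunE (negbTE xr).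
have glueP s : (forall x, x != r -> sp s x != r) ->
    (forall x, x != r -> sp (glue s) x = if sp s x == x then r else sp s x).
  by move=> sr x xr; rewrite {1}/sp glueN.
have glueA s x : x != r -> sa (glue s) x = sa s x by move=> xr; rewrite {1}/sa glueN.
have glueM s x : x != r -> sm (glue s) x = sm s x by move=> xr; rewrite {1}/sm glueN.
have supP s : supported A s -> [/\ s r = (r, r, false),
    forall x, x != r -> sp s x != r & forall x, x != r -> sa s x != r].
  move=> /forallP sA; split=> [|x xr|x xr].
  - by have := sA r; rewrite !inA eqxx => /eqP.
  - by have := sA x; rewrite !inA xr => /andP[].
  - by have := sA x; rewrite !inA xr => /andP[].
have glueK s : supported A s -> cut (glue s) = s.
  move=> /supP[sr sp1 _]; apply/ffunP=> x; have [->|xr] := eqVneq x r; first by rewrite cutr sr.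
  rewrite cutN // glueP // glueA // glueM //; case: (sp s x =P x) => px.
    by rewrite eqxx -{1}px /sp /sa /sm; case: (s x) => [[]].
  by rewrite (negbTE (sp1 _ xr)) /sp /sa /sm; case: (s x) => [[]].
have treeP s : of_kind setT s Tree -> sp s r = r ->
    [/\ s r = (r, r, false), forall x, x != r -> sp s x != x & forall x, x != r -> sa s x != r].
  move=> /andP[/andP[/forall_inP f1 /forall_inP f2] /andP[/cards1P[r' rE] m0]] pr.
  have rootE x : (sp s x == x) = (x == r).
    have /setP/(_ r) := rE; rewrite !inE pr eqxx => /esym/eqP ->.
    by have /setP/(_ x) := rE; rewrite !inE.
  have ar : sa s r = r.
    apply/eqP; rewrite -rootE; have /and3P[/eqP <- _ _] := f1 r (in_setT _).
    by rewrite pr.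
  split=> [|x xr|x xr]; last 2 first.
  - by rewrite rootE.
  - have := f2 x (in_setT _) => /forall_inP/(_ r (in_setT _)); rewrite ar (negbTE xr).
    by case: eqP.
  move: m0; rewrite cards_eq0 => /eqP/setP/(_ r); rewrite !inE /= => mr.
  by move: pr ar mr; rewrite /sp /sa /sm; case: (s r) => [[? ?] ?] /= -> -> ->.
rewrite (reindex_onto glue cut) /= => [|s /andP[sT /eqP pr]]; last first.
  have [sr s1 s2] := treeP s sT pr.
  apply/ffunP=> x; have [->|xr] := eqVneq x r; first by rewrite gluer sr.
  rewrite glueN // /sp /sa /sm cutN //= -/(sp s x).
  have [px|px] := eqVneq (sp s x) r; first by rewrite eqxx -px /sp /sa /sm; case: (s x) => [[]].
  by rewrite (negbTE (s1 _ xr)) /sp /sa /sm; case: (s x) => [[]].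
have key s : supported A s ->
    [/\ forest_aut setT (glue s) = forest_aut A s && (#|rootset A s| != 1)%N,
        rootset setT (glue s) = [set r], markset setT (glue s) = markset A s
      & rootset A s != set0 -> leafset setT (glue s) = leafset A s].
  move=> /supP[sr sp1 sa1]; split.
  - by apply: forest_aut_glue => //; [exact: glueP|exact: glueA].
  - by apply: rootset_glue => //; exact: glueP.
  - by apply: markset_glue => //; exact: glueM.
  - by apply: leafset_glue => //; exact: glueP.
have sp_gluer s : sp (glue s) r = r by rewrite /sp gluer.
have supL s : of_kind setT (glue s) Tree -> cut (glue s) = s -> supported A s.
  move=> sT cg; have [_ _ ga] := treeP _ sT (sp_gluer s).
  apply/forallP=> x; rewrite !inA; have [->|xr] := eqVneq x r.
    by rewrite /= -[s]cg cutr.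
  rewrite -cg /sp /sa cutN //= ga // andbT.
  by case: (sp (glue s) x =P r) => [//|/eqP].
have wE s : supported A s -> forest_aut A s -> weight setT (glue s) Tree = weight A s Tree.
  move=> sA fs; have [_ _ _ lE] := key s sA.
  by rewrite /weight lE //; apply: forest_rootset_neq0.
apply: eq_big => s; last first.
  move=> /andP[/andP[sT _] /eqP cg]; have sA := supL s sT cg.
  rewrite wE //; have [fE _ _ _] := key s sA.
  by case/andP: sT; rewrite fE => /andP[].
rewrite sp_gluer eqxx andbT; apply/andP/andP => [[sT /eqP cg]|[sA /and3P[fs ms rs]]].
  have sA := supL s sT cg; split=> //; have [fE _ mE _] := key s sA.
  by move: sT; rewrite /of_kind fE mE => /andP[/andP[-> ->] /andP[_ ->]].
have [fE rE mE _] := key s sA; split; last by rewrite glueK.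
by rewrite /of_kind fE rE mE cards1 fs rs ms.
Qed.

(** A nonempty forest is a single tree or a tree deprived of its root. That root can be any of
    [m.+2] nodes, which turns the normalisation [m.+1!] into [m.+2!]. *)
Lemma emass_forest m :
  emass Forest m.+1 = emass Tree m.+1 + emass Tree m.+2.
Proof.
suff h : mass Tree [set: 'I_m.+2] = (m.+2`!%:R : rat) *: (emass Forest m.+1 - emass Tree m.+1).
  rewrite [emass Tree m.+2]/emass h scalerA mulVf ?scale1r ?subrKC //.
  by rewrite pnatr_eq0 -lt0n fact_gt0.
have -> : mass Tree [set: 'I_m.+2] = \sum_(r : 'I_m.+2) \sum_(s : fstruct 'I_m.+2 |
    of_kind setT s Tree && (sp s r == r)) 'X^(weight setT s Tree).
  rewrite (exchange_big_dep (fun s => of_kind setT s Tree)) /=; last by move=> r s _ /andP[].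
  apply: eq_big => [s|s /andP[_ sT]]; first by rewrite supported_setT.
  rewrite sT /= sumr_const; case/andP: sT => _ /andP[/eqP r1 _].
  rewrite (_ : #|_| = 1%N) ?mulr1n // -r1; apply: eq_card => r; by rewrite !inE.
rewrite (eq_bigr (fun _ => (m.+1`!%:R : rat) *: (emass Forest m.+1 - emass Tree m.+1))); last first.
  move=> r _; rewrite mass_tree_root ?card_ord // !massE cardsC1 card_ord /=.
  by rewrite scalerBr.
by rewrite sumr_const card_ord -scaler_nat [in RHS]factS natrM -scalerA.
Qed.

Lemma emass_forest0 : emass Forest 0 = 1.
Proof.
pose s0 : fstruct 'I_0 := [ffun x => (x, x, false)].
rewrite /emass /mass (big_pred1 s0) => [|s]; last first.
  have -> : s = s0 by apply/ffunP=> -[].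
  rewrite /= eqxx; apply/and3P; split; last 1 first.
  - by apply/eqP/eq_card0 => -[].
  - by apply/forallP=> -[].
  - by apply/andP; split; apply/forallP=> -[].
rewrite invr1 scale1r /weight (_ : #|_| = 0%N) ?expr0 //.
by apply: eq_card0 => -[].
Qed.

Lemma emass_tree0 : emass Tree 0 = 0.
Proof.
rewrite /emass /mass big_pred0 ?scaler0 // => s; apply/negP=> /and4P[_ _ /cards1P[] [] //].
Qed.

Lemma emass_tree1 : emass Tree 1 = 'X.
Proof.
pose s0 : fstruct 'I_1 := [ffun x => (x, x, false)].
have s0E x : s0 x = (x, x, false) by rewrite ffunE.
have kE s : kids [set: 'I_1] s =1 fun=> set0.
  by move=> x; apply/setP=> y; rewrite !inE (ord1 x) (ord1 y) eqxx andbF.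
rewrite /emass /mass (big_pred1 s0) => [|s].
  rewrite invr1 scale1r /weight (_ : #|_| = 1%N) //.
  rewrite -[RHS](card_ord 1) -cardsT; apply: eq_card => x; by rewrite !inE kE eqxx.
rewrite supported_setT /=; apply/idP/eqP => [/and3P[_ _]|->].
  rewrite cards_eq0 => /eqP/setP m0; apply/ffunP=> x; rewrite ffunE.
  have := m0 x; rewrite !inE /sm /=; case: (s x) => [[y z] b] /= ->.
  by rewrite (ord1 x) (ord1 y) (ord1 z).
apply/and3P; split.
- apply/andP; split; apply/forall_inP=> x _; last first.
    by apply/forall_inP=> y _; rewrite (ord1 x) (ord1 y) !eqxx.
  rewrite kE cards0 /=; apply/andP; split; first by rewrite /sa /sp !s0E.
  apply/exists_inP; exists x; first exact: in_setT.
  by rewrite connect0 andbT /sp s0E.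
- rewrite -[X in _ == X](card_ord 1) -cardsT; apply/eqP/eq_card => x.
  by rewrite !inE /sp s0E eqxx.
- by rewrite cards_eq0; apply/eqP/setP=> x; rewrite !inE /sm s0E.
Qed.

Lemma series_forest n :
  series Forest n = 2 * series Tree n + (n == 0)%:R - (n == 1)%:R.
Proof.
set M := (n.*2 + 3)%N.
have E1 : series Tree n = \sum_(m < M) (emass Tree m.+1)`_n.
  by rewrite (@seriesE _ _ M.+1) // big_ord_recl emass_tree0 coef0 add0r.
(* Shifting the index by two leaves out the tree with one node, whose series is [z]. *)
have E2 : series Tree n = (n == 1)%:R + \sum_(m < M) (emass Tree m.+2)`_n.
  rewrite (@seriesE _ _ M.+2) ?leqW // big_ord_recl emass_tree0 coef0 add0r.
  by rewrite big_ord_recl emass_tree1 coefX.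
have -> : series Forest n = (n == 0)%:R +
    \sum_(m < M) ((emass Tree m.+1)`_n + (emass Tree m.+2)`_n).
  rewrite (@seriesE _ _ M.+1) // big_ord_recl emass_forest0 coef1; congr (_ + _).
  by apply: eq_bigr => m _; rewrite -coefD -emass_forest.
rewrite big_split /= -E1 mulrDl mul1r [X in _ = _ + X + _ - _]E2; ring.
Qed.

(** The structures on ['I_m] are counted twice: [m!] for each class, and [n!] labelings for each of
    [w m] unlabelled structures. [B] is where the classes die out, [M] the truncation chosen for the
    masses. *)
Lemma egf_classes (cls : nat -> nat) (w : nat -> rat) n B M :
    (forall m, (cls m * m`!)%:R = n`!%:R * w m) ->
    (forall m, (B <= m)%N -> cls m = 0%N) -> (B <= M)%N ->
  (\sum_(m < B) cls m)%N%:R / n`!%:R = \sum_(m < M) m`!%:R^-1 * w m.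
Proof.
move=> cw c0 BM; have fn0 m : m`!%:R != 0 :> rat by rewrite pnatr_eq0 -lt0n fact_gt0.
have -> : (\sum_(m < B) cls m = \sum_(m < M) cls m)%N.
  rewrite -[LHS](big_mkord xpredT cls) -[RHS](big_mkord xpredT cls).
  rewrite [RHS](big_cat_nat (n := B)) //= [X in _ = (_ + X)%N]big_nat_cond.
  by rewrite [X in _ = (_ + X)%N]big1 ?addn0 // => m /andP[/andP[/c0 ->]].
rewrite natr_sum mulr_suml; apply: eq_bigr => m _.
apply: (mulfI (fn0 m)); rewrite [RHS]mulrA divff // mul1r mulrA -natrM mulnC cw.
by rewrite mulrAC mulfV ?mul1r.
Qed.

Lemma series_U n : U n = series Tree n.
Proof.
pose S m := [set u in Uclass n 'I_m | predT u].
pose cls m := #|equivalence_partition (@Uiso n 'I_m) (S m)|.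
have cE m : (cls m * m`! = #|S m|)%N by apply: card_Uclasses.
rewrite (@seriesE _ _ (n.*2 + 3)) // (eq_bigr (fun m : 'I__ =>
  m`!%:R^-1 * #|kindset Tree [set: 'I_m] n|%:R)); last first.
  by move=> m _; rewrite /emass coefZ mass_coef.
apply: (egf_classes (cls := cls) (w := fun m => #|kindset Tree [set: 'I_m] n|%:R)).
- by move=> m; rewrite cE card_U_tree natrM.
- move=> m nm; apply/eqP; rewrite -(eqn_pmul2r (fact_gt0 m)) cE mul0n cards_eq0.
  apply/eqP/setP=> u; rewrite !inE andbT; apply/negP=> /andP[/ltree_card].
  by rewrite card_ord ltnNge nm.
- exact: leq_addr.
Qed.

Lemma series_stem o n (P : forall N : finType, pred (ustruct n.+1 N)) :
    (forall N u, P N u = stem_pred o u) ->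
  egf (fun _ => Ucount P) n = series (Stem o) n.
Proof.
move=> PE; pose S m := [set u in Uclass n.+1 'I_m | P _ u].
pose cls m := #|equivalence_partition (@Uiso n.+1 'I_m) (S m)|.
have cE m : (cls m * m`! = #|S m|)%N.
  apply: card_Uclasses => g u; rewrite inE => /andP[uT _]; rewrite !PE /stem_pred.
  rewrite /last_fixed /last_leaf /Uact /= !ffunE permJ (inj_eq perm_inj).
  by rewrite depth_relabel.
(* The trees counted have [n.+1] leaves, so [Ucount] runs up to [n.+1.*2] nodes; the range of the
   series is enlarged to cover it. *)
rewrite (@seriesE _ _ (n.+1.*2 + 3)) ?leq_add // ?leq_double // (eq_bigr (fun m : 'I__ =>
  m`!%:R^-1 * #|kindset (Stem o) [set: 'I_m] n|%:R)); last first.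
  by move=> m _; rewrite /emass coefZ mass_coef.
apply: (egf_classes (cls := cls) (w := fun m => #|kindset (Stem o) [set: 'I_m] n|%:R)).
- move=> m; rewrite cE -natrM -card_U_stem; congr _%:R; apply: eq_card => u.
  by rewrite !inE PE.
- move=> m nm; apply/eqP; rewrite -(eqn_pmul2r (fact_gt0 m)) cE mul0n cards_eq0.
  apply/eqP/setP=> u; rewrite !inE; apply/negP=> /andP[/andP[/ltree_card + _] _].
  by rewrite card_ord ltnNge nm.
- exact: leq_addr.
Qed.

Lemma series_Ustar n : Ustar n = series (Stem None) n.
Proof. by apply: (@series_stem None n) => N u; rewrite /stem_pred andbT. Qed.

Lemma series_Uodd n : Uodd n = series (Stem (Some true)) n.
Proof. by apply: (@series_stem (Some true) n) => N u; rewrite /stem_pred eqb_id. Qed.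

Lemma series_Ueven n : Ueven n = series (Stem (Some false)) n.
Proof. by apply: (@series_stem (Some false) n) => N u; rewrite /stem_pred eqbF_neg. Qed.

Lemma series_Ubullet n : Ubullet n = series Pointed n.
Proof.
have -> : series Pointed n = n%:R * series Tree n.
  rewrite /series mulr_sumr; apply: eq_bigr => m _.
  by rewrite /emass !coefZ !mass_coef -!/(kindset _ _ _) card_pointed natrM mulrCA.
rewrite -series_U /Ubullet /fps_mul /fps_X /fps_deriv.
case: n => [|n]; first by rewrite big_ord1 !mul0r.
rewrite big_ord_recl mul0r add0r big_ord_recl /= mul1r subn1 /= big1 ?addr0 //.
by move=> i _; rewrite mul0r.
Qed.

Lemma series_Uforest n : (2 * U + 1 - 'z)%fps n = series Forest n.
Proof.
rewrite series_forest -series_U /fps_sub /fps_add /fps_X; congr (_ + _ - _); last first.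
  by rewrite /fps_const; case: eqP.
rewrite /fps_mul big_ord_recl big1 ?addr0 ?subn0 //= => i _.
by rewrite /fps_const mul0r.
Qed.

Local Close Scope ring_scope.

(** * Cotrees with marked leaves *)

Section VClasses.
Variables (k : nat) (N0 : finType) (t0 : cotree k N0) (n m : nat).
Notation N := 'I_m.

Definition Vact (g : {perm N}) (v : vstruct k n N) : vstruct k n N :=
  (Cotree (relabel g v.1.1) [ffun x => dec v.1.1 (g^-1%g x)], (v.1.2 ^ g)%g,
   [ffun i => g (v.2 i)]).

Lemma VisoE v w : Viso v w = [exists g, w == Vact g v].
Proof.
case: v w => [[t a] l] [[t' a'] l']; apply: eq_existsb => g.
rewrite ltree_isoE; apply/and4P/eqP.
  case=> /eqP tE /forallP dE /forallP aE /forallP lE; congr (_, _, _).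
  - case: t' tE dE => t' d' /= -> dE; congr Cotree; apply/ffunP=> x.
    by rewrite ffunE (eqP (dE _)) permKV.
  - by apply/permP=> x; rewrite -(permKV g x) permJ (eqP (aE _)).
  - by apply/ffunP=> i; rewrite ffunE (eqP (lE _)).
rewrite /Vact => -[-> -> ->]; split=> //=; apply/forallP=> x.
- by rewrite ffunE permK.
- by rewrite permJ.
- by rewrite ffunE.
Qed.

Lemma is_dca_relabel (g : {perm N}) (t : ltree n N) (S : {set N}) x :
  is_dca (relabel g t) (g @: S) (g x) = is_dca t S x.
Proof.
have allE y : [forall l in g @: S, anc (relabel g t) (g y) l] = [forall l in S, anc t y l].
  apply/forall_inP/forall_inP=> H l; first by move=> lS; rewrite -(anc_relabel g) H ?imset_f.
  by case/imsetP=> z zS ->; rewrite anc_relabel H.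
rewrite /is_dca allE; congr (_ && _); rewrite (forall_perm g); apply: eq_forallb => y.
by rewrite allE anc_relabel.
Qed.

Lemma dcas_relabel (g : {perm N}) (t : cotree n N) (d : {ffun N -> option bool})
    (l : {ffun 'I_k -> N}) (x : N) :
  (g x \in dcas (Cotree (relabel g t) d) [ffun i => g (l i)]) = (x \in dcas t l).
Proof.
rewrite !inE; apply: eq_existsb => A; congr (_ && _); rewrite -[RHS](is_dca_relabel g) /=.
congr is_dca; rewrite -imset_comp; apply: eq_imset => i; by rewrite ffunE.
Qed.

Lemma Vact_class g v : v \in Vclass t0 n N -> Vact g v \in Vclass t0 n N.
Proof.
case: v => [[t a] l]; rewrite !inE /= => /and5P[/andP[tT /forallP dT] /forallP cT aT lI].
case/and3P=> /forallP lL /existsP[f].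
case/and5P=> /injectiveP fI /forallP fL /eqP fD /forallP fA /forallP fd.
move=> /forall_inP fx; set t' := Cotree _ _; set l' := [ffun i => _].
have leafE x : leaf t' (g x) = leaf t x by apply: leaf_relabel.
have decE x : dec t' (g x) = dec t x by rewrite ffunE permK.
apply/and5P; split.
- rewrite /is_cotree is_ltree_relabel tT /=; rewrite (forall_perm g).
  by apply/forallP=> x; rewrite decE leafE.
- rewrite /canonical (forall_perm g); apply/forallP=> x.
  rewrite (forall_perm g); apply/forallP=> y; rewrite child_relabel leafE !decE.
  by have /forallP := cT x.
- by rewrite is_aut_relabel.
- by apply/injectiveP=> i j; rewrite !ffunE => /perm_inj/(injectiveP _ lI).
apply/and3P; split.
- by apply/forallP=> i; rewrite ffunE leafE.
- apply/existsP; exists [ffun x => g (f x)]; apply/and5P; split.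
  + by apply/injectiveP=> x y; rewrite !ffunE => /perm_inj/fI.
  + by apply/forallP=> i; rewrite !ffunE (eqP (fL i)).
  + apply/eqP/setP=> y; rewrite -(permKV g y) dcas_relabel -fD.
    apply/imsetP/imsetP=> -[x xi]; rewrite ?ffunE => /eqP.
      by rewrite (inj_eq perm_inj) => /eqP ->; exists x.
    by move/eqP->; exists x; rewrite ?ffunE.
  + apply/forallP=> x; apply/forallP=> y; rewrite !ffunE anc_relabel.
    by have /forallP := fA x.
  + by apply/forallP=> x; rewrite ffunE decE.
apply/forall_inP=> y; rewrite -(permKV g y); move: (g^-1%g y) => {}y.
rewrite dcas_relabel => yd; have /andP[ay /forall_inP cy] := fx y yd.
rewrite permJ (inj_eq perm_inj) ay /=; apply/forall_inP=> z.
rewrite children_relabel => /imsetP[w wc ->]; apply/implyP=> /existsP[i].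
rewrite ffunE anc_relabel permJ (inj_eq perm_inj) => wi.
by have /implyP := cy w wc; apply; apply/existsP; exists i.
Qed.

Lemma card_Vclasses :
  #|equivalence_partition (@Viso k n N) (Vclass t0 n N)| * m`! = #|Vclass t0 n N|.
Proof.
apply: (card_iso_classes (act := Vact)).
- exact: Viso_equiv.
- exact: VisoE.
- by move=> g u; apply: Vact_class.
- move=> g h [[t a] l]; rewrite inE => /and3P[/andP[tT _] _ _].
  by move/(congr1 (fun v => ctree v.1.1)); apply: relabel_inj.
Qed.

End VClasses.

(** Two ancestors of [u] are comparable, and a sibling properly above the other would be an ancestor
    of its own parent, which only the root is. *)
Lemma siblings_eq (n : nat) (N : finType) (t : ltree n N) y y' u :
    is_ltree t -> y != troot t -> y' != troot t -> par t y = par t y' ->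
  anc t y u -> anc t y' u -> y = y'.
Proof.
move=> tT; have ac := ltree_acyclic tT.
suff h z z' : z' != troot t -> par t z = par t z' -> anc t z' z -> z = z'.
  move=> yr yr' pp yu yu'; case/orP: (fconnect_total yu yu') => H; first exact: h H.
  by apply/esym; apply: h H.
move=> zr pp; rewrite /anc fconnect_eqVf pp => /orP[/eqP //|h].
suff /eqP : par t z' = z' by rewrite par_fix // (negbTE zr).
by apply: fconnect_anti h _ => //; apply: fconnect1.
Qed.

(** * Gluing pieces along [t0] *)

Section Glue.
Variables (k : nat) (N0 : finType) (t0 : cotree k N0).
Hypotheses (hk : 2 <= k) (ht0 : is_cotree t0).
Notation root0 := (troot t0).

Lemma cotree_ltree : is_ltree t0. Proof. by case/andP: ht0. Qed.
Let tT0 := cotree_ltree.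

(** A root that is a leaf would carry all the labels, while two labels sit on distinct leaves. *)
Lemma root_internal : ~~ leaf t0 root0.
Proof.
apply/negP=> lr.
have h i : lab t0 i = root0 by apply: leaf_minimal lr (anc_root _ _).
have /is_ltreeP[_ _ _ li _] := tT0.
have : Ordinal hk = Ordinal (ltnW hk) by apply: li; rewrite !h.
by move/(congr1 val).
Qed.

Lemma par_internal y : y != root0 -> ~~ leaf t0 (par t0 y).
Proof.
by move=> yr; apply/set0Pn; exists y; rewrite inE /child yr eqxx.
Qed.

(** The root of the stem of [y] is a child of [f (par t0 y)], so the distance from [f y] to
    [f (par t0 y)] is one more than the height in the stem: equal decorations mean even distance,
    hence odd height. The stem of [root0] has nothing above it to compare with. A leaf [y] gets an
    empty class [(y, false)], so that the colours form a plain product. *)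
Definition color_kind (i : N0 * bool) : kind :=
  let: (y, b) := i in
  if b then
    if leaf t0 y then Pointed
    else if y == root0 then Stem None
    else Stem (Some (dec t0 y == dec t0 (par t0 y)))
  else if leaf t0 y then Void else Forest.

Variable N : finType.

(* The colour class of [(y, true)] is the stem ending in [f y], or the tree
   pointed at [f y] when [y] is a leaf; that of [(y, false)] is the forest of the
   unmarked trees hanging from [f y]. *)
Record glued (c : N -> N0 * bool) (s : fstruct N) (f : N0 -> N) : Prop := Glued {
  glued_cp : forall x, c (sp s x) = c x;
  glued_ca : forall x, c (sa s x) = c x;
  glued_acyclic : acyclic (sp s);
  glued_branch : forall x, #|fkids (sp s) x| != 1;
  glued_comm : forall x, sa s (sp s x) = sp s (sa s x);
  glued_inj : injective (sa s);
  glued_color : forall y, c (f y) = (y, true);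
  glued_mark : forall x, sm s x -> x = f (c x).1;
  glued_marked : forall y, sm s (f y);
  glued_root : forall x x', sp s x = x -> sp s x' = x' -> c x = c x' -> (c x).2 -> x = x';
  glued_leaf : forall y, fkids (sp s) (f y) = set0;
  glued_fix : forall y, ~~ leaf t0 y -> sa s (f y) = f y;
  glued_parity : forall y, ~~ leaf t0 y -> y != root0 ->
    odd (height (sp s) (f y)) = (dec t0 y == dec t0 (par t0 y));
  glued_internal : forall x, ~~ (c x).2 -> ~~ leaf t0 (c x).1
}.

Definition internal0 : {set N0} := [set y | ~~ leaf t0 y].

(** Only roots of pieces get a new parent, read off from their colour; the root of the stem of
    [root0] stays a root. *)
Definition glue_par (c : N -> N0 * bool) (s : fstruct N) (f : N0 -> N) (x : N) : N :=
  if sp s x != x then sp s x else if c x == (root0, true) then x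
  else f (if (c x).2 then par t0 (c x).1 else (c x).1).

Section GluedFacts.
Variables (c : N -> N0 * bool) (s : fstruct N) (f : N0 -> N).
Hypothesis H : glued c s f.
Notation gp := (glue_par c s f).

Lemma glued_f_inj : injective f.
Proof. by move=> y y' /(congr1 c); rewrite !(glued_color H) => -[]. Qed.

Lemma glued_markE x : sm s x = (x == f (c x).1).
Proof.
apply/idP/eqP => [/(glued_mark H)//|->]; exact: (glued_marked H).
Qed.

Lemma gp_step x : sp s x <> x -> gp x = sp s x.
Proof. by move=> px; rewrite /glue_par; case: eqP. Qed.

Lemma gp_root x : sp s x = x -> c x = (root0, true) -> gp x = x.
Proof. by move=> px cx; rewrite /glue_par px cx !eqxx. Qed.

Lemma gp_stem x y : sp s x = x -> c x = (y, true) -> y != root0 -> gp x = f (par t0 y).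
Proof.
by move=> px cx yr; rewrite /glue_par px cx eqxx /= xpair_eqE (negbTE yr).
Qed.

Lemma gp_forest x y : sp s x = x -> c x = (y, false) -> gp x = f y.
Proof. by move=> px cx; rewrite /glue_par px cx eqxx /= xpair_eqE andbF. Qed.

Lemma gpP x :
  [\/ c (gp x) = c x /\ (gp x = x \/ gp x = sp s x),
      exists y, [/\ sp s x = x, c x = (y, true), y != root0 & gp x = f (par t0 y)]
    | exists y, [/\ sp s x = x, c x = (y, false), ~~ leaf t0 y & gp x = f y]].
Proof.
case: (sp s x =P x) => [px|px]; last first.
  by apply: Or31; rewrite gp_step // (glued_cp H); split=> //; right.
case E: (c x) => [y []].
  have [yr|yr] := eqVneq y root0.
    by apply: Or31; rewrite gp_root -?E -?yr //; split=> //; left.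
  by apply: Or32; exists y; rewrite (gp_stem px E).
apply: Or33; exists y; rewrite (gp_forest px E); split=> //.
by have := glued_internal H (x := x); rewrite E; apply.
Qed.

(** The first component of the colour projects the glued tree onto [t0]; by iteration, ancestors go
    to ancestors. *)
Lemma gp_color x : anc t0 (c (gp x)).1 (c x).1.
Proof.
rewrite /anc; case: (gpP x) => [[-> _]|[y [_ -> _ ->]]|[y [_ -> _ ->]]];
  rewrite ?(glued_color H) /= ?connect0 ?fconnect1 //.
Qed.

Lemma fconnect_gp_color x z : fconnect gp x z -> anc t0 (c z).1 (c x).1.
Proof.
case/fconnectP=> j <-; elim: j => [|j IHj] /=; first exact: connect0.
exact: connect_trans IHj (gp_color _).
Qed.

Lemma fconnect_sp_gp x z : fconnect (sp s) x z -> fconnect gp x z.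
Proof.
case/fconnectP=> j; elim: j x => [x <-|j IHj x]; first exact: connect0.
case: (sp s x =P x) => [px|px]; rewrite iterSr => /IHj; first by rewrite px.
by apply: connect_trans; rewrite -(gp_step px) fconnect1.
Qed.

Definition stem_top y : N := top (sp s) (f y).

Lemma sp_stem_top y : sp s (stem_top y) = stem_top y.
Proof. exact: top_fix (glued_acyclic H) _. Qed.

Lemma c_fconnect_sp x z : fconnect (sp s) x z -> c z = c x.
Proof. by case/fconnectP=> j <-; elim: j => //= j; rewrite (glued_cp H). Qed.

Lemma c_stem_top y : c (stem_top y) = (y, true).
Proof.
by rewrite (c_fconnect_sp (fconnect_top (glued_acyclic H) _)) (glued_color H).
Qed.

Lemma stem_topP x y : sp s x = x -> c x = (y, true) -> x = stem_top y.
Proof.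
move=> px cx; apply: (glued_root H) => //; first exact: sp_stem_top.
  by rewrite cx c_stem_top.
by rewrite cx.
Qed.

Lemma gp_stem_top y : y != root0 -> gp (stem_top y) = f (par t0 y).
Proof. by apply: gp_stem (sp_stem_top y) (c_stem_top y). Qed.

Lemma fconnect_stem_top y : fconnect gp (f y) (stem_top y).
Proof. exact/fconnect_sp_gp/fconnect_top/(glued_acyclic H). Qed.

Lemma fconnect_f_par y : y != root0 -> fconnect gp (f y) (f (par t0 y)).
Proof.
move=> yr; apply: connect_trans (fconnect_stem_top y) _.
by rewrite -gp_stem_top // fconnect1.
Qed.

Lemma fconnect_gp_f x y : fconnect gp (f y) (f x) = anc t0 x y.
Proof.
apply/idP/idP => [/fconnect_gp_color|]; first by rewrite !(glued_color H).
have ac := ltree_acyclic tT0; elim/(acyclic_ind ac): y => y py.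
  by move/(fconnect_fix py) ->; apply: connect0.
move=> IH; rewrite /anc fconnect_eqVf => /orP[/eqP -> |/IH h]; first exact: connect0.
apply: connect_trans h; apply: fconnect_f_par.
by rewrite -par_fix //; apply/eqP.
Qed.

Lemma gp_fix x : (gp x == x) = (x == stem_top root0).
Proof.
apply/eqP/eqP => [gx|->]; last exact: gp_root (sp_stem_top _) (c_stem_top _).
case: (gpP x) => [[_ h]|[y [_ cx yr gE]]|[y [_ cx _ gE]]]; first last.
- by move: cx; rewrite -gx gE (glued_color H).
- by move: cx; rewrite -{1}gx gE (glued_color H) => -[/eqP]; rewrite par_fix // (negbTE yr).
case: (sp s x =P x) => [px|px]; last by rewrite gp_step in gx.
case E: (c x) => [y []]; last first.
  by have := E; rewrite -{1}gx (gp_forest px E) (glued_color H).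
have [yr|yr] := eqVneq y root0; first by apply: stem_topP; rewrite // -yr.
have := E; rewrite -{1}gx (gp_stem px E yr) (glued_color H) => -[/eqP].
by rewrite par_fix // (negbTE yr).
Qed.

(** From any node one climbs to the root of its piece, steps to some [f y], and then follows the
    path of [y] in [t0], piece by piece. *)
Lemma gp_acyclic : acyclic gp.
Proof.
have reach y : exists2 r, gp r = r & fconnect gp (f y) r.
  have ac := ltree_acyclic tT0; elim/(acyclic_ind ac): y => y py.
    exists (stem_top y); last exact: fconnect_stem_top.
    by apply/eqP; rewrite gp_fix (_ : y = root0) //; apply/eqP; rewrite -par_fix // py.
  case=> r gr h; exists r => //; apply: connect_trans h; apply: fconnect_f_par.
  by rewrite -par_fix //; apply/eqP.
apply: acyclicP => x; have /(_ x)[pt /fconnect_sp_gp xt] := topP (glued_acyclic H).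
case E: (c (top (sp s) x)) => [y []].
  have [yr|yr] := eqVneq y root0.
    by exists (top (sp s) x) => //; apply: gp_root; rewrite // -yr.
  have [r gr h] := reach (par t0 y); exists r => //; apply: connect_trans xt _.
  by apply: connect_trans h; rewrite -(gp_stem pt E yr) fconnect1.
have [r gr h] := reach y; exists r => //; apply: connect_trans xt _.
by apply: connect_trans h; rewrite -(gp_forest pt E) fconnect1.
Qed.

Lemma fkids_gp x : x \notin f @: internal0 -> fkids gp x = fkids (sp s) x.
Proof.
move=> xf; apply/setP=> w; rewrite !inE andbC [RHS]andbC; apply: andb_id2l => wx.
have fint v : ~~ leaf t0 v -> x != f v.
  by move=> vi; apply: contraNneq xf => ->; rewrite imset_f // inE.
case: (gpP w) => [[_ [gw|gw]]|[y [pw _ yr gw]]|[y [pw _ yi gw]]].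
- case: (sp s w =P w) => [-> |/gp_step <- //].
  by rewrite gw.
- by rewrite gw.
- by rewrite gw pw (negbTE wx) eq_sym; apply/negbTE/fint/par_internal.
- by rewrite gw pw (negbTE wx) eq_sym; apply/negbTE/fint.
Qed.

Lemma child_gp_f v w : gp w = f v -> w != f v ->
  sp s w = w /\ ((exists y, [/\ c w = (y, true), y != root0 & par t0 y = v]) \/ c w = (v, false)).
Proof.
move=> gw wf; case: (gpP w) => [[cw [gE|gE]]|[y [pw cw yr gE]]|[y [pw cw yi gE]]].
- by move: wf; rewrite -gw gE eqxx.
- have := glued_leaf H v => /setP/(_ w); rewrite !inE wf andbT -gE gw eqxx //.
- by split=> //; left; exists y; split=> //; apply: glued_f_inj; rewrite -gE.
- by split=> //; right; rewrite cw; congr (_, _); apply: glued_f_inj; rewrite -gE.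
Qed.

(** The roots of the pieces of the children of [v] already provide two children, so [f v] branches
    whatever its forest is. *)
Lemma card_fkids_gp v : ~~ leaf t0 v -> 1 < #|fkids gp (f v)|.
Proof.
move=> vi; have : 1 < #|children t0 v|.
  by case/and5P: tT0 => _ _ /forallP/(_ v) + _ _; rewrite (negbTE vi).
move/leq_trans; apply.
have tI : injective stem_top by move=> y y' /(congr1 c); rewrite !c_stem_top => -[].
rewrite -(card_imset _ tI); apply/subset_leq_card/subsetP=> w /imsetP[y].
rewrite !inE => /andP[yr /eqP py] ->; rewrite gp_stem_top // py eqxx /=.
apply/eqP=> /(congr1 c); rewrite c_stem_top (glued_color H) => -[yv].
by move: yr; rewrite -par_fix // py yv eqxx.
Qed.

Lemma leaf_gp x :
  (fkids gp x == set0) = (fkids (sp s) x == set0) && (x \notin f @: internal0).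
Proof.
have [/imsetP[v + ->]|xf] := boolP (x \in f @: internal0).
  by rewrite inE => /card_fkids_gp; rewrite andbF -cards_eq0; case: #|_|.
by rewrite fkids_gp // andbT.
Qed.

(** Foreign pieces are attached only to marks [f v] with [v] internal, and forests and trees pointed
    at a leaf of [t0] contain none. *)
Lemma c_below x z : ~~ (c x).2 || leaf t0 (c x).1 -> fconnect gp z x -> c z = c x.
Proof.
move=> h /fconnectP[j]; elim: j z => [z <- //|j IHj z]; rewrite iterSr => /IHj E.
case: (gpP z) => [[<- _]//|[y [_ _ yr gE]]|[y [_ _ yi gE]]].
  by move: h; rewrite -E gE (glued_color H) /= (negbTE (par_internal yr)).
by move: h; rewrite -E gE (glued_color H) /= (negbTE yi).
Qed.

(** Other pieces hang from a stem only at its mark [f y]. *)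
Lemma stem_below x y z : c x = (y, true) -> fconnect gp z x ->
  c z = (y, true) \/ fconnect gp z (f y).
Proof.
move=> cx /fconnectP[j]; elim: j z => [z /= ->|j IHj z]; first by left.
rewrite iterSr => /IHj[E|h]; last first.
  by right; apply: connect_trans h; apply: fconnect1.
have {}E : c z = (y, true) \/ gp z = f y; last first.
  by case: E => [->|E]; [left|right; rewrite -E fconnect1].
move: E; case: (gpP z) => [[<- _]|[y' [_ _ _ ->]]|[y' [_ _ _ ->]]]; first by left.
  by rewrite (glued_color H) => -[->]; right.
by rewrite (glued_color H) => -[->]; right.
Qed.

Lemma marked_below x i : fconnect gp (f (lab t0 i)) x -> (c x).2.
Proof.
move=> h; apply/negPn/negP=> cx; have := c_below (x := x) _ h.
by rewrite cx => /(_ isT) E; move: cx; rewrite -E (glued_color H).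
Qed.

End GluedFacts.
End Glue.

Arguments gp_step {k N0 t0 N c s f x}.
Arguments gp_root {k N0 t0 N c s f x}.
Arguments gp_stem {k N0 t0 N c s f x y}.
Arguments gp_forest {k N0 t0 N c s f x y}.

(** Decorations flip along every edge between internal nodes, so each is the decoration of the root,
    flipped according to the parity of the height; [x] and [y] are compared through the root. *)
Lemma canonical_dec (n : nat) (N : finType) (t : cotree n N) x y :
    is_cotree t -> canonical t -> ~~ leaf t x -> ~~ leaf t y ->
  dec t x = omap (addb (odd (height (par t) x) (+) odd (height (par t) y))) (dec t y).
Proof.
move=> /andP[tT /forallP dT] /forallP cT; have ac := ltree_acyclic tT.
have dS z : ~~ leaf t z -> exists b, dec t z = Some b.
  by have /eqP := dT z; case: (dec t z) => [b|] /= <- // _; exists b.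
have key z : ~~ leaf t z ->
    dec t z = omap (addb (odd (height (par t) z))) (dec t (troot t)).
  elim/(acyclic_ind ac): z => z pz.
    have -> : z = troot t by apply/eqP; rewrite -par_fix // pz.
    by rewrite height_fix ?par_root //; case: (dec _ _).
  have zr : z != troot t by rewrite -par_fix //; apply/eqP.
  have zc : child t (par t z) z by rewrite /child zr eqxx.
  have pi : ~~ leaf t (par t z) by apply/set0Pn; exists z; rewrite inE.
  move=> /(_ pi) IH zi; have /forallP/(_ z) := cT (par t z); rewrite zc (negbTE zi) /=.
  rewrite height_step //=; have [b ->] := dS z zi; have [b' E] := dS _ pi.
  move: IH; rewrite !E; case: (dec t (troot t)) => //= b0 [->].
  by case: (odd _); case: b; case: b0.
move=> xi yi; rewrite (key x xi) (key y yi); case: (dec _ _) => //= b.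
by congr Some; do 2 case: (odd _); case: b.
Qed.

Definition witness (k : nat) (N0 : finType) (t0 : cotree k N0) (n : nat) (N : finType)
    (t : cotree n N) (l : {ffun 'I_k -> N}) (f : {ffun N0 -> N}) : bool :=
  [&& injectiveb f, [forall i, f (lab t0 i) == l i],
      f @: internal0 t0 == dcas t l,
      [forall x, forall y, anc t0 x y == anc t (f x) (f y)]
    & [forall x, dec t0 x == dec t (f x)]].

Section GlueTree.
Variables (k : nat) (N0 : finType) (t0 : cotree k N0).
Hypotheses (hk : 2 <= k) (ht0 : is_cotree t0).
Notation root0 := (troot t0).
Let tT0 := cotree_ltree ht0.

Lemma anc_siblings v y y' u : y \in children t0 v -> y' \in children t0 v ->
  anc t0 y u -> anc t0 y' u -> y = y'.
Proof.
rewrite !inE => /andP[yr /eqP py] /andP[yr' /eqP py']; apply: siblings_eq => //.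
by rewrite py.
Qed.

Lemma two_children v : ~~ leaf t0 v ->
  exists y y', [/\ y \in children t0 v, y' \in children t0 v & y != y'].
Proof.
move=> vi; case/and5P: tT0 => _ _ /forallP/(_ v) + _ _.
rewrite (negbTE vi) => /card_gt1P[y [y' [? ? ?]]]; by exists y, y'.
Qed.

Lemma dec_internal y : ~~ leaf t0 y -> exists b, dec t0 y = Some b.
Proof.
have /andP[_ /forallP dT] := ht0.
by have /eqP := dT y; case: (dec t0 y) => [b|] /= <- // _; exists b.
Qed.

Variables (N : finType).

(** The leaves of the pieces that are still leaves after gluing: the mark of an internal node of
    [t0] acquires children. *)
Definition free_leaves (c : N -> N0 * bool) (s : fstruct N) : {set N} :=
  [set x | (fkids (sp s) x == set0) && ~~ (sm s x && ~~ leaf t0 (c x).1)].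

Variables (c : N -> N0 * bool) (s : fstruct N) (f : {ffun N0 -> N}).
Hypothesis H : glued t0 c s f.
Notation gp := (glue_par t0 c s f).

Lemma mem_f_internal x : (x \in f @: internal0 t0) = sm s x && ~~ leaf t0 (c x).1.
Proof.
rewrite (glued_markE H); apply/imsetP/andP => [[y + ->]|[/eqP xE xi]].
  by rewrite inE (glued_color H).
by exists (c x).1; rewrite // inE.
Qed.

Lemma free_leavesE x : (x \in free_leaves c s) = (fkids gp x == set0).
Proof. by rewrite inE (leaf_gp ht0 H) mem_f_internal. Qed.

(** The successor counts the edge by which the piece is attached. *)
Lemma height_gp x y : c x = (y, true) -> y != root0 ->
  height gp x = height (sp s) x + (height gp (f (par t0 y))).+1.
Proof.
move=> + yr; elim/(acyclic_ind (glued_acyclic H)): x => [x px cx|x px IH cx].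
  have gx : gp x <> x.
    rewrite (gp_stem px cx yr) => /(congr1 c); rewrite (glued_color H) cx => -[/eqP].
    by rewrite par_fix // (negbTE yr).
  by rewrite (height_fix px) (height_step (gp_acyclic ht0 H) gx) (gp_stem px cx yr).
rewrite (height_step (glued_acyclic H) px).
rewrite (height_step (gp_acyclic ht0 H)); last by rewrite gp_step.
by rewrite gp_step // IH // (glued_cp H).
Qed.

Variables (n : nat) (lb : {ffun 'I_n -> N}).
Hypothesis lbL : lb \in labelings n (free_leaves c s).

Definition glue_ltree : ltree n N :=
  LTree (stem_top s f root0) [ffun x => gp x] lb.

(** The only canonical decoration for which [f root0] has the decoration of [root0]. *)
Definition glue_cotree : cotree n N := Cotree glue_ltree
  [ffun x => if leaf glue_ltree x then None else
     omap (addb (odd (height gp x) (+) odd (height gp (f root0)))) (dec t0 root0)].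

Definition glue_aut : {perm N} := perm (glued_inj H).

Definition glue_marks : {ffun 'I_k -> N} := [ffun i => f (lab t0 i)].

Notation tt := glue_ltree.

Lemma par_glue : par tt =1 gp. Proof. by move=> x; rewrite ffunE. Qed.

Lemma fkids_glue x : fkids (par tt) x = fkids gp x.
Proof. by apply/setP=> y; rewrite !inE par_glue. Qed.

Lemma anc_glue x y : anc tt x y = fconnect gp y x.
Proof. by rewrite /anc (eq_fconnect par_glue). Qed.

Lemma is_ltree_glue : is_ltree tt.
Proof.
move: lbL; rewrite inE => /andP[/injectiveP lI /forallP lL].
apply/is_ltreeP; split=> //.
- apply: acyclicP => x; have [gt xt] := topP (gp_acyclic ht0 H) x.
  by exists (top gp x); rewrite ?par_glue // (eq_fconnect par_glue).
- by move=> x; rewrite par_glue (gp_fix ht0 H).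
- move=> x; rewrite fkids_glue; have [/imsetP[v + ->]|xf] := boolP (x \in f @: internal0 t0).
    by rewrite inE => /(card_fkids_gp ht0 H); case: #|_| => [|[]].
  by rewrite (fkids_gp H) // (glued_branch H).
- by move=> x; rewrite fkids_glue -free_leavesE (eqP (lL x)).
Qed.

Lemma leaf_glue x : leaf tt x = (fkids gp x == set0).
Proof. by rewrite leafE ?is_ltree_glue // fkids_glue. Qed.

Lemma leaf_glue_f y : leaf tt (f y) = leaf t0 y.
Proof.
rewrite leaf_glue (leaf_gp ht0 H) (glued_leaf H) eqxx mem_f_internal.
by rewrite (glued_markE H) (glued_color H) eqxx negbK.
Qed.

Lemma is_aut_glue : is_aut tt glue_aut.
Proof.
apply/is_autP; first exact: is_ltree_glue.
move=> x; rewrite !par_glue !permE.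
case: (sp s x =P x) => [px|px]; last first.
  rewrite !gp_step ?(glued_comm H) //.
  by rewrite -(glued_comm H) => /(glued_inj H).
(* The image of a root of a piece is a root of the same colour, so either both stay roots or both
   hang from the same node [f v], which is fixed. *)
have pa : sp s (sa s x) = sa s x by rewrite -(glued_comm H) px.
have ca := glued_ca H x.
case E: (c x) => [y []]; last first.
  rewrite (gp_forest px E) (gp_forest pa (etrans ca E)) (glued_fix H) //.
  by have := glued_internal H (x := x); rewrite E; apply.
have [yr|yr] := eqVneq y root0; first by rewrite !gp_root ?ca ?E ?yr.
by rewrite (gp_stem px E yr) (gp_stem pa (etrans ca E) yr) (glued_fix H) // par_internal.
Qed.

(** Induction from the root of [t0]: between [f (par t0 y)] and [f y] the decoration flips once per
    edge, and the parity imposed on the stem makes the result agree with [t0]. *)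
Lemma dec_glue_f y : dec glue_cotree (f y) = dec t0 y.
Proof.
rewrite ffunE leaf_glue_f; case: ifPn => [yl|].
  by have /andP[_ /forallP/(_ y)] := ht0; rewrite yl => /eqP/eqP.
elim/(acyclic_ind (ltree_acyclic tT0)): y => y py.
  have -> : y = root0 by apply/eqP; rewrite -par_fix // py.
  by rewrite addbb; case: (dec _ _).
have yr : y != root0 by rewrite -par_fix //; apply/eqP.
move=> /(_ (par_internal yr)) IH yi.
have [b bE] := dec_internal yi; have [b' bE'] := dec_internal (par_internal yr).
have [b0 bE0] := dec_internal (root_internal hk ht0).
have := glued_parity H yi yr; rewrite (height_gp (glued_color H y)) // oddD /= => ->.
move: IH; rewrite bE bE' bE0 /= => -[<-]; congr Some.
by do 2 case: (odd _); case: (b); case: (b0).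
Qed.

Lemma is_cotree_glue : is_cotree glue_cotree.
Proof.
apply/andP; split; first exact: is_ltree_glue.
apply/forallP=> x; rewrite ffunE; case: ifP => //.
by have [b ->] := dec_internal (root_internal hk ht0).
Qed.

Lemma canonical_glue : canonical glue_cotree.
Proof.
apply/forallP=> x; apply/forallP=> y; apply/implyP=> xy.
have xi : leaf tt x = false by apply/negbTE/set0Pn; exists y; rewrite inE.
rewrite !ffunE xi; case: ifP => //= _.
case/andP: xy => yr /eqP px; have [b ->] /= := dec_internal (root_internal hk ht0).
have py : gp y <> y by move/eqP; rewrite -par_glue par_fix ?is_ltree_glue // (negbTE yr).
rewrite (height_step (gp_acyclic ht0 H) py) -par_glue px /=.
by do 2 case: (odd _); case: b.
Qed.

Lemma label_below y : exists i, anc t0 y (lab t0 i).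
Proof. exact: exists_label_below. Qed.

Lemma dcas_glue : dcas glue_cotree glue_marks = f @: internal0 t0.
Proof.
have ac := gp_acyclic ht0 H.
have mE i : glue_marks i = f (lab t0 i) by rewrite ffunE.
apply/setP=> x; rewrite inE; apply/existsP/idP; last first.
  case/imsetP=> v; rewrite inE => vi ->; have [y [y' [yc yc' yy]]] := two_children vi.
  have [i yi] := label_below y; have [j yj] := label_below y'.
  have vy z i' : z \in children t0 v -> anc t0 z (lab t0 i') -> anc t0 v (lab t0 i').
    by rewrite inE => /andP[_ /eqP <-] /connect_trans; apply; apply: fconnect1.
  (* Labels below two distinct children of [v]; they differ because siblings have no common
     descendant. *)
  exists [set i; j]; rewrite cards2; apply/andP; split.
    rewrite ltnS lt0b; apply: contra yy => /eqP ij; apply/eqP.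
    by apply: (anc_siblings yc yc' yi); rewrite ij.
  apply/andP; split.
    apply/forall_inP=> w /imsetP[i' + ->]; rewrite ffunE anc_glue (fconnect_gp_f ht0 H) !inE.
    by case/orP=> /eqP ->; [apply: (vy y)|apply: (vy y')].
  apply/forallP=> z; apply/implyP=> /forall_inP hz; rewrite anc_glue.
  have zi : fconnect gp (f (lab t0 i)) z.
    by rewrite -anc_glue -mE; apply/hz/imset_f/set21.
  have zj : fconnect gp (f (lab t0 j)) z.
    by rewrite -anc_glue -mE; apply/hz/imset_f/set22.
  have vi' : fconnect gp (f (lab t0 i)) (f v) by rewrite (fconnect_gp_f ht0 H) (vy y).
  case/orP: (fconnect_total zi vi') => // zv.
  have [->|/eqP zne] := eqVneq z (f v); first exact: connect0.
  (* A common ancestor strictly below [f v] is below one child [w] of [f v]. If [w] has colour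
     [(u, true)], both labels are below the single child [u] of [v]; if [w] is in the forest, no
     marked leaf is below it. *)
  have [w [gw /eqP wf zw]] := fconnect_child ac zv zne.
  have wi := connect_trans zi zw; have wj := connect_trans zj zw.
  case: (child_gp_f H gw wf) => _ [[u [cw ur pu]]|cw]; last first.
    by have := marked_below H wi; rewrite cw.
  have uc : u \in children t0 v by rewrite inE /child ur pu eqxx.
  have := fconnect_gp_color H wi; have := fconnect_gp_color H wj.
  rewrite cw !(glued_color H) /= => uj ui; case/negP: yy; apply/eqP.
  by rewrite (anc_siblings yc uc yi ui) (anc_siblings yc' uc yj uj).
case=> A /andP[A2 /andP[/forall_inP xA /forallP xM]].
have hA i : i \in A -> fconnect gp (f (lab t0 i)) x.
  by move=> iA; rewrite -anc_glue -mE; apply/xA/imset_f.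
have /card_gt1P[i [j [iA jA ij]]] := A2.
case E: (c x) (marked_below H (hA i iA)) => [y b] /= bT; rewrite {}bT in E.
(* If [y] is a leaf, everything below [x] has colour [(y, true)], which leaves room for one marked
   leaf only. *)
have [yl|yi] := boolP (leaf t0 y).
  have h l : l \in A -> c (f (lab t0 l)) = c x.
    by move=> /hA; apply: (c_below H); rewrite E /= yl.
  have /is_ltreeP[_ _ _ li _] := tT0.
  case/eqP: ij; apply: li; apply/eqP; move: (h i iA) (h j jA); rewrite !(glued_color H) => <- [->].
  by [].
(* The stem of an internal [y] contains no marked leaf, so those of [A] lie below [f y]; as [x] is
   deepest, it is [f y] or below it. Colours then exclude strictly below. *)
have fy : fconnect gp x (f y).
  have := xM (f y); rewrite anc_glue => /implyP; apply.
  apply/forall_inP=> w /imsetP[l lA ->]; rewrite ffunE anc_glue.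
  case: (stem_below H E (hA l lA)) => //; rewrite (glued_color H) => -[ly].
  by move: yi; rewrite -ly leaf_lab.
have [->|/eqP xy] := eqVneq x (f y); first by rewrite imset_f // inE.
have [w [gw /eqP wf xw]] := fconnect_child ac fy xy.
case: (child_gp_f H gw wf) => _ [[u [cw ur pu]]|cw]; last first.
  by have := c_below H _ xw; rewrite cw E => /(_ isT).
have := fconnect_gp_color H xw; rewrite cw E /= => uy.
have yu : anc t0 y u by rewrite -pu /anc fconnect1.
have uE := fconnect_anti (ltree_acyclic tT0) uy yu.
by move: ur; rewrite -par_fix // pu uE eqxx.
Qed.

Lemma glue_witness : witness t0 glue_cotree glue_marks f.
Proof.
apply/and5P; split.
- by apply/injectiveP=> y y' /(glued_f_inj H).
- by apply/forallP=> i; rewrite ffunE.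
- by rewrite dcas_glue.
- by apply/forallP=> x; apply/forallP=> y; rewrite anc_glue (fconnect_gp_f ht0 H).
- by apply/forallP=> y; rewrite dec_glue_f.
Qed.

Lemma fixes_glue : fixes_dcas glue_cotree glue_aut glue_marks.
Proof.
apply/forall_inP=> x; rewrite dcas_glue => /imsetP[v]; rewrite inE => vi ->.
rewrite permE (glued_fix H) // eqxx /=; apply/forall_inP=> w.
rewrite inE => /andP[wr /eqP gw]; apply/implyP=> /existsP[i].
rewrite ffunE anc_glue => wi; rewrite permE; rewrite /= par_glue in gw.
have wf : w != f v.
  by apply: contra wr => /eqP wE; rewrite -par_fix ?is_ltree_glue // par_glue gw wE.
have [pw [[u [cw ur pu]]|cw]] := child_gp_f H gw wf; last first.
  by have := marked_below H wi; rewrite cw.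
(* The automorphism preserves colours and roots of pieces, and the class [(u, true)] has only one
   root. *)
apply/eqP/(glued_root H); rewrite ?(glued_ca H) ?cw //.
by rewrite -(glued_comm H) pw.
Qed.

Lemma glue_class : (glue_cotree, glue_aut, glue_marks) \in Vclass t0 n N.
Proof.
rewrite inE is_cotree_glue canonical_glue is_aut_glue /=.
have -> : induces t0 glue_cotree glue_marks.
  by apply/existsP; exists f; apply: glue_witness.
rewrite fixes_glue !andbT /=.
apply/andP; split; last by apply/forallP=> i; rewrite ffunE leaf_glue_f leaf_lab.
apply/injectiveP=> i j; rewrite !ffunE => /(glued_f_inj H).
by have /is_ltreeP[_ _ _ li _] := tT0 => /li.
Qed.

End GlueTree.

Lemma height_lt (N : finType) (p : N -> N) x y : acyclic p ->
  fconnect p y x -> y <> x -> height p x < height p y.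
Proof.
move=> pA; elim/(acyclic_ind pA): y => [y py /(fconnect_fix py) -> //|y py IH].
rewrite fconnect_eqVf (height_step pA py) => /orP[/eqP //|h _].
by case: (p y =P x) => [->//|/(IH h)/ltnW]; rewrite ltnS.
Qed.

(** A common ancestor of maximal height works, since the ancestors of one element of [S] form a
    chain. *)
Lemma dca_exists (n : nat) (N : finType) (t : ltree n N) (S : {set N}) :
  is_ltree t -> S != set0 -> exists x, is_dca t S x.
Proof.
move=> tT /set0Pn[l0 l0S]; have ac := ltree_acyclic tT.
pose P x := [forall l in S, anc t x l].
have Pr : P (troot t) by apply/forall_inP=> l _; apply: anc_root.
case: (arg_maxnP (height (par t)) Pr) => x Px xM; exists x; rewrite /is_dca -/(P x) Px /=.
apply/forallP=> y; apply/implyP=> Py.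
case/orP: (fconnect_total (forall_inP Px _ l0S) (forall_inP Py _ l0S)) => // yx.
have [->|/eqP ne] := eqVneq x y; first exact: connect0.
have hxy : height (par t) y <= height (par t) x := xM y Py.
by have := height_lt ac yx (nesym ne); rewrite ltnNge hxy.
Qed.

Section SameLeaves.
Variables (k : nat) (N0 : finType) (t0 : cotree k N0).
Hypothesis ht0 : is_cotree t0.
Let tT0 := cotree_ltree ht0.

(** If [v] were strictly below [u], it would be below one child of [u], and another child of [u] has
    labels that are not below [v]. *)
Lemma same_leaves_anc u v : anc t0 u v ->
  (forall i, anc t0 u (lab t0 i) -> anc t0 v (lab t0 i)) -> u = v.
Proof.
move=> uv same; apply/eqP/negPn/negP=> /eqP ne.
have ac := ltree_acyclic tT0.
have [w [pw wu vw]] := fconnect_child ac uv (nesym ne).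
have wc : w \in children t0 u by rewrite childrenE // inE pw eqxx; apply/eqP.
have ui : ~~ leaf t0 u by apply/set0Pn; exists w.
have [y [y' [yc yc' yy]]] := two_children ht0 ui.
have [z zc zw] : exists2 z, z \in children t0 u & z != w.
  by have [yw|] := eqVneq y w; [exists y'; rewrite // -yw eq_sym|exists y].
have [i zi] := exists_label_below tT0 z.
have uz : fconnect (par t0) z u by move: zc; rewrite inE => /andP[_ /eqP <-]; apply: fconnect1.
have vi := same i (connect_trans zi uz).
by case/eqP: zw; apply: (anc_siblings ht0 zc wc zi); apply: connect_trans vi vw.
Qed.

Lemma same_leaves_eq u v :
  (forall i, anc t0 u (lab t0 i) = anc t0 v (lab t0 i)) -> u = v.
Proof.
move=> same; have [i ui] := exists_label_below tT0 u.
have vi := ui; rewrite same in vi.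
case/orP: (fconnect_total ui vi) => h; last by apply: same_leaves_anc h _ => j; rewrite same.
by apply/esym; apply: same_leaves_anc h _ => j; rewrite same.
Qed.

(** On leaves [f] is forced by [l]; an internal [y] is recognised by the labels below it. Hence the
    cut is a function of the marked cotree. *)
Lemma witness_unique (n : nat) (N : finType) (t : cotree n N) (l : {ffun 'I_k -> N}) f g :
  witness t0 t l f -> witness t0 t l g -> f = g.
Proof.
case/and5P=> _ /forallP fl /eqP fD /forallP fA _ /and5P[_ /forallP gl /eqP gD /forallP gA _].
apply/ffunP=> y; have [yl|yi] := boolP (leaf t0 y).
  move: yl; rewrite leaf_codom // => /codomP[i ->].
  by rewrite (eqP (fl i)) (eqP (gl i)).
have : f y \in g @: internal0 t0 by rewrite gD -fD imset_f // inE.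
case/imsetP=> u _ fu; rewrite fu; congr (g _); apply: same_leaves_eq => i.
have /forallP/(_ (lab t0 i))/eqP -> := gA u.
have /forallP/(_ (lab t0 i))/eqP -> := fA y.
by rewrite fu (eqP (gl i)) (eqP (fl i)).
Qed.

End SameLeaves.

(** * Cutting a marked canonical cotree *)

Section Cut.
Variables (k : nat) (N0 : finType) (t0 : cotree k N0) (n : nat) (N : finType).
Notation root0 := (troot t0).

Section CutDef.
Variables (t : ltree n N) (a : {perm N}) (f : {ffun N0 -> N}).

Definition cut_struct : fstruct N :=
  [ffun x => (if par t x \in f @: internal0 t0 then x else par t x, a x, x \in codom f)].

(** The colour is read at the root of the piece: [(y, true)] if it is also the root above [f y],
    otherwise [(v, false)] from the node [f v] it was cut from. The final default is not reached
    when [f] is a witness. *)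
Definition cut_color : {ffun N -> N0 * bool} := [ffun x =>
  let r := top (sp cut_struct) x in
  if [pick y | top (sp cut_struct) (f y) == r] is Some y then (y, true)
  else if [pick v | f v == par t r] is Some v then (v, false) else (root0, false)].

End CutDef.

Variables (t : cotree n N) (a : {perm N}) (l : {ffun 'I_k -> N}) (f : {ffun N0 -> N}).
Hypotheses (hk : 2 <= k) (ht0 : is_cotree t0).
Hypotheses (tC : is_cotree t) (cT : canonical t) (aT : is_aut t a).
Hypotheses (W : witness t0 t l f) (fx : fixes_dcas t a l).

Let tT0 := cotree_ltree ht0.
Let tT := cotree_ltree tC.
Let ac0 := ltree_acyclic tT0.
Let ac := ltree_acyclic tT.
Notation p := (par t).
Notation FI := (f @: internal0 t0).
Notation s := (cut_struct t a f).
Notation cp := (sp (cut_struct t a f)).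
Notation cc := (cut_color t a f).

Lemma cut_inj : injective f.
Proof. by case/and5P: W => /injectiveP. Qed.

Lemma cut_lab i : f (lab t0 i) = l i.
Proof. by case/and5P: W => _ /forallP/(_ i)/eqP. Qed.

Lemma cut_dcas : dcas t l = FI.
Proof. by case/and5P: W => _ _ /eqP. Qed.

Lemma cut_anc x y : fconnect p (f y) (f x) = anc t0 x y.
Proof. by case/and5P: W => _ _ _ /forallP/(_ x)/forallP/(_ y)/eqP -> _. Qed.

Lemma cut_dec x : dec t (f x) = dec t0 x.
Proof. by case/and5P: W => _ _ _ _ /forallP/(_ x)/eqP. Qed.

Lemma cut_leaf x : leaf t (f x) = leaf t0 x.
Proof.
have /andP[_ /forallP/(_ x)/eqP <-] := ht0.
by have /andP[_ /forallP/(_ (f x))/eqP <-] := tC; rewrite cut_dec.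
Qed.

Lemma mem_FI y : (f y \in FI) = ~~ leaf t0 y.
Proof. by rewrite mem_imset ?inE //; apply: cut_inj. Qed.

Lemma cpE x : cp x = if p x \in FI then x else p x.
Proof. by rewrite /sp ffunE. Qed.

Lemma cp_step x : cp x <> x -> p x \notin FI /\ cp x = p x.
Proof. by rewrite cpE; case: ifP. Qed.

Lemma cp_fix x : cp x = x -> p x \in FI \/ p x = x.
Proof. by rewrite cpE; case: ifP => _; [left|right]. Qed.

Lemma cp_acyclic : acyclic cp.
Proof.
apply: acyclicP => x; elim/(acyclic_ind ac): x => x px.
  by exists x; rewrite ?connect0 // cpE px; case: ifP.
case=> y cy xy; case: (cp x =P x) => [cx|/cp_step[_ cx]].
  by exists x; rewrite ?connect0.
by exists y => //; apply: connect_trans xy; rewrite -cx fconnect1.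
Qed.
Let acc := cp_acyclic.

Lemma fconnect_cp x z : fconnect cp x z -> fconnect p x z.
Proof.
case/fconnectP=> j; elim: j x => [x <-|j IHj x]; first exact: connect0.
rewrite iterSr => /IHj; case: (cp x =P x) => [-> //|/cp_step[_ ->]].
exact/connect_trans/fconnect1.
Qed.

Lemma fconnect_cp_FI x z : fconnect cp x z -> z \in FI -> x = z.
Proof.
move=> xz zF; apply/eqP/negPn/negP=> /eqP ne.
have [w [cw wz _]] := fconnect_child acc xz ne.
have cw' : cp w <> w by rewrite cw => /esym.
by have [pF cE] := cp_step cw'; rewrite -cE cw zF in pF.
Qed.

Lemma fconnect_cp_or x z : fconnect p x z ->
  fconnect cp x z \/ fconnect p (p (top cp x)) z.
Proof.
elim/(acyclic_ind acc): x => x cx.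
  have -> : top cp x = x by apply: top_unique (connect0 _ _).
  by rewrite fconnect_eqVf => /orP[/eqP ->|]; [left; apply: connect0|right].
have [_ cpx] := cp_step cx.
move=> IH; rewrite fconnect_eqVf => /orP[/eqP ->|]; first by left; apply: connect0.
rewrite -cpx => /IH[h|]; last by rewrite top_step; [right|].
by left; apply: connect_trans h; apply: fconnect1.
Qed.

Notation cr := (fun y => top cp (f y)).

Lemma cp_cr y : cp (cr y) = cr y. Proof. exact: top_fix. Qed.

Lemma fconnect_cr y : fconnect p (f y) (cr y).
Proof. exact/fconnect_cp/fconnect_top. Qed.

(** [f (par t0 y)] is above [f y] and outside its piece, so the piece hangs from some [f v] with [v]
    between [par t0 y] and [y]; [v = y] would make [f y] its own proper ancestor. *)
Lemma par_cr y : y != root0 -> p (cr y) = f (par t0 y) /\ p (cr y) <> cr y.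
Proof.
move=> yr; have yp : par t0 y != y by rewrite par_fix.
have zF : f (par t0 y) \in FI by rewrite mem_FI par_internal.
have fz : fconnect p (f y) (f (par t0 y)) by rewrite cut_anc /anc fconnect1.
have zr : fconnect p (p (cr y)) (f (par t0 y)).
  case: (fconnect_cp_or fz) => // /fconnect_cp_FI/(_ zF)/cut_inj yE.
  by rewrite -yE eqxx in yp.
have np : p (cr y) <> cr y.
  move=> pr; rewrite pr in zr; have zE := fconnect_fix pr zr.
  have := fconnect_cp_FI (fconnect_top acc (f y)); rewrite -zE => /(_ zF)/cut_inj yE.
  by rewrite -yE eqxx in yp.
split=> //; case: (cp_fix (cp_cr y)) => // /imsetP[v _ vE].
move: zr; rewrite vE cut_anc => vp.
have : anc t0 v y.
  by rewrite -cut_anc -vE; apply: connect_trans (fconnect_cr y) _; apply: fconnect1.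
rewrite /anc fconnect_eqVf => /orP[/eqP yv|h]; last by rewrite (fconnect_anti ac0 h vp).
case: np; rewrite vE -yv; apply: fconnect_anti ac _ _ (fconnect_cr y) _.
by rewrite {2}yv -vE fconnect1.
Qed.

Lemma cr_root : cr root0 = troot t.
Proof.
apply/eqP; rewrite -par_fix //; apply/eqP.
case: (cp_fix (cp_cr root0)) => // /imsetP[v _ vE].
have : anc t0 v root0.
  by rewrite -cut_anc -vE; apply: connect_trans (fconnect_cr _) _; apply: fconnect1.
move/(fconnect_fix (par_root tT0)) => vr; rewrite vr in vE.
rewrite vE; apply: fconnect_anti ac _ _ (fconnect_cr _) _.
by rewrite -{2}vE fconnect1.
Qed.

(** Here it matters that [f] reaches all deepest common ancestors. If [y] and [y'] shared a piece,
    that of two marked leaves, one below each, would be some [f u] below the root of the piece. Then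
    [u] lies below both siblings [y] and [y'], which must coincide. *)
Lemma cr_inj : injective (fun y => cr y).
Proof.
move=> y y' rr; have [yr|yr] := eqVneq y root0.
  have [-> //|/par_cr[_]] := eqVneq y' root0.
  by rewrite -rr yr cr_root par_root.
have [pr npr] := par_cr yr.
have yr' : y' != root0.
  by apply/eqP=> yE; apply: npr; rewrite rr yE cr_root par_root.
have pp : par t0 y = par t0 y' by apply: cut_inj; rewrite -pr rr; case: (par_cr yr').
have [i yi] := exists_label_below tT0 y; have [j yj] := exists_label_below tT0 y'.
have lr z i' : anc t0 z (lab t0 i') -> fconnect p (l i') (cr z).
  by rewrite -cut_anc cut_lab => h; apply: connect_trans h (fconnect_cr z).
have [|x xd] := @dca_exists _ _ t (l @: [set i; j]) tT.
  by rewrite imset_eq0; apply/set0Pn; exists i; apply: set21.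
(* [dcas] requires two distinct labels; a label common to both sides settles the claim at once. *)
have [ij|ij] := eqVneq i j.
  by apply: siblings_eq tT0 yr yr' pp yi _; rewrite ij.
have : x \in FI.
  by rewrite -cut_dcas inE; apply/existsP; exists [set i; j]; rewrite cards2 ij.
case/imsetP=> u _ xE; case/andP: xd => /forall_inP xl /forallP xM.
have ui : anc t0 u (lab t0 i).
  by rewrite -cut_anc -xE cut_lab; apply/xl/imset_f/set21.
have uj : anc t0 u (lab t0 j).
  by rewrite -cut_anc -xE cut_lab; apply/xl/imset_f/set22.
have ur : fconnect p (f u) (cr y).
  rewrite -xE; have /implyP := xM (cr y); apply.
  apply/forall_inP=> w /imsetP[i' + ->]; rewrite !inE => /orP[]/eqP ->; first exact: lr.
  by rewrite rr; apply: lr.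
have vu : anc t0 (par t0 y) u.
  by rewrite -cut_anc -pr; apply: connect_trans ur _; apply: fconnect1.
have uv : u <> par t0 y.
  move=> uE; apply: npr; rewrite pr -uE; apply: fconnect_anti ac _ _ ur _.
  by rewrite uE -pr fconnect1.
have below z i' : par t0 z = par t0 y -> anc t0 z (lab t0 i') -> anc t0 u (lab t0 i') -> anc t0 z u.
  move=> zp zi ui'; case/orP: (fconnect_total zi ui') => // .
  rewrite fconnect_eqVf => /orP[/eqP ->|]; first exact: connect0.
  by rewrite zp => h; case: uv; apply: fconnect_anti ac0 _ _ vu h.
exact: siblings_eq tT0 yr yr' pp (below y i erefl yi ui) (below y' j (esym pp) yj uj).
Qed.

Lemma aut_par x : a (p x) = p (a x).
Proof. by move: x; apply/(is_autP tT). Qed.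

Lemma aut_FI v : v \in FI -> a v = v.
Proof. by rewrite -cut_dcas => vd; have /forall_inP/(_ v vd)/andP[/eqP] := fx. Qed.

Lemma aut_mem_FI x : (a x \in FI) = (x \in FI).
Proof.
apply/idP/idP => [h|xF]; last by rewrite aut_FI.
by have /perm_inj <- := aut_FI h.
Qed.

(** For [y] other than the root this is condition (ii): the root of the piece of [y] is a child of
    the deepest common ancestor [f (par t0 y)] and has a marked leaf below it. *)
Lemma aut_cr y : a (cr y) = cr y.
Proof.
have [->|yr] := eqVneq y root0.
  by rewrite cr_root; apply/eqP; rewrite -par_fix // -aut_par par_root.
have [pr npr] := par_cr yr.
have vd : f (par t0 y) \in dcas t l by rewrite cut_dcas mem_FI par_internal.
have /forall_inP/(_ _ vd)/andP[_ /forall_inP/(_ (cr y))] := fx.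
rewrite childrenE // inE pr eqxx /= => h; apply/eqP; move: h; rewrite -pr.
rewrite (introF eqP (nesym npr)) => /(_ isT)/implyP; apply.
have [i yi] := exists_label_below tT0 y; apply/existsP; exists i.
by move: yi; rewrite -cut_anc cut_lab => h; apply: connect_trans h (fconnect_cr y).
Qed.

Lemma aut_cp x : a (cp x) = cp (a x).
Proof. by rewrite !cpE -aut_par aut_mem_FI; case: ifP. Qed.

Lemma aut_top x : top cp (a x) = a (top cp x).
Proof.
apply: (top_unique acc); first by rewrite -aut_cp top_fix.
have /fconnectP[j <-] := fconnect_top acc x.
elim: j => [|j IHj] /=; first exact: connect0.
by rewrite aut_cp; apply: connect_trans IHj (fconnect1 _ _).
Qed.

Lemma cc_stem x y : top cp x = cr y -> cc x = (y, true).
Proof.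
move=> xy; rewrite ffunE /= xy; case: pickP => [y' /eqP/cr_inj -> //|/(_ y)].
by rewrite eqxx.
Qed.

Lemma cc_forest x : (forall y, top cp x <> cr y) ->
  exists v, [/\ ~~ leaf t0 v, p (top cp x) = f v & cc x = (v, false)].
Proof.
move=> h; case: (cp_fix (top_fix acc x)) => [/imsetP[v]|px]; last first.
  by case: (h root0); rewrite cr_root; apply/eqP; rewrite -par_fix // px.
rewrite inE => vi vE; exists v; split=> //; rewrite ffunE /=.
case: pickP => [y /eqP yE|_]; first by case: (h y).
case: pickP => [w /eqP|/(_ v)]; last by rewrite vE eqxx.
by rewrite vE => /cut_inj ->.
Qed.

Lemma ccP x : (exists2 y, top cp x = cr y & cc x = (y, true)) \/
  (exists v, [/\ ~~ leaf t0 v, p (top cp x) = f v, cc x = (v, false)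
               & forall y, top cp x <> cr y]).
Proof.
have [/existsP[y /eqP yE]|h] := boolP [exists y, top cp x == cr y].
  by left; exists y; rewrite ?(cc_stem yE).
have {}h y : top cp x <> cr y.
  by move=> yE; case/negP: h; apply/existsP; exists y; apply/eqP.
by right; have [v [? ? ?]] := cc_forest h; exists v.
Qed.

Lemma cc_f y : cc (f y) = (y, true). Proof. exact: cc_stem. Qed.

Lemma fkids_cp x : fkids cp x = if x \in FI then set0 else fkids p x.
Proof.
apply/setP=> w; rewrite inE cpE; have [xF|/negbTE xF] := boolP (x \in FI).
  rewrite inE; apply/andP=> -[/eqP + wx]; case: ifP => [_ wE|/negP h xE].
    by rewrite wE eqxx in wx.
  by apply: h; rewrite xE.
rewrite inE; case: ifP => [pF|//]; have [->|wx] := eqVneq w x; rewrite ?andbF // !andbT.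
by apply/esym/negP=> /eqP pw; rewrite pw xF in pF.
Qed.

Lemma top_cp_id x : cp x = x -> top cp x = x.
Proof. by move=> cx; apply: top_unique (connect0 _ _). Qed.

Lemma height_cp x : height p x = height cp x + height p (top cp x).
Proof.
elim/(acyclic_ind acc): x => x cx; first by rewrite top_cp_id // (height_fix cx).
have [_ cpx] := cp_step cx; move=> IH.
rewrite (height_step acc cx) (height_step (p := p) ac) -?cpx ?IH ?top_step //.
Qed.

Lemma cut_glued : glued t0 cc s f.
Proof.
have cc_top x x' : top cp x = top cp x' -> cc x = cc x' by rewrite !ffunE /= => ->.
have saE x : sa s x = a x by rewrite /sa ffunE.
have smE x : sm s x = (x \in codom f) by rewrite /sm ffunE.
split.
- by move=> x; apply: cc_top; rewrite top_step.
- move=> x; rewrite saE; case: (ccP x) => [[y yE ->]|[v [vi pv -> h]]].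
    by apply: cc_stem; rewrite aut_top yE aut_cr.
  (* The roots above the nodes [f y] are fixed, so by injectivity a tree of a forest is not sent
     onto one of their pieces; its image hangs from the same fixed [f v]. *)
  have [|w [_ pw ->]] := @cc_forest (a x).
    by move=> y; rewrite aut_top -aut_cr => /perm_inj; apply: h.
  congr (_, _); apply: cut_inj; rewrite -pw aut_top -aut_par pv aut_FI //.
  by rewrite mem_FI.
- exact: acc.
- move=> x; rewrite fkids_cp; case: ifP => _; first by rewrite cards0.
  by have /is_ltreeP[] := tT.
- by move=> x; rewrite !saE aut_cp.
- by move=> x y; rewrite !saE => /perm_inj.
- exact: cc_f.
- by move=> x; rewrite smE => /codomP[y ->]; rewrite cc_f.
- by move=> y; rewrite smE codom_f.
- move=> x x' cx cx' ccE; case: (ccP x) => [[y yE E]|[v [_ _ -> _]] //] _.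
  case: (ccP x') => [[y' yE' E']|[v [_ _ E' _]]]; last by rewrite ccE E' in E.
  move: ccE; rewrite E E' => -[yy].
  by rewrite -(top_cp_id cx) -(top_cp_id cx') yE yE' yy.
- move=> y; rewrite fkids_cp mem_FI; case: ifPn => //; rewrite negbK => yl.
  by apply/eqP; rewrite -leafE // cut_leaf.
- by move=> y yi; rewrite saE aut_FI // mem_FI.
(* In [t] the heights of [f y] and [f (par t0 y)] differ by the height within the piece plus one,
   and canonical decorations compare by the parity of this difference. *)
- move=> y yi yr; have [pr npr] := par_cr yr.
  have := canonical_dec (x := f y) (y := f (par t0 y)) tC cT.
  rewrite !cut_leaf yi par_internal // => /(_ isT isT); rewrite !cut_dec.
  have [b ->] := dec_internal ht0 yi.
  have [b' ->] /= := dec_internal ht0 (par_internal yr).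
  rewrite (height_cp (f y)) (height_step ac npr) pr oddD /= => -[->].
  by do 2 case: (odd _); case: b'.
- by move=> x; case: (ccP x) => [[y _ ->]|[v [vi _ -> _]]].
Qed.

Lemma glue_cut x : glue_par t0 cc s f x = p x.
Proof.
case: (cp x =P x) => [cx|cx]; last by rewrite gp_step // (cp_step cx).2.
have tx := top_cp_id cx; case: (ccP x); rewrite tx.
  case=> y xE cE; have [yr|yr] := eqVneq y root0.
    rewrite gp_root // ?cE ?yr //; apply/esym/eqP.
    by rewrite par_fix // xE yr cr_root.
  by rewrite (gp_stem cx cE yr) xE; case: (par_cr yr).
by case=> v [_ -> cE _]; rewrite (gp_forest cx cE).
Qed.

(** The formula of [glue_cotree]: given [t0], the decorations carry no information beyond the parent
    map and [f]. *)
Lemma cut_decE x : dec t x = if leaf t x then None else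
  omap (addb (odd (height p x) (+) odd (height p (f root0)))) (dec t0 root0).
Proof.
case: ifPn => [xl|xi].
  by have /andP[_ /forallP/(_ x)] := tC; rewrite xl => /eqP/eqP.
by rewrite (canonical_dec (y := f root0) tC cT xi) ?cut_dec // cut_leaf root_internal.
Qed.

End Cut.

(** * The bijection between marked cotrees and coloured structures *)

Section Good.
Variables (k : nat) (N0 : finType) (t0 : cotree k N0).
Hypotheses (hk : 2 <= k) (ht0 : is_cotree t0).
Notation root0 := (troot t0).

Definition color_class (N : finType) (c : {ffun N -> N0 * bool}) i : {set N} :=
  [set x | c x == i].

(** The index condition produced by [mass_prod] once the colouring is summed over as well. *)
Definition good_pair (N : finType) (u : {ffun N -> N0 * bool} * fstruct N) : bool :=
  [forall x, (u.1 (sp u.2 x) == u.1 x) && (u.1 (sa u.2 x) == u.1 x)]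
  && [forall i, of_kind (color_class u.1 i) u.2 (color_kind t0 i)].

Variable N : finType.
Implicit Types (c : {ffun N -> N0 * bool}) (s : fstruct N).

Section Kids.
Variables (c : {ffun N -> N0 * bool}) (s : fstruct N).
Hypothesis cp : forall x, c (sp s x) = c x.

Lemma kids_color i x : c x = i -> kids (color_class c i) s x = fkids (sp s) x.
Proof.
move=> <-; apply/setP=> y; rewrite !inE; case: (sp s y =P x) => [<-|]; last by rewrite andbF.
by rewrite cp eqxx.
Qed.

Lemma mem_leafset_color i x :
  (x \in leafset (color_class c i) s) = (c x == i) && (fkids (sp s) x == set0).
Proof. by rewrite !inE; apply: andb_id2l => /eqP /kids_color ->. Qed.
End Kids.

Lemma is_stem_color y b : is_stem (color_kind t0 (y, b)) = b && ~~ leaf t0 y.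
Proof. by rewrite /=; case: b; case: (leaf t0 y) => //=; case: eqP. Qed.

(** The local conditions on the colour classes assemble into global ones because both maps preserve
    colours, so the children of a node stay in its class. *)
Lemma good_pairP c s :
  reflect (exists f : {ffun N0 -> N}, glued t0 c s f) (good_pair (c, s)).
Proof.
apply: (iffP andP) => /= [[/forallP cE /forallP kE]|[f H]].
  have cp x : c (sp s x) = c x by have /andP[/eqP] := cE x.
  have ca x : c (sa s x) = c x by have /andP[_ /eqP] := cE x.
  have fE x : [&& sa s (sp s x) == sp s (sa s x), #|fkids (sp s) x| != 1
      & [exists y, (sp s y == y) && fconnect (sp s) x y]].
    have /andP[/andP[/forall_inP/(_ x) + _] _] := kE (c x).
    rewrite inE eqxx => /(_ isT)/and3P[-> + /exists_inP[y _ yE]]; rewrite kids_color // => -> /=.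
    by apply/existsP; exists y.
  have mT y : exists x, markset (color_class c (y, true)) s = [set x].
    apply/cards1P; have /andP[_] := kE (y, true) => /=.
    by case: ifP => _; [case/and3P|case: ifP => _ /and4P[]].
  (* Each class [(y, true)] is a stem or a pointed tree and has exactly one mark, which is taken as
     [f y]. *)
  have [f0 f0E] := fin_all_exists mT; pose f : {ffun N0 -> N} := [ffun y => f0 y].
  have fm y : markset (color_class c (y, true)) s = [set f y] by rewrite ffunE.
  have fmE x y : (c x == (y, true)) && sm s x = (x == f y).
    by have /setP/(_ x) := fm y; rewrite !inE.
  have fy y : c (f y) = (y, true) /\ sm s (f y).
    by have := fmE (f y) y; rewrite eqxx => /andP[/eqP ? ?].
  have stemP y : ~~ leaf t0 y -> of_kind (color_class c (y, true)) s
      (Stem (if y == root0 then None else Some (dec t0 y == dec t0 (par t0 y)))).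
    by move=> yi; have := kE (y, true); rewrite /= (negbTE yi); case: ifP.
  exists f; split=> //.
  - apply: acyclicP => x; have /and3P[_ _ /existsP[y /andP[/eqP py xy]]] := fE x.
    by exists y.
  - by move=> x; have /and3P[] := fE x.
  - by move=> x; have /and3P[/eqP] := fE x.
  - move=> x y xy; have cxy : c x = c y by rewrite -ca xy ca.
    have xA : x \in color_class c (c y) by rewrite inE cxy.
    have yA : y \in color_class c (c y) by rewrite inE.
    have /andP[/andP[_ /forall_inP/(_ x xA)/forall_inP/(_ y yA) xyE] _] := kE (c y).
    by move: xyE; rewrite xy eqxx => /eqP.
  - by move=> y; case: (fy y).
  - move=> x mx; case E: (c x) => [y [|]] /=; first by apply/eqP; rewrite -fmE E eqxx mx.
    have /andP[_] := kE (y, false); rewrite /=; case: ifP => _.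
      by move/eqP/setP/(_ x); rewrite !inE E eqxx.
    by rewrite cards_eq0 => /eqP/setP/(_ x); rewrite !inE E eqxx mx.
  - by move=> y; case: (fy y).
  - move=> x x' px px' cc; case E: (c x) => [y b] /= bT; rewrite bT in E.
    have /cards1P[r rE] : #|rootset (color_class c (y, true)) s| == 1.
      have /andP[_] := kE (y, true) => /=.
      by case: ifP => _; [case/and3P|case: ifP => _ /and4P[]].
    have rP z : c z = (y, true) -> sp s z = z -> z = r.
      by move=> cz pz; apply/eqP; have /setP/(_ z) := rE; rewrite !inE cz pz !eqxx.
    by rewrite (rP x) // (rP x') // -cc.
  - move=> y; apply/eqP; have [cy my] := fy y.
    suff : f y \in leafset (color_class c (y, true)) s.
      by rewrite mem_leafset_color // => /andP[].
    have fM : f y \in markset (color_class c (y, true)) s by rewrite fm inE.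
    have /andP[_] := kE (y, true) => /=.
    by case: ifP => _; [case/and3P|case: ifP => _ /and4P[]] => _ _ /subsetP h *; apply: h.
  - move=> y /stemP/andP[_ /and4P[_ _ _ /forall_inP/(_ (f y))]].
    by rewrite fm inE eqxx => /(_ isT)/andP[/eqP].
  - move=> y /stemP/andP[_ /and4P[_ _ _ /forall_inP/(_ (f y))]] + yr.
    by rewrite fm inE eqxx (negbTE yr) => /(_ isT)/andP[_ /eqP].
  - move=> x; case E: (c x) => [y [|]] //= _; apply/negP=> yl.
    have /andP[_] := kE (y, false); rewrite /= yl => /eqP/setP/(_ x).
    by rewrite !inE E eqxx.
have cp := glued_cp H; have ca := glued_ca H.
split; first by apply/forallP=> x; rewrite cp ca !eqxx.
have fA i : forest_aut (color_class c i) s.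
  apply/andP; split; apply/forall_inP=> x; rewrite inE => /eqP cx; last first.
    apply/forall_inP=> y _; apply/implyP=> /eqP/(glued_inj H) ->.
    by rewrite eqxx.
  rewrite (kids_color cp cx) (glued_branch H) (glued_comm H) eqxx /=.
  have [pt xt] := topP (glued_acyclic H) x.
  apply/exists_inP; exists (top (sp s) x); last by rewrite pt eqxx.
  by rewrite inE (c_fconnect_sp H xt) cx.
have mT y : markset (color_class c (y, true)) s = [set f y].
  apply/setP=> x; rewrite !inE (glued_markE H); apply/andP/eqP.
    by case=> /eqP -> /eqP.
  by move=> ->; rewrite (glued_color H) !eqxx.
have mF y : markset (color_class c (y, false)) s = set0.
  apply/setP=> x; rewrite !inE (glued_markE H); apply/andP=> -[/eqP cx /eqP xE].
  by move: cx; rewrite xE (glued_color H).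
have rT y : rootset (color_class c (y, true)) s = [set stem_top s f y].
  apply/setP=> x; rewrite !inE; apply/andP/eqP => [[/eqP cx /eqP px]|->].
    exact: (stem_topP H).
  by rewrite (c_stem_top H) (sp_stem_top H) !eqxx.
have lT y : [set f y] \subset leafset (color_class c (y, true)) s.
  by rewrite sub1set (mem_leafset_color cp) (glued_color H) (glued_leaf H) !eqxx.
apply/forallP=> -[y b]; rewrite /of_kind fA; case: b => /=; last first.
  case: ifPn => yl; last by rewrite mF cards0.
  apply/eqP/setP=> x; rewrite !inE; apply/negP=> /eqP cx.
  by have := glued_internal H (x := x); rewrite cx yl => /(_ isT).
rewrite mT rT !cards1; case: ifPn => yl; first by rewrite lT.
have [->|yr] := eqVneq y root0; rewrite lT /=.
  by apply/forall_inP=> x; rewrite inE => /eqP ->; rewrite (glued_fix H) ?eqxx ?root_internal.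
apply/forall_inP=> x; rewrite inE => /eqP ->.
by rewrite (glued_fix H) // (glued_parity H) // !eqxx.
Qed.

Lemma weight_good c s : good_pair (c, s) ->
  \sum_i weight (color_class c i) s (color_kind t0 i) = #|free_leaves t0 c s|.
Proof.
case/good_pairP=> f H; rewrite -[RHS]sum1_card (partition_big c predT) //=.
apply: eq_bigr => -[y b] _; rewrite sum1dep_card; apply: eq_card => x.
rewrite !inE; case: (c x =P (y, b)) => [cx|]; last by rewrite andbF.
rewrite (kids_color (glued_cp H) cx) cx /= andbT; congr (_ && ~~ _).
rewrite -/(color_kind t0 (y, b)) is_stem_color andbC.
case: b cx => //= cx; rewrite (glued_markE H); case: eqP => // xE.
by move: cx; rewrite xE (glued_color H).
Qed.

Variable n : nat.

Definition cut_pair (v : vstruct k n N) : {ffun N -> N0 * bool} * fstruct N :=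
  let: (t, a, l) := v in
  if [pick f | witness t0 t l f] is Some f
  then (cut_color t0 t a f, cut_struct t0 t a f)
  else ([ffun=> (root0, true)], [ffun x => (x, x, false)]).

Lemma VclassP t a l : reflect
  (exists f, [/\ is_cotree t /\ canonical t, is_aut t a, witness t0 t l f,
    fixes_dcas t a l
  & cut_pair (t, a, l) = (cut_color t0 t a f, cut_struct t0 t a f)])
  ((t, a, l) \in Vclass t0 n N).
Proof.
apply: (iffP idP).
  rewrite inE => /and5P[tC cT aT _ /and3P[_ /existsP[g gW] fx]].
  rewrite /cut_pair; case: pickP => [f fW|/(_ g)]; first by exists f.
  by rewrite /witness gW.
case=> f [[tC cT] aT W fx _]; rewrite inE tC cT aT fx andbT /=.
have lE := cut_lab W.
apply/and3P; split; last by apply/existsP; exists f.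
- apply/injectiveP=> i j; rewrite -!lE => /(cut_inj W).
  by have /is_ltreeP[_ _ _ li _] := cotree_ltree ht0 => /li.
- by apply/forallP=> i; rewrite -lE (cut_leaf ht0 tC W) leaf_lab // cotree_ltree.
Qed.

Lemma card_V : #|Vclass t0 n N| =
  n`! * #|[set u : {ffun N -> N0 * bool} * fstruct N |
           good_pair u && (#|free_leaves t0 u.1 u.2| == n)]|.
Proof.
rewrite (card_fibration
  (good := fun u : {ffun N -> N0 * bool} * fstruct N =>
     good_pair u && (#|free_leaves t0 u.1 u.2| == n))
  (LB := fun u : {ffun N -> N0 * bool} * fstruct N => labelings n (free_leaves t0 u.1 u.2))
  (r := cut_pair) (la := fun v : vstruct k n N => lab v.1.1)).
- rewrite mulnC -sum1dep_card big_distrl; apply: eq_big => [//|u /andP[_ /eqP w]].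
  by rewrite card_labelings //= mul1n.
- case=> [[t a] l] /VclassP[f [[tC cT] aT W fx ->]] /=.
  have H := cut_glued ht0 tC cT aT W fx.
  have -> : good_pair (cut_color t0 t a f, cut_struct t0 t a f) by apply/good_pairP; exists f.
  have tT := cotree_ltree tC.
  have -> : free_leaves t0 (cut_color t0 t a f) (cut_struct t0 t a f) = [set x | leaf t x].
    apply/setP=> x; rewrite (free_leavesE ht0 H) inE leafE //; congr (_ == _).
    by apply/setP=> y; rewrite !inE (glue_cut a ht0 tC W).
  rewrite labelings_lab // andbT /=; apply/eqP.
  rewrite -[RHS]card_ord; have /is_ltreeP[_ _ _ li _] := tT.
  by rewrite -(card_codom li) cardsE; apply: eq_card => x; rewrite [LHS]leaf_codom.
- case=> [[t a] l] [[t' a'] l'] /VclassP[f [[tC cT] aT W fx ->]].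
  case/VclassP=> f' [[tC' cT'] aT' W' fx' ->].
  case=> cE sE /= labE.
  have H := cut_glued ht0 tC cT aT W fx.
  have H' := cut_glued ht0 tC' cT' aT' W' fx'.
  (* The pair determines the embedding: [f y] is the marked node of colour [(y, true)]. *)
  have ff : f = f'.
    apply/ffunP=> y; have := glued_mark H (x := f' y); rewrite sE cE.
    by rewrite (glued_marked H') (glued_color H') => /(_ isT).
  subst f'.
  have pE : par t =1 par t'.
    move=> x; rewrite -(glue_cut a ht0 tC W) -(glue_cut a' ht0 tC' W').
    by rewrite cE sE.
  have tE : ctree t = ctree t' by apply: ltree_eq; rewrite ?cotree_ltree.
  congr (_, _, _).
  + have dE : dec t = dec t'.
      by apply/ffunP=> x; rewrite (cut_decE hk ht0 tC cT W) (cut_decE hk ht0 tC' cT' W') tE.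
    by case: (t) (t') tE dE => [u d] [u' d'] /= -> ->.
  + by apply/permP=> x; move/ffunP/(_ x): sE; rewrite !ffunE => -[].
  + by apply/ffunP=> i; rewrite -(cut_lab W) -(cut_lab W').
case=> c s lb /andP[/good_pairP[f H] _] /= lbL.
exists (glue_cotree t0 c s f lb, glue_aut H, glue_marks t0 f); first exact: glue_class.
split=> //; have /VclassP[g [[tC cT] aT W fx ->]] := glue_class hk ht0 H lbL.
(* The cut picks its own witness; uniqueness identifies it with the [f] used for gluing. *)
have gf : g = f := witness_unique ht0 W (glue_witness hk ht0 H lbL); subst g.
have sE : cut_struct t0 (glue_cotree t0 c s f lb) (glue_aut H) f = s.
  apply/ffunP=> x; rewrite ffunE permE par_glue.
  have -> : (x \in codom f) = sm s x.
    rewrite (glued_markE H); apply/codomP/eqP => [[y ->]|]; first by rewrite (glued_color H).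
    by exists (c x).1.
  have -> : (if glue_par t0 c s f x \in f @: internal0 t0 then x else glue_par t0 c s f x) = sp s x.
    case: (sp s x =P x) => [px|px]; last first.
      rewrite gp_step // (mem_f_internal H) (glued_markE H); case: eqP => // E.
      (* A mark has no kids within its piece, so no edge inside a piece is cut. *)
      have := glued_leaf H (c (sp s x)).1 => /setP/(_ x); rewrite !inE -E eqxx /=.
      by move/negbT; rewrite negbK => /eqP xE; case: px; rewrite -xE.
    rewrite px; case: ifP => // /negbT.
    case: (gpP H x) => [[_ [->//|->//]]|[y [_ _ yr ->]]|[y [_ _ yi ->]]].
      by rewrite imset_f // inE par_internal.
    by rewrite imset_f // inE.
  by rewrite /sp /sa /sm; case: (s x) => [[]].
rewrite sE; congr (_, _); apply/ffunP=> x.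
have xt := fconnect_top (glued_acyclic H) x; have pt := top_fix (glued_acyclic H) x.
have ct := c_fconnect_sp H xt.
case: (ccP (glue_aut H) ht0 tC W x) => [[y]|[v [vi]]]; rewrite sE.
  by move=> xy ->; rewrite -ct xy (c_stem_top H).
rewrite par_glue => pv -> ny; case E: (c x) => [y [|]].
  by case: (ny y); apply: (stem_topP H); rewrite // ct.
move: pv; rewrite (gp_forest pt (etrans ct E)) => /(glued_f_inj H) ->.
by [].
Qed.

End Good.

(** * Counting the factors of each kind *)

Section Edges.
Variables (k : nat) (N0 : finType) (t0 : cotree k N0).
Hypothesis ht0 : is_cotree t0.
Notation root0 := (troot t0).

Lemma card_leaves0 : #|[set y | leaf t0 y]| = k.
Proof.
have tT0 := cotree_ltree ht0; have /is_ltreeP[_ _ _ li _] := tT0.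
rewrite -[RHS]card_ord -(card_codom li) cardsE; apply: eq_card => y.
exact: leaf_codom.
Qed.

(** An edge is determined by its lower end, which ranges over the internal nodes other than the
    root. *)
Lemma card_int_edges (P : rel (option bool)) :
  #|[set e in int_edges t0 | P (dec t0 e.1) (dec t0 e.2)]| =
  #|[set y | [&& ~~ leaf t0 y, y != root0 & P (dec t0 (par t0 y)) (dec t0 y)]]|.
Proof.
have eI : injective (fun y => (par t0 y, y)) by move=> y y' [].
rewrite -(card_imset _ eI); apply: eq_card => -[x y]; rewrite !inE /=.
apply/andP/imsetP => [[/and3P[/andP[yr /eqP px] xi yi] xy]|[y']].
  by exists y; rewrite ?px // inE yi yr px.
rewrite inE => /and3P[yi yr xy] [-> ->]; split=> //.
by rewrite /child yr eqxx yi par_internal.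
Qed.

Local Open Scope ring_scope.

Lemma prod_color_kind (R : comNzRingType) (Q : kind -> R) : (2 <= k)%N -> Q Void = 1 ->
  \prod_i Q (color_kind t0 i) =
    Q (Stem None) * Q Forest ^+ n_int t0 * Q Pointed ^+ k
      * Q (Stem (Some true)) ^+ n_eq t0 * Q (Stem (Some false)) ^+ n_neq t0.
Proof.
move=> hk Q1.
rewrite [LHS](eq_bigr (fun i => Q (color_kind t0 (i.1, i.2)))) => [|[] //].
rewrite -(pair_bigA _ (fun y b => Q (color_kind t0 (y, b)))) /=.
rewrite (eq_bigr (fun y => Q (color_kind t0 (y, true)) * Q (color_kind t0 (y, false)))); last first.
  by move=> y _; rewrite big_bool.
rewrite big_split /= [X in _ * X](bigID (leaf t0)) /=.
rewrite [X in _ * (X * _)]big1 => [|y ->]; last by rewrite Q1.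
rewrite mul1r [X in _ * X](eq_bigr (fun=> Q Forest)) => [|y /negbTE -> //].
rewrite prodr_const [X in X * _](bigID (leaf t0)) /= (eq_bigr (fun=> Q Pointed)) => [|y -> //].
rewrite prodr_const [X in _ * X * _](bigD1 root0) /=; last exact: root_internal.
rewrite (negbTE (root_internal hk ht0)) eqxx.
rewrite (bigID (fun y => dec t0 (par t0 y) == dec t0 y)) /=.
rewrite [X in _ * (_ * (X * _)) * _](eq_bigr (fun=> Q (Stem (Some true)))); last first.
  by move=> y /andP[/andP[/negbTE -> /negbTE ->]]; rewrite eq_sym => ->.
rewrite [X in _ * (_ * (_ * X)) * _](eq_bigr (fun=> Q (Stem (Some false)))); last first.
  by move=> y /andP[/andP[/negbTE -> /negbTE ->]]; rewrite eq_sym => /negbTE ->.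
rewrite !prodr_const.
have -> : #|[pred y | ~~ leaf t0 y]| = n_int t0 by rewrite /n_int cardsE.
have -> : #|leaf t0| = k by rewrite -[RHS]card_leaves0 cardsE.
have -> : n_eq t0 = #|[pred y | ~~ leaf t0 y && (y != root0) & dec t0 (par t0 y) == dec t0 y]|.
  rewrite [LHS](card_int_edges (fun a b => a == b)) cardsE.
  by apply: eq_card => y; rewrite !unfold_in andbA.
have -> : n_neq t0 = #|[pred y | ~~ leaf t0 y && (y != root0) & dec t0 (par t0 y) != dec t0 y]|.
  rewrite [LHS](card_int_edges (fun a b => a != b)) cardsE.
  by apply: eq_card => y; rewrite !unfold_in andbA.
ring.
Qed.

End Edges.

Local Open Scope ring_scope.

Lemma V_series (k : nat) (N0 : finType) (t0 : cotree k N0) n M :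
    (2 <= k)%N -> is_cotree t0 -> (n.*2 + (#|{: N0 * bool}| * 2 + 3) <= M)%N ->
  V t0 n = (\prod_i \sum_(m < M) emass (color_kind t0 i) m)`_n.
Proof.
move=> hk ht0 nM; rewrite -series_prod //.
apply: (egf_classes (cls := fun m =>
  #|equivalence_partition (@Viso k n 'I_m) (Vclass t0 n 'I_m)|)
  (w := fun m => (\sum_(c : {ffun 'I_m -> N0 * bool})
     \prod_i mass (color_kind t0 i) [set x | c x == i])`_n)).
- move=> m; rewrite card_Vclasses card_V // natrM; congr (_ * _).
  under eq_bigr => c _ do rewrite mass_prod.
  rewrite pair_big_dep coef_sum -sum1dep_card natr_sum big_mkcondr [RHS]big_mkcond /=.
  rewrite [LHS]big_mkcond; apply: eq_bigr => -[c s] _ /=.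
  rewrite -[[forall x, _] && _]/(good_pair t0 (c, s)); case: ifP => // cs.
  by rewrite (weight_good hk ht0 cs) coefXn eq_sym; case: eqP.
- move=> m nm; apply/eqP; rewrite -(eqn_pmul2r (fact_gt0 m)) card_Vclasses mul0n cards_eq0.
  apply/eqP/setP=> -[[t a] l]; rewrite !inE; apply/negP=> /and3P[/andP[/ltree_card + _] _ _].
  by rewrite card_ord ltnNge nm.
- by apply: leq_trans nM; apply: leq_addr.
Qed.

Theorem theorem6p4 (k : nat) (N0 : finType) (t0 : cotree k N0)
    (hk : (2 <= k)%N) (ht0 : is_cotree t0) :
  V t0 =1
    (Ustar * (2 * U + 1 - 'z) ^+ n_int t0 * Ubullet ^+ k
       * Uodd ^+ n_eq t0 * Ueven ^+ n_neq t0)%fps.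
Proof.
(* One truncation for all factors: each of the [#|{: N0 * bool}|] colours adds 2 to the intercept of
   the slope bound. *)
move=> n; set M := (n.*2 + (#|{: N0 * bool}| * 2 + 3))%N.
have M3 : (n.*2 + 3 <= M)%N by rewrite leq_add2l leq_addl.
rewrite (@V_series _ _ _ _ M) //.
rewrite (@prod_color_kind _ _ _ ht0 _ (fun K => \sum_(m < M) emass K m)) //; last first.
  by apply: sum_emass_void; apply: leq_trans M3; rewrite addnS.
have ag K f : f =1 series K -> agree n f (\sum_(m < M) emass K m).
  by move=> fK; apply: agree_ext (agree_series K M3) => e.
apply/esym; apply: (_ : agree n _ _) (leqnn n).
apply: agree_mul; last exact: agree_exp (ag _ _ series_Ueven).
apply: agree_mul; last exact: agree_exp (ag _ _ series_Uodd).
apply: agree_mul; last exact: agree_exp (ag _ _ series_Ubullet).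
apply: agree_mul; last exact: agree_exp (ag _ _ series_Uforest).
exact: ag series_Ustar.
Qed.
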